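(* Assume that conditions (A1)–(A4) stated in the context hold. Then there exists a unique Borel probability measure $\mu_*$ on $(0,1)$ such that the Markov chain $(X^{\mu_*}_n)$ (with initial distribution $\mu_*$) is stationary.
   Context: Let $x_0,y_0$ be real numbers, $a_0=\frac{y_0}{x_0}$, $a_1=\frac{1-y_0}{1-x_0}$. Define homeomorphisms $f_0,f_1:[0,1]\to[0,1]$ by $f_0(x)=a_0x$ for $x\le x_0$, $f_0(x)=a_1(x-1)+1$ for $x>x_0$, and $f_1(x)=1-f_0(1-x)$. Let $p_0,p_1:[0,1]\to\mathbb{R}$ be positive functions with $p_0(x)+p_1(x)=1$ for all $x$. Put $\Lambda_0=p_0(0)\log a_0+p_1(0)\log a_1$ and $\Lambda_1=p_0(1)\log a_1+p_1(1)\log a_0$. Conditions: (A1) $\frac12<x_0<1$ and $\frac12\le y_0<x_0$; (A2) $p_0,p_1$ are Dini continuous, i.e. with the modulus of continuity $\beta(t)=\max_{i=0,1}\sup\{|p_i(x)-p_i(x+h)|: x\in(0,1),\ |h|\le t,\ x+h\in[0,1]\}$ one has $\sum_n\beta(Ct^n)<\infty$ for every $C\ge0$ and $0\le t<1$; (A3) $0<p_i(x)<1$ for $x\in[0,1]$, $i=0,1$; (A4) $\Lambda_0>0$ and $\Lambda_1>0$. For a Borel probability measure $\mu$ on $(0,1)$, $(X^\mu_n)_{n\ge0}$ denotes the Markov chain with state space the open interval $(0,1)$, initial distribution $\mu$ and transition probabilities $p(x,\cdot)=p_0(x)\delta_{f_0(x)}+p_1(x)\delta_{f_1(x)}$, $x\in(0,1)$.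 The law of $X_n^\mu$ is $P^n\mu$, where $P\mu(A)=\int_{f_0^{-1}(A)}p_0\,d\mu+\int_{f_1^{-1}(A)}p_1\,d\mu$ for Borel $A\subseteq(0,1)$; the chain $(X^{\mu}_n)$ is stationary if and only if $P\mu=\mu$. *)

(* Defs.v *)
From HB Require Import structures.
From mathcomp Require Import all_boot all_order all_algebra.
From mathcomp Require Import all_classical all_reals all_analysis.

Set Implicit Arguments.
Unset Strict Implicit.
Unset Printing Implicit Defensive.

Import Order.TTheory GRing.Theory Num.Theory.
Import numFieldNormedType.Exports.

Local Open Scope classical_set_scope.
Local Open Scope ring_scope.

Section iterated_function_system.
Context {R : realType}.
Implicit Types (x y t C : R) (p : R -> R).

Definition slope0 x0 y0 : R := y0 / x0.

Definition slope1 x0 y0 : R := (1 - y0) / (1 - x0).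

(* The maps f0, f1 and the weights p0, p1 are total functions on R; only their
   restrictions to [0, 1] are ever constrained or used. *)
Definition f0 x0 y0 x : R :=
  if x <= x0 then slope0 x0 y0 * x else slope1 x0 y0 * (x - 1) + 1.

Definition f1 x0 y0 x : R := 1 - f0 x0 y0 (1 - x).

Definition Lambda0 x0 y0 p0 p1 : R :=
  p0 0 * ln (slope0 x0 y0) + p1 0 * ln (slope1 x0 y0).

Definition Lambda1 x0 y0 p0 p1 : R :=
  p0 1 * ln (slope1 x0 y0) + p1 1 * ln (slope0 x0 y0).

Definition oscillation p t : \bar R :=
  ereal_sup [set `|p z.1 - p (z.1 + z.2)|%:E | z in
    [set z : R * R |
      [/\ 0 < z.1 < 1, `|z.2| <= t & 0 <= z.1 + z.2 <= 1]]].

Definition modulus p0 p1 t : \bar R :=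
  Order.max (oscillation p0 t) (oscillation p1 t).

Definition dini_continuous p0 p1 : Prop :=
  forall C t, 0 <= C -> 0 <= t < 1 ->
    (\sum_(0 <= n <oo) modulus p0 p1 (C * t ^+ n) < +oo)%E.

End iterated_function_system.

Section markov_chain.
Context {R : realType}.
Implicit Types (x y : R) (p : R -> R) (A : set (measurableTypeR R))
  (s : seq (set (measurableTypeR R))).

Definition transition x0 y0 p0 p1 x A : \bar R :=
  ((p0 x)%:E * \d_(f0 x0 y0 x : measurableTypeR R) A
   + (p1 x)%:E * \d_(f1 x0 y0 x : measurableTypeR R) A)%E.

(* Probability that the chain started at x satisfies
   X_1 \in A_1, ..., X_n \in A_n, where s = [:: A_1; ...; A_n]. *)
Fixpoint path_prob x0 y0 p0 p1 s x : \bar R :=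
  match s with
  | [::] => 1%E
  | A :: s' =>
      @integral _ (measurableTypeR R) R (transition x0 y0 p0 p1 x) A
        (path_prob x0 y0 p0 p1 s')
  end.

(* A Borel probability measure on (0, 1) is represented by a Borel probability
   measure on R giving mass 1 to (0, 1). *)
Definition on_unit_interval (mu : probability (measurableTypeR R) R) : Prop :=
  mu `]0%R, 1%R[%classic = 1%E.

(* Finite-dimensional distributions of the chain with initial law mu:
   the probability that X_0 \in A_0, ..., X_n \in A_n, where
   s = [:: A_0; ...; A_n]. *)
Definition chain_law x0 y0 p0 p1 (mu : probability (measurableTypeR R) R) s
    : \bar R :=
  match s with
  | [::] => 1%E
  | A :: s' => \int[mu]_(x in A) path_prob x0 y0 p0 p1 s' x
  end.

(* (X_k, ..., X_(k+n)) and (X_0, ..., X_n) have the same law, for all k and n;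
   laws on (0, 1)^(n+1) are compared on products of Borel sets. *)
Definition stationary x0 y0 p0 p1 (mu : probability (measurableTypeR R) R)
    : Prop :=
  forall (k n : nat) (A : (set (measurableTypeR R))^nat),
    (forall i, measurable (A i) /\ A i `<=` `]0%R, 1%R[%classic) ->
    chain_law x0 y0 p0 p1 mu (nseq k `]0%R, 1%R[%classic ++ mkseq A n.+1)
      = chain_law x0 y0 p0 p1 mu (mkseq A n.+1).

End markov_chain.

(* Main.v *)
From HB Require Import structures.
Require Import Defs.
From mathcomp Require Import all_boot all_order all_algebra.
From mathcomp Require Import all_classical all_reals all_analysis.
From mathcomp Require Import measurable_realfun giry ring lra.

(** In the coordinate [logc], which sends ]0, 1[ onto R and behaves like a
    logarithm at both endpoints, the two maps become nonexpansive: they are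
    translations near both ends, and [f0] contracts the interval between 1/2
    and [x0]; this is where [1/2 <= y0] is used. Positivity of the exponents
    gives a drift towards the centre, hence a Lyapunov function [W] for which
    |a - c| * W(a) contracts in mean along two orbits driven by the same
    symbols. With Dini continuity of the weights this makes the iterates of the
    averaging operator U on a Lipschitz function equicontinuous. The limit of
    their Cesaro means along a nonprincipal ultrafilter is then a continuous
    harmonic function. By the maximum principle it attains its bounds, on
    closed sets which are invariant under both maps; two such sets always meet,
    for a pair of points at minimal distance could be moved to a place where
    [f0] contracts it. So the limit is a constant, which must be the integral
    against any stationary law: this is uniqueness. For existence, the same
    limit is a tight positive functional; the push-forward of Lebesgue measure
    by its quantile function represents it and is stationary. *)

Set Implicit Arguments.
Unset Strict Implicit.
Unset Printing Implicit Defensive.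

Import Order.TTheory GRing.Theory Num.Theory.
Import numFieldNormedType.Exports.

Local Open Scope classical_set_scope.
Local Open Scope ring_scope.

(** * Averaging operators and Lyapunov functions *)

(** Far from the centre both maps are translations, so distances shrink only when an orbit visits a
    window []lo, hi]] and then moves by [g0], which has probability at least [ep] and contracts
    there by [q < 1]. The window has length [al], the length of a step of [g1] there: an orbit
    coming from the left cannot leap over it, whereas one coming from the right can, as [g0] makes
    longer steps there. The two orbits carry different weights, which costs at time [j] the modulus
    of [p0] at their current distance. That distance is controlled only in mean, so it is compared
    with thresholds [C * t ^+ j] where [r < t < 1]: the Dini condition sums the moduli at the
    thresholds, and Markov's inequality bounds the exceptions by a geometric series in [r / t]. The
    ultrafilter yields a limit for all bounded functions at once, linear and positive without any
    choice of subsequences. This functional is only finitely additive; its values on indicators of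
    half-lines define a quantile function, which tightness keeps inside ]0, 1[, and countable
    additivity is inherited from Lebesgue measure. *)

Definition averaging (R : realType) (P0 P1 g0 g1 f : R -> R) : R -> R :=
  fun u => P0 u * f (g0 u) + P1 u * f (g1 u).

(** Multiplying by [1 - x > 0] reduces the bound to [1 - x <= expR (- x)]: the product of the
    quadratic with [1 - x] exceeds 1 by [x ^+ 2 * (1 - 2 * x)]. *)
Lemma expR_le_quadratic (R : realType) (x : R) : `|x| <= 1 / 2 ->
  expR x <= 1 + x + 2 * x ^+ 2.
Proof.
rewrite ler_norml => /andP[x1 x2].
have h := expR_ge1Dx (- x).
have e0 := expR_gt0 x.
have e1 : expR x * expR (- x) = 1 by rewrite expRN divff ?gt_eqF.
have : expR x * (1 - x) <= 1 by rewrite -[leRHS]e1 ler_pM2l.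
have : 1 <= (1 + x + 2 * x ^+ 2) * (1 - x).
  rewrite -subr_ge0.
  suff -> : (1 + x + 2 * x ^+ 2) * (1 - x) - 1 = x ^+ 2 * (1 - 2 * x) by apply: mulr_ge0; [exact: sqr_ge0|lra].
  ring.
move=> h1 h2; rewrite -(@ler_pM2r _ (1 - x)); [exact: le_trans h2 h1|lra].
Qed.

Lemma convex_le (R : realType) (p q x y B : R) : 0 <= p -> 0 <= q ->
  p + q = 1 -> x <= B -> y <= B -> p * x + q * y <= B.
Proof.
move=> p0 q0 pq xB yB; rewrite -[B]mul1r -pq mulrDl.
by rewrite lerD// ler_wpM2l.
Qed.

Lemma convex_norm_le (R : realType) (p q x y B : R) : 0 <= p -> 0 <= q ->
  p + q = 1 -> `|x| <= B -> `|y| <= B -> `|p * x + q * y| <= B.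
Proof.
move=> p0 q0 pq xB yB; apply: le_trans (ler_normD _ _) _.
by rewrite !normrM (ger0_norm p0) (ger0_norm q0); exact: convex_le.
Qed.

Lemma monotone_nonexpansive (R : realType) (g : R -> R) :
  (forall a c, a <= c -> 0 <= g c - g a <= c - a) ->
  forall a c, `|g a - g c| <= `|a - c|.
Proof.
move=> h a c; have [ac|ca] := leP a c.
  by rewrite distrC [leRHS]distrC !ger0_norm//; have := h _ _ ac; lra.
by rewrite !ger0_norm//; have := h _ _ (ltW ca); lra.
Qed.

(* Both sides of the jump: [D0], [D1] are the steps towards it, and [x], [x0],
   [x1] the values of the exponential term before and after the step. *)
Lemma jump_drift (R : realType) (p0 p1 D0 D1 x0 x1 x z G be de : R) :
  p0 + p1 = 1 -> 0 < G -> 2 * x <= p0 * x0 + p1 * x1 -> 0 <= x -> de <= 1 ->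
  `|p0 * D0 + p1 * D1| <= be ->
  de <= p0 * D0 + p1 * D1 \/ be + 1 <= G * x ->
  p0 * (z - D0 + G * (1 - x0)) + p1 * (z - D1 + G * (1 - x1)) <=
    z + G * (1 - x) - de.
Proof.
move=> p01 G0 xs x_ge0 de1; rewrite ler_norml => /andP[db _] h.
have -> : p0 * (z - D0 + G * (1 - x0)) + p1 * (z - D1 + G * (1 - x1)) =
  (p0 + p1) * (z + G) - (p0 * D0 + p1 * D1) - G * (p0 * x0 + p1 * x1) by ring.
rewrite p01 mul1r.
have := ler_wpM2l (ltW G0) xs; have := mulr_ge0 (ltW G0) x_ge0.
by case: h; lra.
Qed.

(** * Lyapunov function of a chain with bounded left and right steps *)

Section displacement_chain.
Context {R : realType}.
Variables (g0 g1 P0 P1 : R -> R).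
Variables (al be ep : R).
Hypothesis al0 : 0 < al.
Hypothesis ep0 : 0 < ep.
Hypothesis P0_ge : forall u, ep <= P0 u.
Hypothesis P1_ge : forall u, ep <= P1 u.
Hypothesis P01 : forall u, P0 u + P1 u = 1.
Hypothesis g0_step : forall u, al <= u - g0 u <= be.
Hypothesis g1_step : forall u, al <= g1 u - u <= be.

Let U := averaging P0 P1 g0 g1.

Lemma be_gt0 : 0 < be.
Proof. by have := al0; have := g0_step 0; lra. Qed.

Section lyapunov.
Variables (lo hi M eta : R).
Hypothesis lo_hi : lo < hi.
Hypothesis eta0 : 0 < eta.
Hypothesis g1_lo : forall u, u <= lo -> g1 u <= hi.
Hypothesis drift_left : forall u : R, u <= - M ->
  eta <= P0 u * (g0 u - u) + P1 u * (g1 u - u).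
Hypothesis drift_right : forall u, M <= u ->
  P0 u * (g0 u - u) + P1 u * (g1 u - u) <= - eta.

Let drift_bound u : `|P0 u * (g0 u - u) + P1 u * (g1 u - u)| <= be.
Proof.
have := al0; have := be_gt0; have := ep0; have := P0_ge u; have := P1_ge u.
have := g0_step u; have := g1_step u => s1 s0 p1 p0 e0 b0 a0.
by apply: convex_norm_le => //; rewrite ?ler_norml; lra.
Qed.

(* A jump of height [K] at [hi] makes crossing from the right to the left
   always favourable; from the left, one cannot cross without visiting
   ]lo, hi]. The terms in [1 - expR _] turn the chance [ep] of a step towards
   [hi] into a drift, where the linear terms have none. *)
Lemma lyapunov_linear : exists v : R -> R, exists del B : R,
  [/\ 0 < del /\ 1 <= B,
    (forall u, `|u| - B <= v u <= `|u| + B /\ 0 <= v u),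
    (forall u, `|v (g0 u) - v u| <= B /\ `|v (g1 u) - v u| <= B) &
    forall u, ~ (lo < u <= hi) -> U v u <= v u - del].
Proof.
have [al_gt0 ep_gt0 lohi eta_gt0] := And4 al0 ep0 lo_hi eta0.
have be0 := be_gt0.
have ep1 : ep <= 1 by have := P0_ge 0; have := P1_ge 0; have := P01 0; lra.
(* A step towards [hi] has length at least [al] and probability at least [ep]; with this rate it
   alone doubles the mean of the exponential term. *)
pose ka := ln (2 / ep) / al.
have eka : ep * expR (ka * al) = 2.
  rewrite /ka divfK ?gt_eqF// lnK; last by rewrite posrE divr_gt0.
  by rewrite mulrC divfK ?gt_eqF.
have ka0 : 0 < ka.
  by rewrite divr_gt0// ln_gt0// ltr_pdivlMr//; lra.
pose D : R := `|M| + `|hi|.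
have D0 : 0 <= D by rewrite addr_ge0.
have DE : `|M| + `|hi| = D by [].
(* Within distance [D] of [hi], which covers all that [drift_left] and [drift_right] leave out, [G]
   times the exponential is at least [be + 1] and outweighs a linear drift of size [be]. *)
pose G := (be + 1) * expR (ka * D).
have G0 : 0 < G by rewrite mulr_gt0 ?expR_gt0//; lra.
have GE : (be + 1) * expR (ka * D) = G by [].
(* The height for which [vl w <= vr w] whenever [- be <= w]: a step of [g0] across [hi] can then be
   estimated by the formula of the right side. *)
pose K := 2 * be + G * expR (ka * be).
have K0 : 0 < K.
  by apply: addr_gt0; apply: mulr_gt0 => //; exact: expR_gt0.
have KE : 2 * be + G * expR (ka * be) = K by [].
clearbody K G D ka.
pose vl w : R := - w + G * (1 - expR (ka * w)).
pose vr w : R := w + G * (1 - expR (- (ka * w))) + K.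
pose v u := if u <= hi then vl (u - hi) else vr (u - hi).
have EM (x y : R) : (x <= y) -> expR (ka * x) <= expR (ka * y).
  by rewrite ler_expR ler_pM2l.
have E1 (w : R) : w <= 0 -> 0 <= 1 - expR (ka * w) <= 1.
  move=> w0; have := EM _ _ w0; rewrite mulr0 expR0.
  by have := expR_gt0 (ka * w); lra.
have vB u : `|u - hi| <= v u <= `|u - hi| + (G + K).
  rewrite /v; case: ifP => [uh|/negbT]; last rewrite -ltNge => uh.
    rewrite ler0_norm ?subr_le0// /vl.
    have /E1 : u - hi <= 0 by lra.
    by nra.
  rewrite gtr0_norm ?subr_gt0// /vr.
  have /E1 : - (u - hi) <= 0 by lra.
  by rewrite mulrN; nra.
have vd (x y : R) : `|x - y| <= be -> `|v x - v y| <= be + (G + K).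
  move=> xy; have := vB x; have := vB y.
  have := ler_distD (x - hi) 0 (y - hi); have := ler_distD (y - hi) 0 (x - hi).
  rewrite !sub0r !normrN.
  have -> : x - hi - (y - hi) = x - y by ring.
  have -> : y - hi - (x - hi) = - (x - y) by ring.
  rewrite normrN.
  move=> a b /andP[c d] /andP[e f]; rewrite ler_norml; lra.
exists v, (Num.min eta 1), (1 + be + G + K + `|hi|); split.
- by split; [rewrite lt_min eta0 ltr01|have := normr_ge0 hi; lra].
- move=> u; have /andP[a b] := vB u; split; last by have := normr_ge0 (u - hi); lra.
  have := ler_normB u hi; have := ler_normD (u - hi) hi; rewrite subrK.
  lra.
- move=> u; have := normr_ge0 hi => h0; split.
    apply: (le_trans (vd _ _ _)); last lra.
    by rewrite distrC ger0_norm; have := g0_step u; lra.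
  apply: (le_trans (vd _ _ _)); last lra.
  by rewrite ger0_norm; have := g1_step u; lra.
move=> u uI.
have min1 : Num.min eta 1 <= 1 by rewrite ge_min lexx orbT.
have mineta : Num.min eta 1 <= eta by rewrite ge_min lexx.
set de := Num.min eta 1 in min1 mineta *.
have p0 := P0_ge u; have p1 := P1_ge u; have p01 := P01 u.
have s0 := g0_step u; have s1 := g1_step u; have db := drift_bound u.
have GD (w : R) : - D <= w -> be + 1 <= G * expR (ka * w).
  move=> /EM h; rewrite -GE -mulrA -expRD; rewrite ler_peMr//; first lra.
  rewrite -[leLHS]expR0 ler_expR; have := h; rewrite ler_expR; lra.
rewrite /U /averaging.
have [ulo|ulo] := leP u lo.
- have g0h : g0 u <= hi by lra.
  have g1h : g1 u <= hi by exact: g1_lo.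
  have uh : u <= hi := le_trans ulo (ltW lohi).
  rewrite /v g0h g1h uh /vl.
  have e1 : 2 * expR (ka * (u - hi)) <= P1 u * expR (ka * (g1 u - hi)).
    rewrite -eka -mulrA -expRD; apply: ler_pM => //; [by lra|].
    rewrite -mulrDr; apply: EM; lra.
  have e0 : 0 <= P0 u * expR (ka * (g0 u - hi)).
    by rewrite mulr_ge0 ?expR_ge0// (le_trans (ltW ep0)).
  have e2 := expR_ge0 (ka * (u - hi)).
  have -> : - (g0 u - hi) = - (u - hi) - (g0 u - u) by ring.
  have -> : - (g1 u - hi) = - (u - hi) - (g1 u - u) by ring.
  apply: (@jump_drift R _ _ _ _ _ _ _ _ _ _ _ p01 G0 _ e2 min1 db).
    by apply: le_trans e1 _; rewrite lerDr.
  have [uM|uM] := leP u (- M); [left|right].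
    exact: le_trans mineta (drift_left uM).
  by apply: GD; rewrite -DE; have := ler_norm M; have := ler_norm hi; lra.
- have uh : hi < u by rewrite ltNge; apply/negP => uh; apply: uI; rewrite ulo.
  have vru : v u = vr (u - hi) by rewrite /v leNgt uh.
  have vr1 : v (g1 u) = vr (g1 u - hi).
    by rewrite /v leNgt; have -> : hi < g1 u by lra.
  have vr0 : v (g0 u) <= vr (g0 u - hi).
    rewrite /v; case: ifP => // gh; rewrite /vl /vr.
    have gb : - be <= g0 u - hi by lra.
    have := EM (- (g0 u - hi)) be; rewrite mulrN => h.
    have {}h : G * expR (- (ka * (g0 u - hi))) <= G * expR (ka * be).
      by rewrite ler_pM2l//; apply: h; lra.
    have := mulr_ge0 (ltW G0) (expR_ge0 (ka * (g0 u - hi))).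
    move: h; set y0 := expR (- _); set y1 := expR (ka * (g0 u - hi)).
    by rewrite -KE; move: y0 y1 (expR (ka * be)) => ? ? ?; lra.
  rewrite vru vr1.
  apply: (@le_trans _ _ (P0 u * vr (g0 u - hi) + P1 u * vr (g1 u - hi))).
    by rewrite lerD2r ler_pM2l//; lra.
  rewrite /vr.
  have e1 : 2 * expR (- (ka * (u - hi))) <= P0 u * expR (- (ka * (g0 u - hi))).
    rewrite -eka -mulrA -expRD; apply: ler_pM => //; [by lra|].
    rewrite -!mulrN -mulrDr; apply: EM; lra.
  have e0 : 0 <= P1 u * expR (- (ka * (g1 u - hi))).
    by rewrite mulr_ge0 ?expR_ge0// (le_trans (ltW ep0)).
  have e2 := expR_ge0 (- (ka * (u - hi))).
  have db' : `|P0 u * (u - g0 u) + P1 u * (u - g1 u)| <= be.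
    by rewrite -normrN opprD -!mulrN !opprB.
  have zE w : w - hi + G * (1 - expR (- (ka * (w - hi)))) + K =
    u - hi + K - (u - w) + G * (1 - expR (- (ka * (w - hi)))) by ring.
  rewrite !zE subrr subr0; apply: (@jump_drift R _ _ _ _ _ _ _ _ _ _ _ p01 G0 _ e2 min1 db').
    by apply: le_trans e1 _; rewrite lerDl.
  have [uM|uM] := leP M u; [left|right].
    apply: le_trans mineta _; rewrite -lerN2 opprD -!mulrN !opprB.
    exact: drift_right.
  rewrite -mulrN; apply: GD.
  by rewrite -DE; have := ler_norm M; have := ler_norm (- hi); rewrite normrN; lra.
Qed.

End lyapunov.
End displacement_chain.

(** * Contraction in mean along two coupled orbits *)

Section contraction_in_mean.
Context {R : realType}.
Variables (g0 g1 P0 P1 : R -> R).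
Hypothesis P0_ge0 : forall u, 0 <= P0 u.
Hypothesis P1_ge0 : forall u, 0 <= P1 u.
Hypothesis P01 : forall u, P0 u + P1 u = 1.

Let U := averaging P0 P1 g0 g1.

(* For small [s], [expR (s * v)] turns the additive drift of [v] off ]lo, hi]
   into a factor < 1, and its growth on ]lo, hi] is absorbed by the contraction
   [q] of [g0]. *)
Lemma lyapunov_exp (v : R -> R) (lo hi del B ep q : R) :
  0 < ep -> (forall u, ep <= P0 u) -> q < 1 -> 0 < del -> 1 <= B ->
  (forall u, `|u| - B <= v u <= `|u| + B /\ 0 <= v u) ->
  (forall u, `|v (g0 u) - v u| <= B /\ `|v (g1 u) - v u| <= B) ->
  (forall u, ~ (lo < u <= hi) -> U v u <= v u - del) ->
  exists (W : R -> R) (r C s : R),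
  [/\ 0 < s /\ 0 < r < 1,
      (forall u, 1 <= W u /\ expR (s * (`|u| - B)) <= W u <= expR (s * (`|u| + B))),
      (forall u, U W u <= r * W u + C) &
      forall u x y : R, 0 <= x <= 1 -> 0 <= y <= 1 -> (lo < u <= hi -> x <= q) ->
        P0 u * (x * W (g0 u)) + P1 u * (y * W (g1 u)) <= r * W u].
Proof.
move=> ep0 epP q1 del0 B1 vB vd vU.
pose th := ep * (1 - q); have th0 : 0 < th by rewrite mulr_gt0 // subr_gt0.
pose c := Num.min 1 (Num.min del th).
have c0 : 0 < c by rewrite !lt_min ltr01 del0 th0.
have c1 : c <= 1 by rewrite ge_min lexx.
have cdel : c <= del by rewrite !ge_min lexx !orbT.
have cth : c <= th by rewrite !ge_min lexx !orbT.
have thE : ep * (1 - q) = th by [].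
(* The quadratic error [2 * (s * B) ^+ 2] becomes [s * c / 2], half of the first-order gain [s * c];
   the other half is the gap between [r] and 1. *)
pose s : R := c / (4 * B ^+ 2).
have B0 : 0 < B by lra.
have sBB : 4 * s * B ^+ 2 = c by rewrite /s; field; lra.
have s0 : 0 < s by rewrite divr_gt0// mulr_gt0// exprn_gt0.
have sB0 : 0 < s * B by rewrite mulr_gt0.
have sB : 4 * (s * B) <= c.
  by rewrite -sBB; have := ler_wpM2l (ltW sB0) B1; rewrite mulr1 expr2; lra.
have s_le : 4 * s <= 1 by have := ler_wpM2l (ltW s0) B1; lra.
clearbody c th s.
pose r : R := 1 - s * c / 2; have rE : r = 1 - s * c / 2 by [].
have sc : 0 < s * c by rewrite mulr_gt0.
have s1 : s <= 1 by lra.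
have sc1 : s * c <= 1 := mulr_ile1 (ltW s0) (ltW c0) s1 c1.
clearbody r.
pose W u := expR (s * v u).
have Wg u w : W w = W u * expR (s * (v w - v u)).
  by rewrite /W -expRD; congr expR; ring.
have W0 u : 0 < W u by exact: expR_gt0.
have eq u w : `|v w - v u| <= B ->
    expR (s * (v w - v u)) <= 1 + s * (v w - v u) + 2 * (s * B) ^+ 2.
  move=> h; have sh : `|s * (v w - v u)| <= s * B.
    by rewrite normrM (gtr0_norm s0) ler_pM2l.
  apply: le_trans (expR_le_quadratic _) _; first by apply: le_trans sh _; lra.
  rewrite lerD2l ler_pM2l// -real_normK ?num_real// ler_pXn2r ?nnegrE//.
  by rewrite ltW.
have main u x y : 0 <= x <= 1 -> 0 <= y <= 1 -> (lo < u <= hi -> x <= q) ->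
    P0 u * (x * W (g0 u)) + P1 u * (y * W (g1 u)) <= r * W u.
  move=> /andP[x0 x1] /andP[y0 y1] xq.
  have [d0 d1] := vd u; have [p0 p1 p01] := And3 (P0_ge0 u) (P1_ge0 u) (P01 u).
  rewrite (Wg u (g0 u)) (Wg u (g1 u)).
  have e0 := eq _ _ d0; have e1 := eq _ _ d1.
  move: (expR_ge0 (s * (v (g0 u) - v u))) (expR_ge0 (s * (v (g1 u) - v u))).
  set E0 := expR _ in e0 *; set E1 := expR _ in e1 *.
  clearbody E0 E1; move=> E00 E10.
  suff : P0 u * x * E0 + P1 u * y * E1 <= r.
    move=> /(ler_wpM2r (ltW (W0 u))); apply: le_trans.
    by rewrite le_eqVlt; apply/orP; left; apply/eqP; ring.
  have [uI|uI] := boolP (lo < u <= hi).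
    have xq' := xq uI.
    have sB2 : 2 * (s * B) ^+ 2 <= s * B.
      by rewrite expr2 mulrA ler_piMl ?(ltW sB0)//; lra.
    have Eb w : w <= B -> 1 + s * w + 2 * (s * B) ^+ 2 <= 1 + 2 * (s * B).
      by move=> /(ler_wpM2l (ltW s0)); lra.
    have E0b : E0 <= 1 + 2 * (s * B).
      apply: le_trans e0 _; apply: Eb; exact: le_trans (ler_norm _) d0.
    have E1b : E1 <= 1 + 2 * (s * B).
      apply: le_trans e1 _; apply: Eb; exact: le_trans (ler_norm _) d1.
    (* In the window [W] grows at most by the factor [1 + 2 * (s * B)], while the contraction of
       [g0] lowers the total weight to [1 - th]; the choice [4 * (s * B) <= c <= th] leaves room. *)
    apply: (@le_trans _ _ ((1 - th) * (1 + 2 * (s * B)))).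
      have h0 : P0 u * x * E0 <= P0 u * q * (1 + 2 * (s * B)).
        by apply: ler_pM => //; [rewrite mulr_ge0|rewrite ler_wpM2l].
      have h1 : P1 u * y * E1 <= P1 u * (1 + 2 * (s * B)).
        by apply: ler_pM => //; [rewrite mulr_ge0|rewrite ler_piMr].
      have : P0 u * q + P1 u <= 1 - th.
        have := ler_wpM2r (ltW (_ : 0 < 1 - q)) (epP u).
        by rewrite subr_gt0 => /(_ q1); rewrite thE; lra.
      have pos : 0 <= 1 + 2 * (s * B) by rewrite addr_ge0// mulr_ge0// ltW.
      move=> /(ler_wpM2r pos); apply: le_trans.
      by rewrite [leRHS]mulrDl lerD.
    have : 0 <= th * (s * B) by rewrite mulr_ge0// ltW.
    have : s * c <= c by rewrite ler_piMl ?(ltW c0).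
    rewrite rE mulrDr mulr1; lra.
  have h0 : P0 u * x * E0 <= P0 u * E0 by rewrite ler_wpM2r// ler_piMr.
  have h1 : P1 u * y * E1 <= P1 u * E1 by rewrite ler_wpM2r// ler_piMr.
  have h2 := ler_wpM2l p0 e0; have h3 := ler_wpM2l p1 e1.
  have /vU : ~ (lo < u <= hi) by exact/negP.
  rewrite /U /averaging => h4.
  have : s * (P0 u * (v (g0 u) - v u) + P1 u * (v (g1 u) - v u)) <= - (s * c).
    rewrite -mulrN ler_pM2l//.
    have : (P0 u + P1 u) * v u = v u by rewrite p01 mul1r.
    lra.
  have : (P0 u + P1 u) * (2 * (s * B) ^+ 2) = s * c / 2.
    by rewrite p01 mul1r -sBB; field.
  rewrite rE; lra.
have Wle u : 1 <= W u /\ expR (s * (`|u| - B)) <= W u <= expR (s * (`|u| + B)).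
  have [/andP[a b] z] := vB u; rewrite !ler_expR !ler_pM2l// a b.
  by split=> //; rewrite -expR0 ler_expR mulr_ge0// ltW.
(* The additive constant bounds [U W] on the window, where one step raises [v] by at most [B]. *)
exists W, r, (expR (s * (`|lo| + `|hi| + 2 * B))), s; split=> //.
- by split=> //; rewrite rE; lra.
- move=> u; have [uI|uI] := boolP (lo < u <= hi); last first.
    have := @main u 1 1; rewrite !mul1r ler01 lexx => /(_ isT isT).
    move=> h; apply: le_trans (h _) _; first by move=> uI'; rewrite uI' in uI.
    by rewrite lerDl expR_ge0.
  have ub : `|u| <= `|lo| + `|hi|.
    have := ler_norm (- lo); have := ler_norm hi; rewrite normrN.
    by case/andP: uI => a b; rewrite ler_norml; have := normr_ge0 lo; have := normr_ge0 hi; lra.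
  have [/andP[_ a] _] := vB u; have [d0 d1] := vd u.
  have /le_trans -> // : U W u <= expR (s * (`|lo| + `|hi| + 2 * B)).
    apply: convex_le => //; rewrite ler_expR ler_pM2l//.
      by have := ler_norm (v (g0 u) - v u); lra.
    by have := ler_norm (v (g1 u) - v u); lra.
  rewrite lerDr mulr_ge0// ?ltW// rE; lra.
Qed.

Variables (W b : R -> R) (r d1 : R).
Hypothesis r0 : 0 < r.
Hypothesis r1 : r < 1.
Hypothesis W1 : forall u, 1 <= W u.
Hypothesis g_contr : forall a c, `|a - c| <= d1 ->
  P0 a * (`|g0 a - g0 c| * W (g0 a)) + P1 a * (`|g1 a - g1 c| * W (g1 a)) <=
  r * (`|a - c| * W a).
Hypothesis g0_nonexp : forall a c, `|g0 a - g0 c| <= `|a - c|.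
Hypothesis g1_nonexp : forall a c, `|g1 a - g1 c| <= `|a - c|.
Hypothesis b_mono : {homo b : x y / x <= y}.
Hypothesis b_ge0 : forall x, 0 <= b x.
Hypothesis b_le1 : forall x, b x <= 1.
Hypothesis P0_b : forall a c, `|P0 a - P0 c| <= b `|a - c|.

(** Both points are moved by the same map, drawn with the weights of [a]; the change of weights from
    [c] to [a] is paid by the first term, since the differences of [P0] and of [P1] are opposite. *)
Lemma averaging_osc (f : R -> R) (M : R) (a c : R) : (forall u, `|f u| <= M) ->
  `|U f a - U f c| <= 2 * M * b `|a - c| +
    (P0 a * `|f (g0 a) - f (g0 c)| + P1 a * `|f (g1 a) - f (g1 c)|).
Proof.
move=> fM; have M0 : 0 <= M := le_trans (normr_ge0 _) (fM 0).
rewrite /U /averaging.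
have -> : P0 a * f (g0 a) + P1 a * f (g1 a) - (P0 c * f (g0 c) + P1 c * f (g1 c))
  = (P0 a - P0 c) * f (g0 c) + (P1 a - P1 c) * f (g1 c) +
    (P0 a * (f (g0 a) - f (g0 c)) + P1 a * (f (g1 a) - f (g1 c))) by ring.
apply: le_trans (ler_normD _ _) _; apply: lerD; last first.
  apply: le_trans (ler_normD _ _) _.
  by rewrite !normrM (ger0_norm (P0_ge0 _)) (ger0_norm (P1_ge0 _)).
apply: le_trans (ler_normD _ _) _; rewrite !normrM.
have -> : P1 a - P1 c = - (P0 a - P0 c) by have := P01 a; have := P01 c; lra.
rewrite normrN mulrAC mulrDl mul1r mulrDl [X in _ <= X + _]mulrC mulrC.
have h u : `|P0 a - P0 c| * `|f u| <= b `|a - c| * M.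
  by apply: ler_pM => //; exact: P0_b.
have := h (g0 c); have := h (g1 c); lra.
Qed.

Lemma iter_averaging_norm (f : R -> R) (M : R) n u : (forall u, `|f u| <= M) ->
  `|iter n U f u| <= M.
Proof.
by move=> fM; elim: n u => [//|n IH] u; rewrite iterS; exact: convex_norm_le.
Qed.

(** By induction on [n] with [C] arbitrary. At time [j] the distance is at most [C * t ^+ j], up to
    an event whose probability Markov's inequality bounds by a multiple of [(r / t) ^+ j]. *)
Lemma iter_averaging_osc (f : R -> R) (M Lip t : R) : 0 < t -> 0 <= Lip ->
  (forall u, `|f u| <= M) -> (forall u w, `|f u - f w| <= Lip * `|u - w|) ->
  forall n (C : R) a c, 0 < C -> `|a - c| <= d1 ->
  `|iter n U f a - iter n U f c| <= 2 * M * \sum_(j < n) b (C * t ^+ j) +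
    (2 * M / C * \sum_(j < n) (r / t) ^+ j + Lip) * (`|a - c| * W a).
Proof.
move=> t0 Lip0 fM fL.
have M0 : 0 <= M := le_trans (normr_ge0 _) (fM 0).
elim=> [|n IH] C a c C0 ac.
  rewrite !big_ord0 !mulr0 add0r add0r; apply: le_trans (fL _ _) _.
  by rewrite ler_wpM2l// ler_peMr.
rewrite !iterS; apply: le_trans (averaging_osc _ _ _) _.
  by move=> u; exact: iter_averaging_norm.
set S := \sum_(j < n) b (C * t * t ^+ j).
set Q := \sum_(j < n) (r / t) ^+ j.
have Q0 : 0 <= Q by apply: sumr_ge0 => j _; rewrite exprn_ge0// divr_ge0// ltW.
have Ct0 : 0 < C * t by rewrite mulr_gt0.
(* Using the induction hypothesis at [C * t] shifts the thresholds by one step. The factor [1 / t]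
   this costs meets the factor [r] of [g_contr]. *)
have h0 := IH _ _ _ Ct0 (le_trans (g0_nonexp a c) ac).
have h1 := IH _ _ _ Ct0 (le_trans (g1_nonexp a c) ac).
rewrite -/S -/Q in h0 h1.
have A0 : 0 <= 2 * M / (C * t) * Q + Lip.
  by rewrite addr_ge0// mulr_ge0// divr_ge0 ?mulr_ge0// ltW.
have W0 u : 0 <= W u by apply: le_trans (W1 u).
have z0 : 0 <= `|a - c| * W a by rewrite mulr_ge0.
(* Markov's inequality in pointwise form: beyond the threshold [C], the bound [b <= 1] is absorbed
   by the ratio of the distance to [C]. *)
have bC : b `|a - c| <= b C + `|a - c| * W a / C.
  have [aC|Ca] := leP `|a - c| C.
    by apply: le_trans (b_mono aC) _; rewrite lerDl divr_ge0// ltW.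
  apply: le_trans (b_le1 _) _.
  suff : 1 <= `|a - c| * W a / C by move=> h; apply: le_trans h _; rewrite lerDr.
  by rewrite ler_pdivlMr// mul1r; apply: le_trans (ltW Ca) _; rewrite ler_peMr.
have -> : \sum_(j < n.+1) b (C * t ^+ j) = b C + S.
  rewrite big_ord_recl expr0 mulr1; congr (_ + _).
  by apply: eq_bigr => j _; rewrite exprS mulrA.
have -> : \sum_(j < n.+1) (r / t) ^+ j = 1 + r / t * Q.
  rewrite big_ord_recl expr0; congr (_ + _); rewrite mulr_sumr.
  by apply: eq_bigr => j _; rewrite exprS.
have {}h0 := ler_wpM2l (P0_ge0 a) h0; have {}h1 := ler_wpM2l (P1_ge0 a) h1.
apply: (@le_trans _ _ (2 * M * (b C + `|a - c| * W a / C) + (2 * M * S +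
   (2 * M / (C * t) * Q + Lip) * (r * (`|a - c| * W a))))).
  apply: lerD; first by rewrite ler_wpM2l// mulr_ge0.
  apply: le_trans (lerD h0 h1) _.
  have := ler_wpM2l A0 (g_contr ac).
  have : (P0 a + P1 a) * (2 * M * S) = 2 * M * S by rewrite P01 mul1r.
  lra.
have : r * (Lip * (`|a - c| * W a)) <= Lip * (`|a - c| * W a).
  by rewrite ler_piMl ?(ltW r1)// mulr_ge0.
set z := `|a - c| * W a; move=> h.
have -> : (2 * M / (C * t) * Q + Lip) * (r * z) =
  2 * M / C * (r / t * Q) * z + r * (Lip * z).
  by field; rewrite !gt_eqF.
have -> : (2 * M / C * (1 + r / t * Q) + Lip) * z =
  2 * M * (z / C) + 2 * M / C * (r / t * Q) * z + Lip * z.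
  by field; rewrite !gt_eqF.
lra.
Qed.

End contraction_in_mean.

(** * Orbit means and harmonic functions *)

Definition orbit_mean (R : realType) (U : (R -> R) -> R -> R) (n : nat) (f : R -> R) : R -> R :=
  fun u => n.+1%:R^-1 * \sum_(k < n.+1) iter k U f u.
(** The image ultrafilter lives on a compact segment, hence clusters somewhere, and a cluster point
    of an ultrafilter is a limit. *)
Lemma ultrafilter_cvg_bounded (R : realType) (T : Type) (F : set_system T)
    (FU : UltraFilter F) (a : T -> R) (M : R) :
  (forall n, `|a n| <= M) -> cvg (a n @[n --> F]).
Proof.
move=> aM; have FF := @ultra_proper _ F FU.
have aK : (a n @[n --> F]) `[- M, M]%classic.
  apply: (@filterS _ F _ setT) filterT => n _.
  by rewrite /= in_itv/= -ler_norml.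
have [p [_ cp]] := @segment_compact R (- M) M _ (fmap_proper_filter a FF) aK.
apply: (cvgP p) => B Bp.
have [//|nB] := in_ultra_setVsetC (a @^-1` B) FU.
by have [x [/= nBx Bx]] := cp (~` B) B nB Bp.
Qed.

Section orbit_means.
Context {R : realType}.
Variables (g0 g1 P0 P1 : R -> R).
Hypothesis P0_ge0 : forall u, 0 <= P0 u.
Hypothesis P1_ge0 : forall u, 0 <= P1 u.
Hypothesis P01 : forall u, P0 u + P1 u = 1.

Let U := averaging P0 P1 g0 g1.

Lemma averagingD f h : U (f \+ h) = U f \+ U h.
Proof. by apply/funext => u; rewrite /U /averaging /=; ring. Qed.

Lemma averagingZ (k : R) f : U (fun u => k * f u) = (fun u => k * U f u).
Proof. by apply/funext => u; rewrite /U /averaging /=; ring. Qed.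

Lemma iter_averagingD n f h : iter n U (f \+ h) = iter n U f \+ iter n U h.
Proof. by elim: n => //= n ->; rewrite averagingD. Qed.

Lemma iter_averagingZ n (k : R) f :
  iter n U (fun u => k * f u) = (fun u => k * iter n U f u).
Proof. by elim: n => //= n ->; rewrite averagingZ. Qed.

Lemma iter_averaging_cst n (k : R) u : iter n U (fun=> k) u = k.
Proof.
elim: n u => //= n IH u.
by rewrite {1}/U /averaging !IH -mulrDl P01 mul1r.
Qed.

Lemma iter_averaging_le n f h u : (forall u, f u <= h u) ->
  iter n U f u <= iter n U h u.
Proof.
by move=> fh; elim: n u => //= n IH u; apply: lerD; apply: ler_wpM2l.
Qed.

Lemma orbit_meanD n f h u :
  orbit_mean U n (f \+ h) u = orbit_mean U n f u + orbit_mean U n h u.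
Proof.
rewrite /orbit_mean -mulrDr -big_split/=; congr (_ * _).
by apply: eq_bigr => k _; rewrite iter_averagingD.
Qed.

Lemma orbit_meanZ n (k : R) f u :
  orbit_mean U n (fun u => k * f u) u = k * orbit_mean U n f u.
Proof.
rewrite /orbit_mean [RHS]mulrCA; congr (_ * _); rewrite mulr_sumr.
by apply: eq_bigr => i _; rewrite iter_averagingZ.
Qed.

Lemma mean_cst n (k : R) : n.+1%:R^-1 * \sum_(i < n.+1) k = k.
Proof. by rewrite sumr_const card_ord -[k *+ _]mulr_natl mulKf. Qed.

Lemma orbit_mean_cst n (k : R) u : orbit_mean U n (fun=> k) u = k.
Proof.
rewrite /orbit_mean -[RHS](mean_cst n); congr (_ * _).
by apply: eq_bigr => i _; rewrite iter_averaging_cst.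
Qed.

Lemma orbit_mean_le n f h u : (forall u, f u <= h u) ->
  orbit_mean U n f u <= orbit_mean U n h u.
Proof.
move=> fh; rewrite ler_pM2l ?invr_gt0//; apply: ler_sum => k _.
exact: iter_averaging_le.
Qed.

Lemma orbit_mean_norm n f (M : R) u : (forall u, `|f u| <= M) ->
  `|orbit_mean U n f u| <= M.
Proof.
move=> fM; rewrite ler_norml -{1}(orbit_mean_cst n (- M) u) -{2}(orbit_mean_cst n M u).
by apply/andP; split; apply: orbit_mean_le => w; have := fM w; rewrite ler_norml => /andP[].
Qed.

Lemma orbit_mean_dist n f (e : R) a c :
  (forall k, `|iter k U f a - iter k U f c| <= e) ->
  `|orbit_mean U n f a - orbit_mean U n f c| <= e.
Proof.
move=> h; rewrite /orbit_mean -mulrBr -sumrB normrM ger0_norm ?invr_ge0//.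
rewrite -[leRHS](mean_cst n) ler_pM2l ?invr_gt0//.
by apply: le_trans (ler_norm_sum _ _ _) _; apply: ler_sum.
Qed.

Lemma averaging_orbit_mean n f u : U (orbit_mean U n f) u = orbit_mean U n (U f) u.
Proof.
rewrite {1}/U /averaging /orbit_mean.
rewrite mulrCA [X in _ + X]mulrCA -mulrDr !mulr_sumr -big_split/=.
by rewrite -mulr_sumr; congr (_ * _); apply: eq_bigr => k _; rewrite -iterSr.
Qed.

(** The sum telescopes to the difference of the last and the first iterate. This is what makes
    limits of means harmonic. *)
Lemma orbit_mean_shift n f (M : R) u : (forall u, `|f u| <= M) ->
  `|orbit_mean U n (U f) u - orbit_mean U n f u| <= 2 * M * n.+1%:R^-1.
Proof.
move=> fM; rewrite /orbit_mean -mulrBr -sumrB.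
under eq_bigr do rewrite -iterSr.
rewrite -(big_mkord predT (fun k => iter k.+1 U f u - iter k U f u)).
rewrite (@telescope_sumr _ 0 n.+1 (fun k => iter k U f u))// normrM ger0_norm ?invr_ge0//.
rewrite mulrC ler_pM2r ?invr_gt0//.
apply: le_trans (ler_normB _ _) _.
have h k : `|iter k U f u| <= M by apply: iter_averaging_norm.
have := h n.+1; have := h 0%N; lra.
Qed.

Section ultralimit.
Variables (F : set_system nat) (FU : UltraFilter F).
Hypothesis F_oo : F --> \oo.

Definition ulim (a : nat -> R) : R := lim (a n @[n --> F]).

Let FF : ProperFilter F := ultra_proper.

Lemma orbit_mean_cvg f (M : R) u : (forall u, `|f u| <= M) ->
  orbit_mean U n f u @[n --> F] --> ulim (fun n => orbit_mean U n f u).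
Proof.
by move=> fM; apply: (@ultrafilter_cvg_bounded _ _ _ FU _ M) => n; exact: orbit_mean_norm.
Qed.

Lemma orbit_mean_shift_cvg f (M l : R) u : (forall u, `|f u| <= M) ->
  orbit_mean U n f u @[n --> F] --> l -> orbit_mean U n (U f) u @[n --> F] --> l.
Proof.
move=> fM fl.
suff h : orbit_mean U n (U f) u - orbit_mean U n f u @[n --> F] --> (0 : R).
  rewrite -[l]add0r (_ : (fun n => orbit_mean U n (U f) u) =
    (fun n => orbit_mean U n (U f) u - orbit_mean U n f u) \+
    (fun n => orbit_mean U n f u)); first exact: cvgD.
  by apply/funext => n /=; rewrite subrK.
have h0 : 2 * M * n.+1%:R^-1 @[n --> F] --> (0 : R).
  apply: cvg_trans (_ : 2 * M * n.+1%:R^-1 @[n --> \oo] --> (0 : R)).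
    exact: cvg_fmap2.
  by rewrite -[X in _ --> X](mulr0 (2 * M)); apply: cvgMr; exact: cvg_harmonic.
apply/norm_cvg0P; apply: (squeeze_cvgr _ (cvg_cst _) h0).
by apply: nearW => n; rewrite normr_ge0/=; exact: orbit_mean_shift.
Qed.

(** [U] evaluates a function at two points only, so it commutes with pointwise limits; it also
    commutes with the means, where it amounts to a negligible shift. *)
Lemma ulim_harmonic f (M : R) : (forall u, `|f u| <= M) ->
  forall u, U (fun u => ulim (fun n => orbit_mean U n f u)) u =
            ulim (fun n => orbit_mean U n f u).
Proof.
move=> fM u; have h w := orbit_mean_cvg (u := w) fM.
have hu : orbit_mean U n (U f) u @[n --> F] -->
    P0 u * ulim (fun n => orbit_mean U n f (g0 u)) +
    P1 u * ulim (fun n => orbit_mean U n f (g1 u)).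
  rewrite (_ : (fun n => orbit_mean U n (U f) u) = (fun n =>
    P0 u * orbit_mean U n f (g0 u) + P1 u * orbit_mean U n f (g1 u))).
    by apply: cvgD; apply: cvgMr; exact: h.
  by apply/funext => n; rewrite -averaging_orbit_mean.
by apply: (cvg_unique _ hu) => //; exact: orbit_mean_shift_cvg fM (h u).
Qed.

End ultralimit.
End orbit_means.

(** * Maximum principle and closed invariant sets *)

Section harmonic.
Context {R : realType}.
Variables (g0 g1 P0 P1 : R -> R).
Hypothesis P0_gt0 : forall u, 0 < P0 u.
Hypothesis P1_gt0 : forall u, 0 < P1 u.
Hypothesis P01 : forall u, P0 u + P1 u = 1.

Let U := averaging P0 P1 g0 g1.

(** Let [z] be a maximum point on [[lo, hi]]. If [psi] were larger at some [x], then [psi - e * v]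
    would come close to its supremum only off the window, where [- e * v] gains [e * del] in mean
    under [U], overshooting that supremum. *)
Lemma harmonic_max (psi v : R -> R) (lo hi del M : R) : lo <= hi ->
  continuous psi -> (forall u, psi u <= M) -> (forall u, U psi u = psi u) ->
  0 < del -> (forall u, 0 <= v u) ->
  (forall u, ~ (lo < u <= hi) -> U v u <= v u - del) ->
  exists z, forall u, psi u <= psi z.
Proof.
move=> lohi cpsi psiM psiU del0 v0 vU.
have [z _ zmax] := EVT_max lohi (continuous_subspaceT cpsi).
exists z => x; rewrite leNgt; apply/negP => zx.
(* Small enough that the penalty [e * v] leaves the value at [x] above [psi z]. *)
pose e := (psi x - psi z) / (2 * (v x + 1)).
have vx : 0 < v x + 1 by have := v0 x; lra.
have e0 : 0 < e by rewrite divr_gt0 ?subr_gt0// mulr_gt0.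
have ev : e * v x < psi x - psi z.
  have : e * (v x + 1) = (psi x - psi z) / 2 by rewrite /e; field; rewrite gt_eqF.
  lra.
pose h u := psi u - e * v u.
have sh : has_sup (range h).
  split; first by exists (h x); exists x.
  exists M => _ [u _ <-]; rewrite /h; have := psiM u.
  by have := mulr_ge0 (ltW e0) (v0 u); lra.
set m := sup (range h).
have hm u : h u <= m by apply: sup_upper_bound => //; exists u.
(* A point where [h] exceeds [m - d] cannot lie in the window, by the second condition on [d]; off
   the window the first condition pushes [U h] above [m]. *)
have [ed_min] : exists2 d, 0 < d & d <= e * del /\ psi z < m - d.
  have hx := hm x; rewrite /h in hx.
  exists (Num.min (e * del) ((m - psi z) / 2)).
    by rewrite lt_min mulr_gt0//= divr_gt0//; lra.
  split; first by rewrite ge_min lexx.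
  have : Num.min (e * del) ((m - psi z) / 2) <= (m - psi z) / 2 by rewrite ge_min lexx orbT.
  lra.
move=> d0 [de dz].
have [_ [u _ <-] um] := sup_adherent d0 sh.
rewrite -/m in um.
have [uI|uI] := boolP (lo < u <= hi).
  have : psi u <= psi z by apply: zmax; rewrite in_itv/=; case/andP: uI => /ltW -> ->.
  rewrite /h in um; have := mulr_ge0 (ltW e0) (v0 u); lra.
have : U h u <= m by apply: convex_le => //; exact: ltW.
have -> : U h u = U psi u - e * U v u by rewrite /U /averaging /h; ring.
have /vU : ~ (lo < u <= hi) by exact/negP.
move=> /(ler_wpM2l (ltW e0)); rewrite mulrBr psiU.
rewrite /h in um; lra.
Qed.

(** An average with positive weights of values at most [psi z] can equal [psi z] only if both values
    do. *)
Lemma harmonic_max_step (psi : R -> R) (z : R) : (forall u, U psi u = psi u) ->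
  (forall u, psi u <= psi z) -> psi (g0 z) = psi z /\ psi (g1 z) = psi z.
Proof.
move=> psiU zmax; have := psiU z; rewrite /U /averaging => h.
have h0 := ler_wpM2l (ltW (P0_gt0 z)) (zmax (g0 z)).
have h1 := ler_wpM2l (ltW (P1_gt0 z)) (zmax (g1 z)).
have hs : (P0 z + P1 z) * psi z = psi z by rewrite P01 mul1r.
split; apply/eqP; rewrite eq_le zmax/=.
  by rewrite -(ler_pM2l (P0_gt0 z)); lra.
by rewrite -(ler_pM2l (P1_gt0 z)); lra.
Qed.

Variables (al be L : R).
Hypothesis al0 : 0 < al.
Hypothesis g0_step : forall u, al <= u - g0 u <= be.
Hypothesis g1_step : forall u, al <= g1 u - u <= be.
Hypothesis g0_nonexp : forall a c, a <= c -> 0 <= g0 c - g0 a <= c - a.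
Hypothesis g1_nonexp : forall a c, a <= c -> 0 <= g1 c - g1 a <= c - a.
Hypothesis g0_strict : forall a c, a < c -> a < L -> 0 < c -> g0 c - g0 a < c - a.
Hypothesis g1_L : forall u, u <= 0 -> g1 u < L.
Hypothesis g0_L : forall u, L <= u -> 0 <= g0 u.

Let nonexp0 := monotone_nonexpansive g0_nonexp.
Let nonexp1 := monotone_nonexpansive g1_nonexp.

Let archimedean_al (x : R) : exists n : nat, x <= n%:R * al.
Proof.
exists (Num.trunc (`|x| / al)).+1.
have := truncnS_gt (`|x| / al); rewrite ltr_pdivrMr// => h.
exact: le_trans (ler_norm x) (ltW h).
Qed.

(* A pair at minimal distance stays at minimal distance, but it can be moved
   to a place where [g0] strictly contracts. *)
Let no_isometric_pair (Q : R -> R -> Prop) :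
  (forall a c, Q a c -> a < c -> Q (g0 a) (g0 c) /\ g0 c - g0 a = c - a) ->
  (forall a c, Q a c -> a < c -> Q (g1 a) (g1 c) /\ g1 c - g1 a = c - a) ->
  forall a c, Q a c -> a < c -> False.
Proof.
move=> Q0 Q1.
have strict a c : Q a c -> a < c -> a < L -> 0 < c -> False.
  by move=> /Q0 h ac aL c0; have [_] := h ac; have := g0_strict ac aL c0; lra.
have al_gt0 := al0.
(* A pair left of 0 climbs under [g1], by at least [al] each time. When its upper point passes 0 it
   is still below [L] by [g1_L], so the lower point is too, and [g0_strict] applies. The descent
   from beyond [L] is symmetric. *)
have up n a c : Q a c -> a < c -> c <= 0 -> - c <= n%:R * al -> False.
  elim: n a c => [|n IH] a c Qac ac c0 cn.
    have [Q' e] := Q1 _ _ Qac ac; apply: (strict _ _ Q'); first lra.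
      by have := g1_L c0; lra.
    by have := g1_step c; lra.
  have [Q' e] := Q1 _ _ Qac ac.
  have [c1|c1] := leP (g1 c) 0.
    apply: (IH _ _ Q') => //; first lra.
    by have := g1_step c; move: cn; rewrite mulrSr mulrDl mul1r; lra.
  by apply: (strict _ _ Q') => //; [lra|have := g1_L c0; lra].
have down n a c : Q a c -> a < c -> L <= a -> a - L <= n%:R * al -> False.
  elim: n a c => [|n IH] a c Qac ac aL an.
    have [Q' e] := Q0 _ _ Qac ac; apply: (strict _ _ Q'); first lra.
      by have := g0_step a; lra.
    by have := g0_L aL; lra.
  have [Q' e] := Q0 _ _ Qac ac.
  have [a1|a1] := leP L (g0 a).
    apply: (IH _ _ Q') => //; first lra.
    by have := g0_step a; move: an; rewrite mulrSr mulrDl mul1r; lra.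
  by apply: (strict _ _ Q') => //; [lra|have := g0_L aL; lra].
move=> a c Qac ac.
have [c0|c0] := leP c 0; first by have [n cn] := archimedean_al (- c); exact: (up n a c).
have [aL|aL] := leP L a; first by have [n an] := archimedean_al (a - L); exact: (down n a c).
exact: (strict _ _ Qac).
Qed.

(** Restores compactness, as the sets are unbounded. The point of [E] is driven to the box and the
    other one follows with the same maps. Steps are at most [be], so neither climbing nor descending
    can leap over [[0, be]]. *)
Let move_to_box (E E' : set R) a c :
  (forall u, E u -> E (g0 u) /\ E (g1 u)) ->
  (forall u, E' u -> E' (g0 u) /\ E' (g1 u)) -> E a -> E' c ->
  exists a' c', [/\ E a', E' c', 0 <= a' <= be & `|a' - c'| <= `|a - c|].
Proof.
move=> EE EE' Ea Ec; have al_gt0 := al0.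
have up n a' c' : E a' -> E' c' -> a' <= 0 -> - a' <= n%:R * al ->
    `|a' - c'| <= `|a - c| ->
    exists a' c', [/\ E a', E' c', 0 <= a' <= be & `|a' - c'| <= `|a - c|].
  elim: n a' c' => [|n IH] a' c' Ea' Ec' a0 an ac.
    by exists a', c'; split=> //; have := g0_step 0; lra.
  have [a1|a1] := leP (g1 a') 0.
    apply: (IH (g1 a') (g1 c')) => //; [exact: (EE _ Ea').2|exact: (EE' _ Ec').2| |].
      by have := g1_step a'; move: an; rewrite mulrSr mulrDl mul1r; lra.
    exact: le_trans ac.
  exists (g1 a'), (g1 c'); split; [exact: (EE _ Ea').2|exact: (EE' _ Ec').2| |].
    by have := g1_step a'; lra.
  exact: le_trans ac.
have down n a' c' : E a' -> E' c' -> be <= a' -> a' - be <= n%:R * al ->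
    `|a' - c'| <= `|a - c| ->
    exists a' c', [/\ E a', E' c', 0 <= a' <= be & `|a' - c'| <= `|a - c|].
  elim: n a' c' => [|n IH] a' c' Ea' Ec' a0 an ac.
    by exists a', c'; split=> //; have := g0_step 0; lra.
  have [a1|a1] := leP be (g0 a').
    apply: (IH (g0 a') (g0 c')) => //; [exact: (EE _ Ea').1|exact: (EE' _ Ec').1| |].
      by have := g0_step a'; move: an; rewrite mulrSr mulrDl mul1r; lra.
    exact: le_trans ac.
  exists (g0 a'), (g0 c'); split; [exact: (EE _ Ea').1|exact: (EE' _ Ec').1| |].
    by have := g0_step a'; lra.
  exact: le_trans ac.
have [a0|a0] := leP a 0; first by have [n an] := archimedean_al (- a); exact: (up n a c).
have [ab|ab] := leP be a; first by have [n an] := archimedean_al (a - be); exact: (down n a c).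
by exists a, c; split=> //; rewrite !ltW.
Qed.

Lemma invariant_closed_meet (E E' : set R) : closed E -> closed E' ->
  E !=set0 -> E' !=set0 ->
  (forall u, E u -> E (g0 u) /\ E (g1 u)) ->
  (forall u, E' u -> E' (g0 u) /\ E' (g1 u)) -> exists u, E u /\ E' u.
Proof.
move=> cE cE' [a Ea] [c Ec] EE EE'.
pose D : R := `|a - c|.
pose X := (E `&` `[0, be]%classic) `*` (E' `&` `[- D, be + D]%classic).
have cX : compact X.
  by apply: compact_setX; rewrite setIC; apply: compact_closedI => //; exact: segment_compact.
have inX a' c' : E a' -> E' c' -> 0 <= a' <= be -> `|a' - c'| <= D -> X (a', c').
  move=> Ea' Ec' ab; rewrite ler_norml => /andP[d1 d2].
  by split; split => //=; rewrite in_itv/=; lra.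
have X0 : X !=set0.
  have [a' [c' [Ea' Ec' ab ac]]] := move_to_box EE EE' Ea Ec.
  by exists (a', c'); exact: inX.
pose dist (z : R * R) := `|z.1 - z.2|.
have cd : continuous dist.
  by move=> z; apply: cvg_norm; apply: cvgB; [exact: cvg_fst|exact: cvg_snd].
have [[a1 c1] /set_mem[/= [Ea1 _] [Ec1 _]] dmin] :=
  compact_EVT_min X0 cX (continuous_subspaceT cd).
(* A minimum over [X] is one over all pairs: moving a pair to the box lands in [X] unless its
   distance exceeds [D], and then the moved copy of the initial pair is closer. *)
have {}dmin a' c' : E a' -> E' c' -> `|a1 - c1| <= `|a' - c'|.
  move=> Ea' Ec'; have [a2 [c2 [Ea2 Ec2 ab ac]]] := move_to_box EE EE' Ea' Ec'.
  apply: le_trans ac; have [d|/ltW d] := leP `|a2 - c2| D.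
    by have := dmin (a2, c2) (mem_set (inX _ _ Ea2 Ec2 ab d)).
  apply: le_trans d; have [a3 [c3 [Ea3 Ec3 ab3 ac3]]] := move_to_box EE EE' Ea Ec.
  apply: (le_trans _ ac3).
  exact: (dmin (a3, c3) (mem_set (inX _ _ Ea3 Ec3 ab3 ac3))).
have [e|ne] := eqVneq a1 c1; first by exists a1; split=> //; rewrite e.
pose m := `|a1 - c1|.
have iso0 a' c' : E a' -> E' c' -> `|a' - c'| = m -> `|g0 a' - g0 c'| = m.
  move=> Ea' Ec' e; apply/eqP; rewrite eq_le -{1}e nonexp0/=.
  by apply: dmin; [exact: (EE _ Ea').1|exact: (EE' _ Ec').1].
have iso1 a' c' : E a' -> E' c' -> `|a' - c'| = m -> `|g1 a' - g1 c'| = m.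
  move=> Ea' Ec' e; apply/eqP; rewrite eq_le -{1}e nonexp1/=.
  by apply: dmin; [exact: (EE _ Ea').2|exact: (EE' _ Ec').2].
exfalso.
have [ac|ca] := ltP a1 c1.
(* At minimal distance a nonexpansive map must preserve the distance. Each order of the two points
   needs its own [Q], whose first argument is the smaller point. *)
- apply: (no_isometric_pair (Q := fun a c => [/\ E a, E' c & `|a - c| = m]) _ _ _ ac); last by [].
    move=> a' c' [Ea' Ec' e] ac'; have e' := iso0 _ _ Ea' Ec' e.
    split; first by split=> //; [exact: (EE _ Ea').1|exact: (EE' _ Ec').1].
    have := g0_nonexp (ltW ac'); rewrite distrC ger0_norm in e; last lra.
    by move=> h; rewrite distrC ger0_norm in e'; lra.
  move=> a' c' [Ea' Ec' e] ac'; have e' := iso1 _ _ Ea' Ec' e.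
  split; first by split=> //; [exact: (EE _ Ea').2|exact: (EE' _ Ec').2].
  have := g1_nonexp (ltW ac'); rewrite distrC ger0_norm in e; last lra.
  by move=> h; rewrite distrC ger0_norm in e'; lra.
have {}ca : c1 < a1 by rewrite lt_neqAle eq_sym ne.
apply: (no_isometric_pair (Q := fun c a => [/\ E a, E' c & `|a - c| = m]) _ _ _ ca); last by [].
  move=> c' a' [Ea' Ec' e] ac'; have e' := iso0 _ _ Ea' Ec' e.
  split; first by split=> //; [exact: (EE _ Ea').1|exact: (EE' _ Ec').1].
  have := g0_nonexp (ltW ac'); rewrite ger0_norm in e; last lra.
  by move=> h; rewrite ger0_norm in e'; lra.
move=> c' a' [Ea' Ec' e] ac'; have e' := iso1 _ _ Ea' Ec' e.
split; first by split=> //; [exact: (EE _ Ea').2|exact: (EE' _ Ec').2].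
have := g1_nonexp (ltW ac'); rewrite ger0_norm in e; last lra.
by move=> h; rewrite ger0_norm in e'; lra.
Qed.

End harmonic.

Lemma geometric_sum_le (R : realType) (x : R) n : 0 <= x < 1 ->
  \sum_(j < n) x ^+ j <= (1 - x)^-1.
Proof.
move=> /andP[x0 x1]; elim: n => [|n IH].
  by rewrite big_ord0 invr_ge0; lra.
rewrite big_ord_recl expr0.
under eq_bigr do rewrite /= exprS.
rewrite -mulr_sumr; apply: (@le_trans _ _ (1 + x * (1 - x)^-1)).
  by rewrite lerD2l ler_wpM2l.
by rewrite le_eqVlt; apply/orP; left; apply/eqP; field; lra.
Qed.

(** * Equicontinuity, tightness and constancy of the limits *)

Section ergodicity.
Context {R : realType}.
Variables (g0 g1 P0 P1 b : R -> R) (al be ep L lo hi M eta q d1 : R).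
Hypothesis al0 : 0 < al.
Hypothesis ep0 : 0 < ep.
Hypothesis P0_ge : forall u, ep <= P0 u.
Hypothesis P1_ge : forall u, ep <= P1 u.
Hypothesis P01 : forall u, P0 u + P1 u = 1.
Hypothesis g0_step : forall u, al <= u - g0 u <= be.
Hypothesis g1_step : forall u, al <= g1 u - u <= be.
Hypothesis lo_hi : lo < hi.
Hypothesis eta0 : 0 < eta.
Hypothesis g1_lo : forall u, u <= lo -> g1 u <= hi.
Hypothesis drift_left : forall u, u <= - M ->
  eta <= P0 u * (g0 u - u) + P1 u * (g1 u - u).
Hypothesis drift_right : forall u, M <= u ->
  P0 u * (g0 u - u) + P1 u * (g1 u - u) <= - eta.
Hypothesis g0_nonexp : forall a c, a <= c -> 0 <= g0 c - g0 a <= c - a.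
Hypothesis g1_nonexp : forall a c, a <= c -> 0 <= g1 c - g1 a <= c - a.
Hypothesis g0_strict : forall a c, a < c -> a < L -> 0 < c -> g0 c - g0 a < c - a.
Hypothesis g1_L : forall u, u <= 0 -> g1 u < L.
Hypothesis g0_L : forall u, L <= u -> 0 <= g0 u.
Hypothesis q1 : q < 1.
Hypothesis d1_gt0 : 0 < d1.
Hypothesis g0_contr : forall a c, lo < a <= hi -> `|a - c| <= d1 ->
  `|g0 a - g0 c| <= q * `|a - c|.
Hypothesis b_mono : {homo b : x y / x <= y}.
Hypothesis b_ge0 : forall x, 0 <= b x.
Hypothesis b_le1 : forall x, b x <= 1.
Hypothesis P0_b : forall a c, `|P0 a - P0 c| <= b `|a - c|.
Hypothesis b_dini : forall t e : R, 0 < t < 1 -> 0 < e ->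
  exists2 C, 0 < C & forall n, \sum_(j < n) b (C * t ^+ j) <= e.

Let U := averaging P0 P1 g0 g1.

Let P0_gt0 u : 0 < P0 u. Proof. exact: lt_le_trans (P0_ge u). Qed.
Let P1_gt0 u : 0 < P1 u. Proof. exact: lt_le_trans (P1_ge u). Qed.
Let P0_ge0 u : 0 <= P0 u. Proof. exact: ltW. Qed.
Let P1_ge0 u : 0 <= P1 u. Proof. exact: ltW. Qed.

(** Uniform in the number of iterations, but only locally uniform in [a], because the oscillation
    bound involves the unbounded [W a]. *)
Lemma iter_averaging_equicontinuous (f : R -> R) (K Lip : R) : 0 <= Lip ->
  (forall u, `|f u| <= K) -> (forall u w, `|f u - f w| <= Lip * `|u - w|) ->
  forall N e : R, 0 < e -> exists2 d, 0 < d & forall n a c, `|a| <= N ->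
    `|a - c| <= d -> `|iter n U f a - iter n U f c| <= e.
Proof.
move=> Lip0 fK fL N e e0.
have K0 : 0 <= K := le_trans (normr_ge0 _) (fK 0).
have [v [del [B [[del0 B1] vB vd vU]]]] :=
  lyapunov_linear al0 ep0 P0_ge P1_ge P01 g0_step g1_step lo_hi eta0 g1_lo
    drift_left drift_right.
have [W [r [C0 [s [[s0 /andP[r0 r1]] WB WU Wxy]]]]] :=
  lyapunov_exp P0_ge0 P1_ge0 P01 ep0 P0_ge q1 del0 B1 vB vd vU.
have W1 u : 1 <= W u by have [] := WB u.
have g_contr a c : `|a - c| <= d1 ->
    P0 a * (`|g0 a - g0 c| * W (g0 a)) + P1 a * (`|g1 a - g1 c| * W (g1 a)) <=
    r * (`|a - c| * W a).
  move=> ac; have [<-|nac] := eqVneq a c.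
    by rewrite !subrr !normr0 !mul0r !mulr0 addr0.
  have ac0 : 0 < `|a - c| by rewrite normr_gt0 subr_eq0.
  have h (g : R -> R) : `|g a - g c| <= `|a - c| -> 0 <= `|g a - g c| / `|a - c| <= 1.
    by move=> gac; rewrite divr_ge0//= ler_pdivrMr// mul1r.
  have hq : lo < a <= hi -> `|g0 a - g0 c| / `|a - c| <= q.
    by move=> aI; rewrite ler_pdivrMr//; exact: g0_contr.
  (* The two factors fed to [Wxy] are the ratios by which [g0] and [g1] shrink the distance of [a]
     and [c]. *)
  have := Wxy a _ _ (h _ (monotone_nonexpansive g0_nonexp a c)) (h _ (monotone_nonexpansive g1_nonexp a c)) hq.
  move=> /(ler_wpM2l (ltW ac0)); rewrite [leRHS]mulrCA; apply: le_trans.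
  by rewrite le_eqVlt; apply/orP; left; apply/eqP; field; rewrite gt_eqF.
(* Any [t] strictly between [r] and 1 would serve: [t < 1] for the Dini sum, [r < t] for the
   geometric one. *)
pose t := (1 + r) / 2.
have t0 : 0 < t by rewrite /t; lra.
have rt : 0 <= r / t < 1.
  by rewrite divr_ge0 ?ltW//= ltr_pdivrMr// mul1r /t; lra.
pose e1 := e / (4 * (K + 1)).
have e10 : 0 < e1 by rewrite divr_gt0// mulr_gt0//; lra.
have e1K : 2 * K * e1 <= e / 2.
  have : e1 * (K + 1) = e / 4 by rewrite /e1; field; lra.
  by lra.
have [|C C_gt0 Cb] := b_dini (_ : 0 < t < 1) e10; first by rewrite t0 /t; lra.
pose H := 2 * K / C * (1 - r / t)^-1 + Lip.
have H0 : 0 <= H.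
  rewrite addr_ge0// mulr_ge0 ?invr_ge0; [by []|by rewrite divr_ge0 ?mulr_ge0// ltW|lra].
pose WN := expR (s * (N + B)).
have WN0 : 0 < WN := expR_gt0 _.
have HW : 0 < 2 * (H + 1) * WN by rewrite mulr_gt0// mulr_gt0//; lra.
exists (Num.min d1 (e / (2 * (H + 1) * WN))); first by rewrite lt_min d1_gt0 divr_gt0.
move=> n a c aN; rewrite le_min => /andP[acd ace].
have := iter_averaging_osc P0_ge0 P1_ge0 P01 r0 r1 W1 g_contr
  (monotone_nonexpansive g0_nonexp) (monotone_nonexpansive g1_nonexp)
  b_mono b_ge0 b_le1 P0_b t0 Lip0 fK fL n C_gt0 acd.
rewrite -/U => /le_trans; apply.
have WaN : W a <= WN.
  have [_ /andP[_ /le_trans]] := WB a; apply.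
  by rewrite ler_expR ler_pM2l//; lra.
have h1 : 2 * K * \sum_(j < n) b (C * t ^+ j) <= e / 2.
  by apply: le_trans e1K; rewrite ler_wpM2l ?mulr_ge0.
have h2 : 2 * K / C * \sum_(j < n) (r / t) ^+ j + Lip <= H.
  by rewrite lerD2r ler_wpM2l ?geometric_sum_le// divr_ge0 ?mulr_ge0// ltW.
have z0 : 0 <= `|a - c| * W a by rewrite mulr_ge0//; apply: le_trans (W1 a).
have h3 : `|a - c| * W a <= e / (2 * (H + 1)).
  have -> : e / (2 * (H + 1)) = e / (2 * (H + 1) * WN) * WN.
    by field; rewrite gt_eqF//; lra.
  by apply: ler_pM => //; apply: le_trans (W1 a).
have h4 : H * (e / (2 * (H + 1))) <= e / 2.
  have -> : e / 2 = (H + 1) * (e / (2 * (H + 1))) by field; lra.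
  by rewrite ler_wpM2r//; [rewrite divr_ge0 ?ltW ?mulr_gt0//; lra|lra].
have := ler_wpM2r z0 h2; have := ler_wpM2l H0 h3; lra.
Qed.

(** Iterating [U W <= r W + C] keeps the mean of [W] along the orbit of 0 below a constant [S]; as
    [W] grows exponentially, Markov's inequality bounds the tails. *)
Lemma orbit_mean_tight (e : R) : 0 < e -> exists N : R, forall n,
  orbit_mean U n (fun u : R => (N < `|u|)%R%:R) 0 <= e.
Proof.
move=> e0.
have [v [del [B [[del0 B1] vB vd vU]]]] :=
  lyapunov_linear al0 ep0 P0_ge P1_ge P01 g0_step g1_step lo_hi eta0 g1_lo
    drift_left drift_right.
have [W [r [C [s [[s0 /andP[r0 r1]] WB WU _]]]]] :=
  lyapunov_exp P0_ge0 P1_ge0 P01 ep0 P0_ge q1 del0 B1 vB vd vU.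
have W1 u : 1 <= W u by have [] := WB u.
pose S := `|C| / (1 - r) + W 0.
have S0 : 0 < S.
  apply: ltr_wpDl; first by rewrite divr_ge0// subr_ge0 ltW.
  exact: lt_le_trans (W1 0).
have WS n : iter n U W 0 <= S.
  have h u : iter n U W u <= r ^+ n * W u + `|C| * \sum_(j < n) r ^+ j.
    elim: n u => [|n IH] u; first by rewrite big_ord0 expr0 mulr0 addr0 mul1r.
    rewrite iterS big_ord_recr /= exprS.
    have := lerD (ler_wpM2l (P0_ge0 u) (IH (g0 u))) (ler_wpM2l (P1_ge0 u) (IH (g1 u))).
    rewrite {1}/U {1}/averaging => /le_trans; apply.
    have rn : 0 <= r ^+ n by rewrite exprn_ge0 ?ltW.
    have := ler_wpM2l rn (WU u); have := ler_wpM2l rn (ler_norm C).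
    rewrite /U /averaging; set T := \sum_(j < n) _.
    have : (P0 u + P1 u) * (`|C| * T) = `|C| * T by rewrite P01 mul1r.
    lra.
  apply: le_trans (h 0) _; rewrite addrC; apply: lerD.
    by rewrite ler_wpM2l// geometric_sum_le// ltW.
  by rewrite ler_piMl ?exprn_ile1 ?(ltW r0) ?(ltW r1)//; apply: le_trans (W1 0).
(* Solves [expR (s * (N - B)) = S / e], so that [e / S * W] is at least 1 beyond [N]. *)
pose N := B + ln (S / e) / s.
have NS : expR (s * (N - B)) = S / e.
  rewrite /N addrAC subrr add0r mulrC divfK ?gt_eqF// lnK// posrE divr_gt0//.
have Se : 0 < e / S by rewrite divr_gt0.
exists N => n; apply: (@le_trans _ _ (orbit_mean U n (fun u => e / S * W u) 0)).
  apply: orbit_mean_le => // u; have [Nu|_] := ltP N `|u|; last first.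
    by rewrite mulr_ge0 ?(ltW Se)//; apply: le_trans (W1 u).
  rewrite mulrC -ler_pdivrMr// invf_div mul1r -NS.
  have [_ /andP[+ _]] := WB u; apply: le_trans.
  by rewrite ler_expR ler_pM2l// lerB// ltW.
rewrite orbit_meanZ /orbit_mean.
have eS : e = e / S * S by rewrite divfK ?gt_eqF.
rewrite [leRHS]eS ler_pM2l// -[leRHS](mean_cst n) ler_pM2l ?invr_gt0//.
by apply: ler_sum.
Qed.

(* The ultralimit of the orbit means is harmonic; by the maximum principle it
   attains its bounds, on closed invariant sets which must meet. *)
Lemma orbit_mean_cvg_cst (F : set_system nat) (FU : UltraFilter F) (f : R -> R)
    (K Lip : R) : F --> \oo -> 0 <= Lip ->
  (forall u, `|f u| <= K) -> (forall u w, `|f u - f w| <= Lip * `|u - w|) ->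
  exists c, forall N e : R, 0 < e ->
    \forall n \near F, forall u, `|u| <= N -> `|orbit_mean U n f u - c| <= e.
Proof.
move=> Foo Lip0 fK fL.
have FF := @ultra_proper _ F FU.
have equi (N e : R) : 0 < e -> exists2 d, 0 < d & forall n a c, `|a| <= N ->
    `|a - c| <= d -> `|orbit_mean U n f a - orbit_mean U n f c| <= e.
  move=> /(iter_averaging_equicontinuous Lip0 fK fL N)[d d0 dP].
  by exists d => // n a c aN ac; apply: orbit_mean_dist => k; exact: dP.
pose psi u := ulim F (fun n => orbit_mean U n f u).
have psi_cvg u : orbit_mean U n f u @[n --> F] --> psi u.
  by apply: (@orbit_mean_cvg R g0 g1 P0 P1 P0_ge0 P1_ge0 P01 F FU f K).
have psiK u : `|psi u| <= K.
  apply: (@closed_cvg _ _ F _ (fun n => `|orbit_mean U n f u|) (fun x => x <= K)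
    (@closed_le _ K) _ _ (cvg_norm (psi_cvg u))).
  by apply: nearW => n; exact: orbit_mean_norm.
have psiU u : U psi u = psi u.
  exact: (@ulim_harmonic R g0 g1 P0 P1 P0_ge0 P1_ge0 P01 F FU Foo f K).
have psi_cont : continuous psi.
  move=> a; apply/cvgrPdist_le => e e0.
  have [d d0 dP] := equi `|a| _ e0.
  exists d => //= c ac.
  apply: (@closed_cvg _ _ F _
    (fun n => `|orbit_mean U n f a - orbit_mean U n f c|) (fun x => x <= e)
    (@closed_le _ e) _ _ (cvg_norm (cvgB (psi_cvg a) (psi_cvg c)))).
  by apply: nearW => n; apply: dP => //; exact: ltW.
have [v [del [B [[del0 B1] vB vd vU]]]] :=
  lyapunov_linear al0 ep0 P0_ge P1_ge P01 g0_step g1_step lo_hi eta0 g1_lo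
    drift_left drift_right.
have v0 u : 0 <= v u by have [] := vB u.
have [z zmax] := harmonic_max P0_gt0 P1_gt0 P01 (ltW lo_hi) psi_cont
  (fun u => le_trans (ler_norm _) (psiK u)) psiU del0 v0 vU.
(* The minimum of [psi] is obtained as the maximum of its opposite, which is harmonic too. *)
pose npsi u := - psi u.
have npsiU u : U npsi u = npsi u by rewrite /npsi -psiU /U /averaging; ring.
have npsi_cont : continuous npsi by move=> u; apply: cvgN; exact: psi_cont.
have npsiK u : npsi u <= K by have := psiK u; rewrite ler_norml /npsi; lra.
have [y ymax] := harmonic_max P0_gt0 P1_gt0 P01 (ltW lo_hi) npsi_cont npsiK npsiU
  del0 v0 vU.
have step (h : R -> R) (x : R) : (forall u, U h u = h u) ->
    (forall u, h u <= h x) -> forall u, h u = h x ->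
    h (g0 u) = h x /\ h (g1 u) = h x.
  move=> hU hx u ux; have hu w : h w <= h u by rewrite ux.
  by have := harmonic_max_step P0_gt0 P1_gt0 P01 hU hu; rewrite ux.
have closedE (h : R -> R) (x : R) : continuous h -> closed [set u | h u = h x].
  move=> ch; rewrite (_ : [set _ | _] = h @^-1` [set h x]) //.
  by apply: preimage_closed => //; exact: closed_eq.
have [w [wz wy]] := invariant_closed_meet al0 g0_step g1_step g0_nonexp g1_nonexp
  g0_strict g1_L g0_L (closedE psi z psi_cont) (closedE npsi y npsi_cont)
  (ex_intro _ z erefl) (ex_intro _ y erefl) (step _ _ psiU zmax) (step _ _ npsiU ymax).
have psi_cst u : psi u = psi z.
  apply/eqP; rewrite eq_le zmax/=.
  have := ymax u; rewrite /= in wz wy; rewrite -wy /npsi wz; lra.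
exists (psi z) => N e e0.
have [d d0 dP] := equi N (e / 2) ltac:(lra).
have near_pt u : \forall n \near F, `|orbit_mean U n f u - psi z| <= e / 2.
  have := psi_cvg u; rewrite psi_cst => /cvgrPdist_le /(_ (e / 2) ltac:(lra)).
  by apply: filterS => n; rewrite distrC.
(* From pointwise to locally uniform: pointwise limits at the grid [- N + k%:R * d], spread over
   cells of width [d] by equicontinuity. Finitely many cells suffice. *)
have cover k : \forall n \near F, forall u, `|u| <= N -> u <= - N + k%:R * d ->
    `|orbit_mean U n f u - psi z| <= e.
  elim: k => [|k IH].
    apply: filterS (near_pt (- N)) => n h u; rewrite mul0r addr0 ler_norml.
    move=> /andP[a _] c; have -> : u = - N by apply/eqP; rewrite eq_le a c.
    by apply: le_trans h _; lra.
  have := near_pt (- N + k%:R * d); apply: filterS2 IH => n IH h u uN uk.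
  have [uk'|uk'] := leP u (- N + k%:R * d); first exact: IH.
  have hd : `|u - (- N + k%:R * d)| <= d.
    by rewrite gtr0_norm ?subr_gt0//; move: uk; rewrite mulrSr mulrDl mul1r; lra.
  have := dP n u _ uN hd.
  have := ler_distD (orbit_mean U n f (- N + k%:R * d)) (orbit_mean U n f u) (psi z).
  lra.
apply: filterS (cover (Num.trunc ((N + `|N|) / d)).+1) => n h u uN.
apply: h => //; have := truncnS_gt ((N + `|N|) / d); rewrite ltr_pdivrMr//.
have := ler_norm u; have := ler_norm N; lra.
Qed.

End ergodicity.

(** * The logarithmic coordinate *)

Section log_coordinate.
Context {R : realType}.
Implicit Types x u w : R.

Definition logc x : R :=
  if x <= 1 / 2 then ln (2 * x) else - ln (2 * (1 - x)).

(** The distribution function of the Laplace law, with density half of the exponential of minus the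
    absolute value; [logc] is its inverse on ]0, 1[. *)
Definition unlogc u : R :=
  if u <= 0 then expR u / 2 else 1 - expR (- u) / 2.

Lemma unlogc_le0 u : u <= 0 -> unlogc u = expR u / 2.
Proof. by rewrite /unlogc => ->. Qed.

Lemma unlogc_ge0 u : 0 <= u -> unlogc u = 1 - expR (- u) / 2.
Proof.
rewrite /unlogc le_eqVlt => /orP[/eqP <-|u0]; last by rewrite leNgt u0.
by rewrite lexx oppr0 expR0; field.
Qed.

Lemma unlogcN u : unlogc (- u) = 1 - unlogc u.
Proof.
have [u0|u0] := leP u 0.
  by rewrite unlogc_ge0 ?oppr_ge0// unlogc_le0// opprK.
by rewrite unlogc_le0 ?oppr_le0 ?(ltW u0)// unlogc_ge0 ?(ltW u0)//; ring.
Qed.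

Lemma unlogc_half u : (unlogc u <= 1 / 2) = (u <= 0).
Proof.
have [u0|u0] := leP u 0.
  by rewrite unlogc_le0// ler_pM2r ?invr_gt0// -expR0 ler_expR.
have : expR (- u) < 1 by rewrite -[ltRHS]expR0 ltr_expR oppr_lt0.
by rewrite (unlogc_ge0 (ltW u0)) => h; apply/negbTE; rewrite -ltNge; lra.
Qed.

Lemma unlogc_range u : 0 < unlogc u < 1.
Proof.
have [u0|u0] := leP u 0.
  have : expR u <= 1 by rewrite -expR0 ler_expR.
  by rewrite unlogc_le0//; have := expR_gt0 u; lra.
have : expR (- u) < 1 by rewrite -[ltRHS]expR0 ltr_expR oppr_lt0.
by rewrite unlogc_ge0 ?(ltW u0)//; have := expR_gt0 (- u); lra.
Qed.

Lemma unlogcK u : logc (unlogc u) = u.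
Proof.
rewrite /logc unlogc_half; have [u0|u0] := leP u 0.
  by rewrite unlogc_le0// mulrC divfK// expRK.
rewrite unlogc_ge0 ?(ltW u0)//.
have -> : 2 * (1 - (1 - expR (- u) / 2)) = expR (- u) by field.
by rewrite expRK opprK.
Qed.

Lemma logcK x : 0 < x < 1 -> unlogc (logc x) = x.
Proof.
move=> /andP[x0 x1]; rewrite /logc; have [xh|xh] := leP x (1 / 2).
  rewrite unlogc_le0 ?ln_le0//; last lra.
  by rewrite lnK ?posrE ?mulr_gt0//; field.
rewrite unlogc_ge0; last by rewrite oppr_ge0 ln_le0//; lra.
by rewrite opprK lnK ?posrE; [field|lra].
Qed.

(** With Lipschitz constant 1, the modulus of [p0] serves unchanged in the new coordinate. Proved on
    the negative half-line from [1 + x <= expR x], extended by symmetry. *)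
Lemma unlogc_lip u w : u <= w -> 0 <= unlogc w - unlogc u <= w - u.
Proof.
have half (a c : R) : a <= c -> c <= 0 -> 0 <= unlogc c - unlogc a <= c - a.
  move=> ac c0; rewrite !unlogc_le0//; last exact: le_trans c0.
  have e1 : expR a <= expR c by rewrite ler_expR.
  have e2 : expR c <= 1 by rewrite -expR0 ler_expR.
  have e3 := expR_ge1Dx (a - c).
  have e4 : expR a = expR c * expR (a - c) by rewrite -expRD; congr expR; ring.
  have e5 := expR_gt0 c.
  have : expR c * (1 + (a - c)) <= expR a by rewrite e4 ler_pM2l.
  have : expR c * (c - a) <= 1 * (c - a) by rewrite ler_wpM2r//; lra.
  lra.
move=> uw; have [w0|w0] := leP w 0; first exact: half.
have [u0|u0] := leP u 0; last first.
  have := half (- w) (- u); rewrite !unlogcN; lra.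
have h1 := half u 0 u0 (lexx _).
have := half (- w) 0; rewrite unlogcN; have := unlogcN 0; rewrite oppr0; lra.
Qed.

Lemma unlogc_dist u w : `|unlogc u - unlogc w| <= `|u - w|.
Proof. by apply: monotone_nonexpansive => a c; exact: unlogc_lip. Qed.

Lemma unlogc_le u w : (unlogc u <= unlogc w) = (u <= w).
Proof.
have [uw|wu] := leP u w; first by have := unlogc_lip uw; lra.
apply/negbTE; rewrite -ltNge lt_neqAle.
have := unlogc_lip (ltW wu); rewrite subr_ge0 => /andP[-> _]; rewrite andbT.
by apply/eqP => /(congr1 logc); rewrite !unlogcK => e; rewrite e ltxx in wu.
Qed.

Lemma unlogc_lt u w : (unlogc u < unlogc w) = (u < w).
Proof. by rewrite !ltNge unlogc_le. Qed.

Lemma logc_sub x : 0 < x < 1 -> logc (1 - x) = - logc x.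
Proof. by move=> x01; rewrite -[in LHS](logcK x01) -unlogcN unlogcK. Qed.

End log_coordinate.

(** The left side is [1 + (b - a) / (2 - b)], and [b / (2 - b)] increases with [b]. It is meant for
    [a], [b] of the form [expR (- w)], [expR (- u)] and [t = w - u]. *)
Lemma ratio_le (F : realFieldType) (a b e t : F) : b <= e -> e < 1 -> 0 <= t ->
  b * (1 - t) <= a -> (2 - a) / (2 - b) <= 1 + e / (2 - e) * t.
Proof.
move=> be e1 t0 ab; rewrite ler_pdivrMr; last lra.
have : b * t <= e / (2 - e) * (2 - b) * t.
  by rewrite ler_wpM2r// mulrAC ler_pdivlMr; lra.
lra.
Qed.

(** * The two maps in the logarithmic coordinate *)

Section interval_maps.
Context {R : realType}.
Variables (x0 y0 : R).
Hypothesis x0y0 : 1 / 2 < x0 < 1 /\ 1 / 2 <= y0 < x0.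
Implicit Types x u w a c : R.

Let a0 := slope0 x0 y0.
Let a1 := slope1 x0 y0.

Lemma slope0_bounds : [/\ 1 / 2 < a0, a0 < 1 & a0 * x0 = y0].
Proof.
have [/andP[h1 h2] /andP[h3 h4]] := x0y0.
have x00 : 0 < x0 by lra.
rewrite /a0 /slope0; split; last by rewrite divfK ?gt_eqF.
  by rewrite ltr_pdivlMr//; lra.
by rewrite ltr_pdivrMr//; lra.
Qed.

Lemma slope1_bounds : 1 < a1 /\ a1 * (1 - x0) = 1 - y0.
Proof.
have [/andP[h1 h2] /andP[h3 h4]] := x0y0.
have x01 : 0 < 1 - x0 by lra.
rewrite /a1 /slope1; split; last by rewrite divfK ?gt_eqF.
by rewrite ltr_pdivlMr//; lra.
Qed.

Lemma f0_range x : 0 < x < 1 -> 0 < f0 x0 y0 x < 1.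
Proof.
have [/andP[h1 h2] /andP[h3 h4]] := x0y0.
have [b0 b1 b2] := slope0_bounds; have [c0 c1] := slope1_bounds.
rewrite /f0 -/a0 -/a1 => /andP[x1 x2]; case: ifP => [xx|/negbT].
  have : 0 < a0 * x by rewrite mulr_gt0//; lra.
  have : a0 * x <= 1 * x by rewrite ler_wpM2r//; lra.
  lra.
rewrite -ltNge => xx.
have : a1 * (x - 1) < a1 * 0 by rewrite ltr_pM2l; lra.
have : a1 * (1 - x) <= a1 * (1 - x0) by rewrite ler_pM2l; lra.
lra.
Qed.

Lemma f0_le x y : x <= y -> f0 x0 y0 x <= f0 x0 y0 y.
Proof.
have [/andP[h1 h2] /andP[h3 h4]] := x0y0.
have [b0 b1 b2] := slope0_bounds; have [c0 c1] := slope1_bounds.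
rewrite /f0 -/a0 -/a1 => xy; case: ifP => [xx|/negbT]; case: ifP => [yx|/negbT].
- by rewrite ler_pM2l//; lra.
- rewrite -ltNge => yx.
  have : a1 * (1 - y) <= a1 * (1 - x0) by rewrite ler_pM2l; lra.
  have : a0 * x <= a0 * x0 by rewrite ler_pM2l; lra.
  lra.
- by rewrite -ltNge => xx; lra.
- move=> _ _; have : a1 * (x - 1) <= a1 * (y - 1) by rewrite ler_pM2l; lra.
  lra.
Qed.

Definition g0 u : R := logc (f0 x0 y0 (unlogc u)).
Definition g1 u : R := logc (f1 x0 y0 (unlogc u)).

Lemma g0E u : unlogc (g0 u) = f0 x0 y0 (unlogc u).
Proof. by rewrite /g0 logcK//; apply: f0_range; exact: unlogc_range. Qed.

Lemma g1N u : g1 u = - g0 (- u).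
Proof.
rewrite /g1 /f1 -unlogcN logc_sub//; apply: f0_range; exact: unlogc_range.
Qed.

Lemma f1_range x : 0 < x < 1 -> 0 < f1 x0 y0 x < 1.
Proof. by move=> h; have := @f0_range (1 - x); rewrite /f1; lra. Qed.

Lemma g1E u : unlogc (g1 u) = f1 x0 y0 (unlogc u).
Proof. by rewrite /g1 logcK//; apply: f1_range; exact: unlogc_range. Qed.

Lemma g0_mono a c : a <= c -> g0 a <= g0 c.
Proof. by rewrite -[g0 a <= _]unlogc_le !g0E -unlogc_le; exact: f0_le. Qed.

(** Far from the centre, a step outwards has length [al] and a step inwards has length [be]. *)
Let al := - ln a0.
Let be := ln a1.
Let L := logc x0.
(** The zero of [g0]: its point of ]0, 1[ is sent by [f0] to 1/2. That [m <= L] is the condition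
    [1 / 2 <= y0]. *)
Let m := logc (1 / (2 * a0)).

Lemma unlogcL : unlogc L = x0.
Proof. by have [/andP[h1 h2] _] := x0y0; rewrite logcK//; lra. Qed.

Lemma unlogcm : unlogc m = 1 / (2 * a0) /\ 1 / 2 < 1 / (2 * a0) <= x0.
Proof.
have [/andP[h1 h2] /andP[h3 h4]] := x0y0.
have [b0 b1 b2] := slope0_bounds.
have h : 1 / 2 < 1 / (2 * a0) <= x0.
  rewrite ltr_pdivlMr; last by lra.
  by rewrite ler_pdivrMr; lra.
by split=> //; rewrite logcK//; lra.
Qed.

Lemma m_gt0 : 0 < m.
Proof. by have [mm /andP[h _]] := unlogcm; rewrite ltNge -unlogc_half mm -ltNge. Qed.

Lemma m_le_L : m <= L.
Proof. by rewrite -unlogc_le unlogcL; have [-> /andP[_ ->]] := unlogcm. Qed.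

Lemma L_gt0 : 0 < L. Proof. exact: lt_le_trans m_gt0 m_le_L. Qed.

Let s u := u - g0 u.

Lemma expR_logc_lo x : 0 < x -> x <= 1 / 2 -> expR (logc x) = 2 * x.
Proof. by move=> x00 xh; rewrite /logc xh lnK// posrE mulr_gt0. Qed.

Lemma expR_logc_hi x : 1 / 2 <= x -> x < 1 -> expR (- logc x) = 2 * (1 - x).
Proof.
rewrite /logc le_eqVlt => /orP[/eqP <-|xh] x1.
  have -> : 2 * (1 / 2) = 1 :> R by field.
  by rewrite lexx ln1 oppr0 expR0; field.
by rewrite leNgt xh/= opprK lnK// posrE; lra.
Qed.

Lemma displacement_neg u : u <= 0 -> s u = al.
Proof.
have [/andP[h1 h2] /andP[h3 h4]] := x0y0; have [b0 b1 b2] := slope0_bounds.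
move=> u0; have uh : unlogc u <= 1 / 2 by rewrite unlogc_half.
have ux : unlogc u <= x0 by lra.
have /andP[u1 u2] := unlogc_range u.
have hh : a0 * unlogc u <= 1 / 2.
  by have := ler_wpM2r (ltW u1) (ltW b1); lra.
rewrite /s /g0 /f0 ux -/a0 /logc hh unlogc_le0//.
have -> : 2 * (a0 * (expR u / 2)) = a0 * expR u by field.
by rewrite lnM ?posrE ?expR_gt0//; [rewrite expRK /al; ring|lra].
Qed.

(** As [1 / 2 <= y0], both the point and its image lie in the upper half, where [logc] is minus a
    logarithm of [1 - x], and [f0] multiplies [1 - x] by [a1]. *)
Lemma displacement_far u : L <= u -> s u = be.
Proof.
have [/andP[h1 h2] /andP[h3 h4]] := x0y0; have [b0 b1] := slope1_bounds.
have [c0 c1 c2] := slope0_bounds.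
have L0 := L_gt0.
move=> Lu; have u0 : 0 <= u by lra.
have ux : x0 <= unlogc u by rewrite -unlogcL unlogc_le.
have fE : f0 x0 y0 (unlogc u) = a1 * (unlogc u - 1) + 1.
  rewrite /f0 -/a0 -/a1; case: ifP => // ux'.
  have -> : unlogc u = x0 by apply/eqP; rewrite eq_le ux'.
  by lra.
have eu := expR_gt0 (- u).
have fE' : 1 - f0 x0 y0 (unlogc u) = a1 * expR (- u) / 2.
  by rewrite fE unlogc_ge0//; ring.
have fh : 1 / 2 <= f0 x0 y0 (unlogc u).
  by apply: (@le_trans _ _ y0) => //; have := f0_le ux; rewrite {1}/f0 lexx -/a0 c2.
have f1' : f0 x0 y0 (unlogc u) < 1 by have := f0_range (unlogc_range u); lra.
have := expR_logc_hi fh f1'; rewrite fE' -/(g0 u).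
have -> : 2 * (a1 * expR (- u) / 2) = a1 * expR (- u) by field.
move=> /(congr1 (@ln R)); rewrite expRK lnM ?posrE//; [|lra].
by rewrite expRK /s /be => h; lra.
Qed.

(* [expR (- s u)] is [4 a0 x (1 - x)] or [(1 - x) / (1 - a0 x)], x = unlogc u,
   according to the position of [a0 x] with respect to 1/2. *)
Lemma displacement_lt u w : 0 <= u -> u < w -> w <= L -> s u < s w.
Proof.
have [/andP[h1 h2] /andP[h3 h4]] := x0y0; have [b0 b1 b2] := slope0_bounds.
move=> u0 uw wL.
pose ph x := if a0 * x <= 1 / 2 then 4 * a0 * x * (1 - x) else (1 - x) / (1 - a0 * x).
have sE v : 0 <= v -> v <= L -> expR (- s v) = ph (unlogc v).
  move=> v0 vL.
  have /andP[r1 r2] := unlogc_range v.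
  have vh : 1 / 2 <= unlogc v.
    by have := @unlogc_lip _ 0 v v0; rewrite (unlogc_le0 (lexx 0)) expR0; lra.
  have vx : unlogc v <= x0 by rewrite -unlogcL unlogc_le.
  have ev : expR (- v) = 2 * (1 - unlogc v) by rewrite unlogc_ge0//; field.
  have av0 : 0 < a0 * unlogc v by rewrite mulr_gt0//; lra.
  have av1 : a0 * unlogc v < 1.
    by have := ler_wpM2r (ltW r1) (ltW b1); lra.
  rewrite /s opprB addrC expRD ev /g0 /f0 vx -/a0 /ph.
  case: ifP => [lo|/negbT]; first by rewrite expR_logc_lo//; ring.
  rewrite -ltNge => hi; have := expR_logc_hi (ltW hi) av1.
  rewrite expRN => /(congr1 GRing.inv); rewrite invrK => ->.
  by field; lra.
suff : expR (- s w) < expR (- s u) by rewrite ltr_expR ltrN2.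
rewrite [ltLHS](sE w (le_trans u0 (ltW uw)) wL) [ltRHS](sE u u0 (le_trans (ltW uw) wL)).
have uw' : unlogc u < unlogc w by rewrite unlogc_lt.
have uh : 1 / 2 <= unlogc u.
  by have := @unlogc_lip _ 0 u u0; rewrite (unlogc_le0 (lexx 0)) expR0; lra.
have /andP[_ w1] := unlogc_range w.
move: (unlogc u) (unlogc w) uw' uh w1 => x y xy xh y1.
have ay1 : a0 * y < 1.
  by have := ler_wpM2r (_ : 0 <= y) (ltW b1) => /(_ ltac:(lra)); lra.
have axy : a0 * x < a0 * y by rewrite ltr_pM2l//; lra.
rewrite /ph; have [ax|ax] := leP (a0 * x) (1 / 2); have [ay|ay] := leP (a0 * y) (1 / 2).
- have -> : 4 * a0 * y * (1 - y) = 4 * a0 * x * (1 - x) - 4 * a0 * ((y - x) * (x + y - 1)) by ring.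
  have : 0 < 4 * a0 * ((y - x) * (x + y - 1)) by apply: mulr_gt0; [lra|apply: mulr_gt0; lra].
  lra.
- rewrite ltr_pdivrMr; last lra.
  have a00 : 0 < a0 by lra.
  (* The two formulas for [ph] agree at [c], which separates [x] from [y]; the comparison passes
     through that common value. *)
  pose c := 1 / (2 * a0); have ac : a0 * c = 1 / 2 by rewrite /c; field; lra.
  have xc : x <= c by rewrite -(ler_pM2l a00) ac.
  have l1 : 4 * a0 * c * (1 - c) <= 4 * a0 * x * (1 - x).
    have : 0 <= a0 * ((c - x) * (c + x - 1)).
      by apply: mulr_ge0; [lra|apply: mulr_ge0; lra].
    lra.
  have l2 : 1 - y < 4 * a0 * c * (1 - c) * (1 - a0 * y).
    rewrite -(ltr_pM2l a00).
    have -> : a0 * (4 * a0 * c * (1 - c) * (1 - a0 * y)) =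
      4 * (a0 * c) * (a0 - a0 * c) * (1 - a0 * y) by ring.
    rewrite ac; have : 0 < (1 - a0) * (2 * (a0 * y) - 1) by rewrite mulr_gt0//; lra.
    lra.
  apply: lt_le_trans l2 _; rewrite ler_wpM2r//; lra.
- lra.
- rewrite ltr_pdivrMr; last lra.
  rewrite mulrAC ltr_pdivlMr; last lra.
  have : 0 < (y - x) * (1 - a0) by rewrite mulr_gt0//; lra.
  lra.
Qed.

Lemma al_gt0 : 0 < al.
Proof.
by have [b0 b1 _] := slope0_bounds; rewrite /al oppr_gt0 ln_lt0//; lra.
Qed.

(** The displacement is [al] at 0, [be] at [L], and strictly increasing in between. *)
Lemma al_lt_be : al < be.
Proof.
by have L0 := L_gt0; rewrite -(displacement_neg (lexx 0)) -(displacement_far (lexx L)); exact: displacement_lt.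
Qed.

(** [L - be] is [g0 L], the coordinate of [y0], nonnegative since [1 / 2 <= y0]. *)
Lemma be_le_L : be <= L.
Proof.
have [/andP[h1 h2] /andP[h3 h4]] := x0y0; have [_ _ b2] := slope0_bounds.
have : 0 <= g0 L.
  rewrite -unlogc_le g0E unlogcL /f0 lexx -/a0 b2 unlogc_le0// expR0; lra.
by rewrite -(displacement_far (lexx L)) gerBl.
Qed.

Lemma displacement_le u w : u <= w -> s u <= s w.
Proof.
move=> uw; have L0 := L_gt0; have albe := al_lt_be.
have s0 := displacement_neg (lexx 0); have sL := displacement_far (lexx L).
have [w0|w0] := leP w 0; first by rewrite !displacement_neg//; exact: le_trans uw w0.
have [Lu|uL] := leP L u; first by rewrite !displacement_far//; exact: le_trans Lu uw.
have [u0|u0] := leP u 0.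
  rewrite (displacement_neg u0); have [Lw|wL] := leP L w; first by rewrite displacement_far// ltW.
  by rewrite -s0 ltW//; apply: displacement_lt => //; exact: ltW.
have [Lw|wL] := leP L w.
  by rewrite (displacement_far Lw) -sL ltW//; apply: displacement_lt => //; exact: ltW.
move: uw; rewrite le_eqVlt => /orP[/eqP->//|uw].
by rewrite ltW//; apply: displacement_lt => //; exact: ltW.
Qed.

Lemma g0_step u : al <= u - g0 u <= be.
Proof.
apply/andP; split.
  have [u0|u0] := leP u 0; first by rewrite -/(s u) displacement_neg.
  by rewrite -(displacement_neg (lexx 0)); apply: displacement_le; exact: ltW.
have [uL|uL] := leP L u; first by rewrite -/(s u) displacement_far.
by rewrite -(displacement_far (lexx L)); apply: displacement_le; exact: ltW.
Qed.

Lemma g1_step u : al <= g1 u - u <= be.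
Proof. by rewrite g1N; have := g0_step (- u); move: (g0 _) al be => ? ? ?; lra. Qed.

Lemma g0_nonexp a c : a <= c -> 0 <= g0 c - g0 a <= c - a.
Proof.
move=> ac; have := g0_mono ac; have := displacement_le ac; rewrite /s.
by move: (g0 a) (g0 c) => ? ?; lra.
Qed.

Lemma g1_nonexp a c : a <= c -> 0 <= g1 c - g1 a <= c - a.
Proof.
move=> ac; have := @g0_nonexp (- c) (- a); rewrite !g1N.
by move: (g0 (- a)) (g0 (- c)) => ? ?; lra.
Qed.

(** The displacement is monotone everywhere and strictly so on [[0, L]]; clipping [a] and [c] to
    that segment leaves two distinct points. *)
Lemma g0_strict a c : a < c -> a < L -> 0 < c -> g0 c - g0 a < c - a.
Proof.
move=> ac aL c0; suff : s a < s c by rewrite /s; move: (g0 a) (g0 c) => ? ?; lra.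
have L0 := L_gt0.
have h1 : s a <= s (Num.max a 0) by apply: displacement_le; rewrite le_max lexx.
have h2 : s (Num.min c L) <= s c by apply: displacement_le; rewrite ge_min lexx.
apply: le_lt_trans h1 (lt_le_trans _ h2); apply: displacement_lt.
- by rewrite le_max lexx orbT.
- by rewrite gt_max !lt_min ac aL c0 L0.
- by rewrite ge_min lexx orbT.
Qed.

Lemma g1_L u : u <= 0 -> g1 u < L.
Proof.
move=> u0; have := g1_nonexp u0; have := displacement_neg (lexx 0); rewrite /s.
have := g1N 0; rewrite oppr0; have := al_lt_be; have := be_le_L.
by move: (g1 u) (g1 0) (g0 0) al be L => ? ? ? ? ? ?; lra.
Qed.

Lemma g0_L u : L <= u -> 0 <= g0 u.
Proof. by move=> Lu; rewrite -[g0 u](subKr u) -/(s u) displacement_far// subr_ge0 (le_trans be_le_L). Qed.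

(** The displacement is [al] at 0 and, since [g0 m = 0], it is [m] at [m]. *)
Lemma al_lt_m : al < m.
Proof.
have [b0 b1 b2] := slope0_bounds; have [mE /andP[m1 m2]] := unlogcm.
have gm : g0 m = 0.
  rewrite -[RHS](unlogcK 0); rewrite /g0 mE /f0 m2 -/a0 (unlogc_le0 (lexx 0)) expR0.
  by congr logc; field; lra.
by have := displacement_lt (lexx 0) m_gt0 m_le_L; rewrite displacement_neg// /s gm; lra.
Qed.

(** The window is centred in [[0, m]], with [g1 lo = hi], and is at distance [2 * de] from both
    ends: a point within [de] of it stays in [[de, m - de]]. *)
Let lo := (m - al) / 2.
Let hi := lo + al.
Let de := (m - al) / 4.

Lemma g1_lo u : u <= lo -> g1 u <= hi.
Proof.
have alm := al_lt_m.
move=> ulo; apply: le_trans (_ : g1 lo <= _).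
  by have /andP[] := g1_nonexp ulo; rewrite subr_ge0.
by rewrite g1N; have := @displacement_neg (- lo); rewrite /s /hi /lo; lra.
Qed.

(** The derivative of [ln (2 - expR (- u))] at [u = de]. It decreases in [u] and equals 1 at 0,
    hence the margin [de]. *)
Let q := expR (- de) / (2 - expR (- de)).

Let ede : expR (- de) < 1.
Proof. by rewrite -[ltRHS]expR0 ltr_expR /de; have := al_lt_m; lra. Qed.

Lemma q_lt1 : q < 1.
Proof. by have e1 := ede; rewrite /q ltr_pdivrMr; lra. Qed.

(* On [0, m], [g0 u = ln (2 - expR (- u)) - al]. *)
Let g0_contr_le u w : de <= u -> u <= w -> w <= m -> g0 w - g0 u <= q * (w - u).
Proof.
move=> du uw wm; have alm := al_lt_m; have d0 : 0 < de by rewrite /de; lra.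
have [b0 b1 b2] := slope0_bounds; have [mE /andP[m1 m2]] := unlogcm.
have gE v : de <= v -> v <= m -> expR (g0 v) = a0 * (2 - expR (- v)).
  move=> dv vm; have vx : unlogc v <= 1 / (2 * a0) by rewrite -mE unlogc_le.
  have /andP[r1 r2] := unlogc_range v.
  have vx0 : unlogc v <= x0 by lra.
  rewrite /g0 /f0 vx0 -/a0 expR_logc_lo.
  - by rewrite unlogc_ge0; [field|lra].
  - by rewrite mulr_gt0//; lra.
  - have : a0 * unlogc v <= a0 * (1 / (2 * a0)) by rewrite ler_pM2l//; lra.
    have -> : a0 * (1 / (2 * a0)) = 1 / 2 by field; lra.
    by [].
have Eu0 := expR_gt0 (- u); have Ed := ede.
have Eud : expR (- u) <= expR (- de) by rewrite ler_expR; lra.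
have h1 : expR (g0 w - g0 u) = (2 - expR (- w)) / (2 - expR (- u)).
  rewrite expRD expRN (gE w (le_trans du uw) wm) (gE u du (le_trans uw wm)).
  have w1 : expR (- w) <= expR (- u) by rewrite ler_expR lerN2.
  by field; lra.
have h2 := expR_ge1Dx (g0 w - g0 u).
have h3 := expR_ge1Dx (u - w).
have h4 : expR (- w) = expR (- u) * expR (u - w) by rewrite -expRD; congr expR; ring.
have h5 : expR (- u) * (1 + (u - w)) <= expR (- w) by rewrite h4 ler_pM2l.
(* The logarithm is bypassed: [1 + x <= expR x] at [x = g0 w - g0 u], whose exponential is the ratio
   [h1]. *)
by rewrite -(lerD2l 1) (le_trans h2)// h1 ratio_le// ?subr_ge0// opprB.
Qed.

Lemma g0_contr a c : lo < a <= hi -> `|a - c| <= de ->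
  `|g0 a - g0 c| <= q * `|a - c|.
Proof.
have alm := al_lt_m; rewrite /lo /hi /lo => aI; rewrite ler_norml => ac.
have acd : `|a - c| <= de by rewrite ler_norml.
have [h|h] := leP a c.
  rewrite distrC [in leRHS]distrC !ger0_norm ?subr_ge0 ?g0_mono//.
  by apply: g0_contr_le => //; rewrite /de in ac *; lra.
rewrite !ger0_norm ?subr_ge0 ?g0_mono ?(ltW h)//.
by apply: g0_contr_le => //; rewrite /de in ac *; lra.
Qed.

End interval_maps.

(** * The weights in the logarithmic coordinate: modulus and drift *)

Section place_dependent_weights.
Context {R : realType}.
Variables (x0 y0 : R) (p0 p1 : R -> R).
Hypothesis p_sum1 : forall x, 0 <= x <= 1 -> p0 x + p1 x = 1.
Hypothesis x0y0 : 1 / 2 < x0 < 1 /\ 1 / 2 <= y0 < x0.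
Hypothesis p_dini : dini_continuous p0 p1.
Hypothesis p_gt0 : forall x, 0 <= x <= 1 -> 0 < p0 x < 1 /\ 0 < p1 x < 1.
Hypothesis Lambda_gt0 : 0 < Lambda0 x0 y0 p0 p1 /\ 0 < Lambda1 x0 y0 p0 p1.
Implicit Types x y t e : R.

Let b (t : R) : R := fine (oscillation p0 t).

Let osc_le1 t : (oscillation p0 t <= 1)%E.
Proof.
apply: ge_ereal_sup => _ [[x h] /= [x01 _ xh01] <-]; rewrite lee_fin.
have [q1 _] := p_gt0 xh01.
have [|q2 _] := @p_gt0 x; first lra.
by rewrite ler_norml; lra.
Qed.

Let oscE t : 0 <= t -> oscillation p0 t = (b t)%:E.
Proof.
move=> t0; rewrite /b fineK// fin_real//; apply/andP; split.
  apply: lt_le_trans (_ : 0%:E <= _)%E; first by rewrite ltNyr.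
  apply: ereal_sup_ubound; exists (1 / 2, 0) => /=; last by rewrite addr0 subrr normr0.
  by rewrite normr0 addr0; split => //; lra.
by apply: le_lt_trans (osc_le1 t) _; rewrite ltry.
Qed.

(** The supremum is over the empty set, hence [-oo], which [fine] sends to 0; so [b] is nonnegative
    and monotone on all of R. *)
Let b_lt0 t : t < 0 -> b t = 0.
Proof.
move=> t0; rewrite /b /oscillation (_ : [set _ | _ in _] = set0) ?ereal_sup0//.
rewrite -subset0 => _ [[x h] /= [_ ht _] _].
by have := normr_ge0 h; rewrite leNgt (le_lt_trans ht t0).
Qed.

Let b_ge0 t : 0 <= b t.
Proof.
have [t0|t0] := leP 0 t; last by rewrite b_lt0.
rewrite -lee_fin -oscE//; apply: ereal_sup_ubound; exists (1 / 2, 0) => /=; last by rewrite addr0 subrr normr0.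
by rewrite normr0 addr0; split => //; lra.
Qed.

Let b_le1 t : b t <= 1.
Proof.
have [t0|t0] := leP 0 t; last by rewrite b_lt0.
by rewrite -lee_fin -oscE.
Qed.

Let b_mono : {homo b : t u / t <= u}.
Proof.
move=> t u tu; have [t0|t0] := leP 0 t; last by rewrite (b_lt0 t0).
rewrite -lee_fin -!oscE//; last exact: le_trans tu.
apply: ereal_sup_le => _ [[x h] /= [xh ht xh1] <-]; exists (x, h) => //=.
by split=> //; exact: le_trans tu.
Qed.

Lemma p0_osc x y : 0 < x < 1 -> 0 <= y <= 1 -> `|p0 x - p0 y| <= b `|x - y|.
Proof.
move=> x01 y01; rewrite -lee_fin -oscE//; apply: ereal_sup_ubound.
have xy : x + (y - x) = y by ring.
by exists (x, y - x) => /=; rewrite xy// distrC.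
Qed.

(** With [C = t ^+ m] the sum is a segment of the convergent series of [b (t ^+ n)] starting at
    index [m], hence below a small tail. *)
Let b_dini t e : 0 < t < 1 -> 0 < e ->
  exists2 C, 0 < C & forall n, \sum_(j < n) b (C * t ^+ j) <= e.
Proof.
move=> /andP[t0 t1] e0.
have bs : cvgn (series (fun n => b (t ^+ n))).
  apply: nnseries_is_cvg => //.
  have := @p_dini 1 t ler01; rewrite (ltW t0) t1 => /(_ isT); apply: le_lt_trans.
  apply: lee_nneseries => [n _ _|n _]; first by rewrite lee_fin.
  by rewrite mul1r -oscE ?exprn_ge0 ?(ltW t0)// /modulus le_max lexx.
have nd : nondecreasing_seq (series (fun n => b (t ^+ n))).
  by apply: nondecreasing_series => n _ _.
have [m _ /(_ m (leqnn m)) mP] : \forall n \near \oo,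
    limn (series (fun n => b (t ^+ n))) - series (fun n => b (t ^+ n)) n <= e.
  have /cvgrPdist_le /(_ e e0) := bs; apply: filterS => n; apply: le_trans.
  exact: ler_norm.
exists (t ^+ m); first by rewrite exprn_gt0.
move=> n; apply: le_trans mP.
have := nondecreasing_cvgn_le nd bs (m + n); rewrite /series/=.
rewrite (big_cat_nat _ (leq_addr n m))//=.
have -> : \sum_(m <= i < m + n) b (t ^+ i) = \sum_(j < n) b (t ^+ m * t ^+ j).
  rewrite -{1}[m]add0n big_addn addKn big_mkord.
  by apply: eq_bigr => j _; rewrite addnC exprD.
by rewrite lerBrDl.
Qed.

Let b_small e : 0 < e -> exists2 C, 0 < C & b C <= e.
Proof.
move=> e0; have [|C C0 /(_ 1%N)] := @b_dini (1 / 2) e _ e0; first lra.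
by rewrite big_ord1 expr0 mulr1 => h; exists C.
Qed.

Lemma p0_uniformly_continuous e : 0 < e -> exists2 d, 0 < d &
  forall x y, 0 < x < 1 -> 0 < y < 1 -> `|x - y| <= d -> `|p0 x - p0 y| <= e.
Proof.
move=> /b_small[d d0 de]; exists d => // x y x01 y01 xy.
apply: le_trans de; apply: le_trans (p0_osc x01 _) (b_mono xy); lra.
Qed.

Lemma p0_continuous : {within `[0, 1], continuous p0}.
Proof.
apply/subspace_continuousP => x /=; rewrite in_itv/= => x01.
apply/cvgrPdist_le => e e0; have [C C0 Ce] := b_small e0.
rewrite near_withinE; near=> y => /=; rewrite in_itv/= => y01.
have xy : `|x - y| < Num.min C 1.
  by near: y; apply: cvgr_dist_lt => //; rewrite lt_min C0 ltr01.
move: xy; rewrite lt_min => /andP[xC xy1].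
have h : b `|x - y| <= e by apply: le_trans Ce; apply: b_mono; exact: ltW.
(* The oscillation demands that one of the two points be interior. If neither is, both are
   endpoints, and a distance below 1 makes them equal. *)
have [x01'|/negP nx] := boolP (0 < x < 1).
  by apply: le_trans h; exact: p0_osc.
have [y01'|/negP ny] := boolP (0 < y < 1).
  by apply: le_trans h; rewrite distrC [`|x - y|]distrC; exact: p0_osc.
suff -> : x = y by rewrite subrr normr0 ltW.
move: xy1 x01 y01; rewrite ltr_norml => /andP[c1 c2] /andP[c3 c4] /andP[c5 c6].
have [x0'|x0'] := leP x 0; have [y0'|y0'] := leP y 0.
- lra.
- by have : 1 <= y; [rewrite leNgt; apply/negP => ?; apply: ny; rewrite y0'|lra].
- by have : 1 <= x; [rewrite leNgt; apply/negP => ?; apply: nx; rewrite x0'|lra].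
have : 1 <= x by rewrite leNgt; apply/negP => ?; apply: nx; rewrite x0'.
have : 1 <= y by rewrite leNgt; apply/negP => ?; apply: ny; rewrite y0'.
lra.
Unshelve. all: by end_near.
Qed.

Let weight_lb : exists2 e, 0 < e & forall x, 0 <= x <= 1 -> e <= p0 x /\ e <= p1 x.
Proof.
have [c c01 cmin] := EVT_min ler01 p0_continuous.
have [d d01 dmax] := EVT_max ler01 p0_continuous.
rewrite !in_itv/= in c01 d01.
have [/andP[c1 _] _] := p_gt0 c01; have [/andP[_ d1] _] := p_gt0 d01.
exists (Num.min (p0 c) (1 - p0 d)); first by rewrite lt_min c1 subr_gt0.
move=> x x01; have := p_sum1 x01; have := cmin x; have := dmax x.
rewrite !in_itv/= x01 => /(_ isT) h1 /(_ isT) h2 h3.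
split; first by rewrite ge_min h2.
by rewrite ge_min; apply/orP; right; lra.
Qed.

Definition P0 (u : R) : R := p0 (unlogc u).
Definition P1 (u : R) : R := p1 (unlogc u).

Let ur (u : R) : 0 <= unlogc u <= 1.
Proof. by have := unlogc_range u; lra. Qed.

Lemma P01 u : P0 u + P1 u = 1. Proof. exact: p_sum1. Qed.

Lemma P0_b a c : `|P0 a - P0 c| <= b `|a - c|.
Proof.
apply: le_trans (p0_osc (unlogc_range a) (ur c)) (b_mono _).
exact: unlogc_dist.
Qed.

Let al := - ln (slope0 x0 y0).
Let be := ln (slope1 x0 y0).

(** Near an end the mean displacement differs from its value at the end by the variation of the
    weight times [al + be]; this error is kept below half of the exponent. *)
Let p0_end : exists N, forall u, (u <= - N ->
    `|P0 u - p0 0| * (al + be) <= Lambda0 x0 y0 p0 p1 / 2) /\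
  (N <= u -> `|P0 u - p0 1| * (al + be) <= Lambda1 x0 y0 p0 p1 / 2).
Proof.
have [L0 L1] := Lambda_gt0.
have alb : 0 < al + be by have := al_gt0 x0y0; have := al_lt_be x0y0; rewrite -/al -/be; lra.
pose e := Num.min (Lambda0 x0 y0 p0 p1) (Lambda1 x0 y0 p0 p1) / 2 / (al + be).
have e0 : 0 < e by rewrite !divr_gt0// lt_min L0.
have [C C0 Ce] := b_small e0.
have em : e * (al + be) = Num.min (Lambda0 x0 y0 p0 p1) (Lambda1 x0 y0 p0 p1) / 2.
  by rewrite /e divfK ?gt_eqF.
have eL0 : e * (al + be) <= Lambda0 x0 y0 p0 p1 / 2.
  by rewrite em ler_pM2r ?invr_gt0// ge_min lexx.
have eL1 : e * (al + be) <= Lambda1 x0 y0 p0 p1 / 2.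
  by rewrite em ler_pM2r ?invr_gt0// ge_min lexx orbT.
pose N := `|ln C|; have N0 : 0 <= N by exact: normr_ge0.
have NC u : u <= - N -> unlogc u <= C.
  move=> uN; rewrite unlogc_le0; last lra.
  have : expR u <= expR (ln C).
    by rewrite ler_expR; have := ler_norm (- ln C); rewrite normrN -/N; lra.
  by rewrite lnK ?posrE//; have := expR_gt0 u; lra.
exists N => u; split=> uN.
  apply: le_trans eL0; rewrite ler_pM2r//; apply: le_trans Ce.
  apply: le_trans (p0_osc (unlogc_range u) _) _; first by rewrite lexx ler01.
  apply: b_mono; rewrite subr0 ger0_norm; first exact: NC.
  by have := ur u; lra.
apply: le_trans eL1; rewrite ler_pM2r//; apply: le_trans Ce.
apply: le_trans (p0_osc (unlogc_range u) _) _; first by rewrite lexx ler01.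
apply: b_mono; rewrite distrC -unlogcN ger0_norm; first by apply: NC; lra.
by have := ur (- u); lra.
Qed.

Let eta := Num.min (Lambda0 x0 y0 p0 p1) (Lambda1 x0 y0 p0 p1) / 2.

Let drift : exists N, (forall u, u <= - N ->
    eta <= P0 u * (g0 x0 y0 u - u) + P1 u * (g1 x0 y0 u - u)) /\
  (forall u, N <= u ->
    P0 u * (g0 x0 y0 u - u) + P1 u * (g1 x0 y0 u - u) <= - eta).
Proof.
have [L0 L1] := Lambda_gt0.
have m0 : Num.min (Lambda0 x0 y0 p0 p1) (Lambda1 x0 y0 p0 p1) <= Lambda0 x0 y0 p0 p1 by rewrite ge_min lexx.
have m1 : Num.min (Lambda0 x0 y0 p0 p1) (Lambda1 x0 y0 p0 p1) <= Lambda1 x0 y0 p0 p1 by rewrite ge_min lexx orbT.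
have al0 := al_gt0 x0y0; have albe := al_lt_be x0y0.
rewrite -/al -/be in al0 albe.
have [N NP] := p0_end.
have LL := L_gt0 x0y0.
have p1E x : 0 <= x <= 1 -> p1 x = 1 - p0 x by move=> /p_sum1; lra.
(* Adding [L = logc x0] ensures that both maps are exact translations in the range considered. *)
exists (`|N| + logc x0); split => u uN; have nN := ler_norm N; have nN0 := normr_ge0 N.
  have [/(_ _) h _] := NP u; have {}h := h ltac:(lra).
  have s0 : g0 x0 y0 u - u = - al by have := @displacement_neg _ _ _ x0y0 u; rewrite -/al; move: (g0 x0 y0 u) => ?; lra.
  have s1 : g1 x0 y0 u - u = be.
    rewrite g1N//; have := @displacement_far _ _ _ x0y0 (- u); rewrite -/be.
    by move: (g0 x0 y0 (- u)) => ?; lra.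
  have LE : Lambda0 x0 y0 p0 p1 = (1 - p0 0) * be - p0 0 * al.
    by rewrite /Lambda0 p1E ?lexx ?ler01// /al /be; ring.
  have ab : 0 <= al + be by lra.
  have hu := ler_wpM2r ab (ler_norm (P0 u - p0 0)).
  rewrite s0 s1 /P1 p1E// -/(P0 u) /eta; lra.
have [_ /(_ _) h] := NP u; have {}h := h ltac:(lra).
have s0 : g0 x0 y0 u - u = - be by have := @displacement_far _ _ _ x0y0 u; rewrite -/be; move: (g0 x0 y0 u) => ?; lra.
have s1 : g1 x0 y0 u - u = al.
  rewrite g1N//; have := @displacement_neg _ _ _ x0y0 (- u); rewrite -/al.
  by move: (g0 x0 y0 (- u)) => ?; lra.
have LE : Lambda1 x0 y0 p0 p1 = p0 1 * be - (1 - p0 1) * al.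
  by rewrite /Lambda1 p1E ?lexx ?ler01// /al /be; ring.
have ab : 0 <= al + be by lra.
have hu := ler_wpM2r ab (ler_norm (p0 1 - P0 u)).
rewrite distrC in hu.
rewrite s0 s1 /P1 p1E// -/(P0 u) /eta; lra.
Qed.

Let eta_gt0 : 0 < eta.
Proof. by have [L0 L1] := Lambda_gt0; rewrite divr_gt0// lt_min L0. Qed.

Let U := averaging P0 P1 (g0 x0 y0) (g1 x0 y0).

Let lo_hi : (logc (1 / (2 * slope0 x0 y0)) - al) / 2 <
  (logc (1 / (2 * slope0 x0 y0)) - al) / 2 + al.
Proof. by rewrite ltrDl; exact: al_gt0. Qed.

Let de_gt0 : 0 < (logc (1 / (2 * slope0 x0 y0)) - al) / 4.
Proof. by rewrite divr_gt0// subr_gt0; exact: al_lt_m. Qed.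

Lemma log_chain_tight e : 0 < e -> exists N : R, forall n,
  orbit_mean U n (fun u : R => (N < `|u|)%R%:R) 0 <= e.
Proof.
have [ep ep0 epP] := weight_lb; have [N [dl dr]] := drift.
apply: (orbit_mean_tight (al_gt0 x0y0) ep0 (fun u => (epP _ (ur u)).1)
  (fun u => (epP _ (ur u)).2) P01 (g0_step x0y0) (g1_step x0y0) lo_hi eta_gt0
  (@g1_lo _ _ _ x0y0) dl dr (q_lt1 x0y0)).
Qed.

Lemma log_chain_cvg_cst (F : set_system nat) (FU : UltraFilter F) (f : R -> R)
    (K Lip : R) : F --> \oo -> 0 <= Lip ->
  (forall u, `|f u| <= K) -> (forall u w, `|f u - f w| <= Lip * `|u - w|) ->
  exists c, forall N e : R, 0 < e ->
    \forall n \near F, forall u, `|u| <= N -> `|orbit_mean U n f u - c| <= e.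
Proof.
have [ep ep0 epP] := weight_lb; have [N [dl dr]] := drift.
apply: (orbit_mean_cvg_cst (al_gt0 x0y0) ep0 (fun u => (epP _ (ur u)).1)
  (fun u => (epP _ (ur u)).2) P01 (g0_step x0y0) (g1_step x0y0) lo_hi eta_gt0
  (@g1_lo _ _ _ x0y0) dl dr (@g0_nonexp _ _ _ x0y0) (@g1_nonexp _ _ _ x0y0)
  (@g0_strict _ _ _ x0y0) (@g1_L _ _ _ x0y0) (@g0_L _ _ _ x0y0) (q_lt1 x0y0)
  de_gt0 (@g0_contr _ _ _ x0y0) b_mono b_ge0 b_le1 P0_b b_dini FU).
Qed.

End place_dependent_weights.

(** * Measures from positive functionals *)

Section step_functions.
Context {R : realType} {X : Type}.
Variables (B : (X -> R) -> Prop) (C : (X -> R) -> R) (D : set X).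
Hypothesis B1 : B (fun=> 1).
Hypothesis BD : forall f g, B f -> B g -> B (f \+ g).
Hypothesis BZ : forall (k : R) f, B f -> B (fun x => k * f x).
Hypothesis C1 : C (fun=> 1) = 1.
Hypothesis CD : forall f g, B f -> B g -> C (f \+ g) = C f + C g.
Hypothesis CZ : forall (k : R) f, B f -> C (fun x => k * f x) = k * C f.
Hypothesis C_le : forall f g, B f -> B g -> (forall x, D x -> f x <= g x) ->
  C f <= C g.

(** On [D] the increments of [E] form a partition of unity, and [f] is within [e] of [v k] where the
    [k]-th one lives. The abstract form lets two functionals on different spaces be compared through
    the same sum. *)
Lemma step_approximation (f : X -> R) (N : nat) (E : nat -> X -> R)
    (v : nat -> R) (e : R) : B f -> (forall k, B (E k)) ->
  (forall x, D x -> E 0%N x = 0 /\ E N x = 1) ->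
  (forall k x, (k < N)%N -> D x ->
     `|f x - v k| * (E k.+1 x - E k x) <= e * (E k.+1 x - E k x)) ->
  (forall k x, (k < N)%N -> D x -> E k x <= E k.+1 x) ->
  `|C f - \sum_(k < N) v k * (C (E k.+1) - C (E k))| <= e.
Proof.
move=> Bf BE E01 fv Emono.
pose h n x := \sum_(k < n) v k * (E k.+1 x - E k x).
have Bdiff k : B (fun x => E k.+1 x - E k x).
  rewrite (_ : (fun x => _) = E k.+1 \+ (fun x => -1 * E k x)).
    by apply: BD => //; apply: BZ.
  by apply/funext => x /=; rewrite mulN1r.
have Cdiff k : C (fun x => E k.+1 x - E k x) = C (E k.+1) - C (E k).
  rewrite (_ : (fun x => _) = E k.+1 \+ (fun x => -1 * E k x)).
    by rewrite CD ?CZ ?mulN1r//; apply: BZ.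
  by apply/funext => x /=; rewrite mulN1r.
have hE n : B (h n) /\ C (h n) = \sum_(k < n) v k * (C (E k.+1) - C (E k)).
  elim: n => [|n [Bh Ch]].
    have h0 : h 0%N = (fun x => 0 * (fun=> 1 : R) x).
      by apply/funext => x; rewrite /h big_ord0 mul0r.
    by rewrite h0 big_ord0; split; [exact: BZ|rewrite CZ// mul0r].
  have hS : h n.+1 = h n \+ (fun x => v n * (E n.+1 x - E n x)).
    by apply/funext => x; rewrite /h big_ord_recr.
  rewrite hS big_ord_recr /= -Ch; split; first by apply: BD => //; exact: BZ.
  by rewrite CD ?CZ ?Cdiff//; exact: BZ.
have [Bh <-] := hE N.
have fh x : D x -> `|f x - h N x| <= e.
  move=> Dx; have [E0 E1] := E01 x Dx.
  have tel : \sum_(k < N) (E k.+1 x - E k x) = 1.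
    by rewrite -(big_mkord predT (fun k => E k.+1 x - E k x)) telescope_sumr// E0 E1 subr0.
  have -> : f x - h N x = \sum_(k < N) (f x - v k) * (E k.+1 x - E k x).
    have fE : f x = \sum_(k < N) f x * (E k.+1 x - E k x).
      by rewrite -mulr_sumr tel mulr1.
    by rewrite {1}fE /h -sumrB; apply: eq_bigr => k _; rewrite mulrBl.
  apply: le_trans (ler_norm_sum _ _ _) _.
  rewrite -[leRHS]mulr1 -tel mulr_sumr; apply: ler_sum => k _.
  rewrite normrM [X in _ * X <= _]ger0_norm; last first.
    by rewrite subr_ge0; apply: Emono.
  exact: fv.
have Be : B (fun=> e * 1) by exact: BZ.
have Ce : C (fun=> e * 1) = e by rewrite CZ// C1 mulr1.
have h1 : C f <= C (h N \+ (fun=> e * 1)).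
  apply: C_le => //; first exact: BD.
  by move=> x Dx /=; have := fh x Dx; rewrite ler_norml; lra.
have h2 : C (h N) <= C (f \+ (fun=> e * 1)).
  apply: C_le => //; first exact: BD.
  by move=> x Dx /=; have := fh x Dx; rewrite ler_norml; lra.
by move: h1 h2; rewrite !CD// Ce ler_norml; lra.
Qed.

End step_functions.

Section unit_interval_lebesgue.
Context {R : realType}.

Definition lebesgue01 : set (measurableTypeR R) -> \bar R :=
  mrestr (@lebesgue_measure R) (measurable_itv `]0, 1[).

HB.instance Definition _ := Measure.on lebesgue01.

Let lebesgue01_setT : lebesgue01 setT = 1%E.
Proof.
rewrite /lebesgue01 /mrestr setTI lebesgue_measure_itv/= lte_fin ltr01.
by rewrite -EFinB subr0.
Qed.

HB.instance Definition _ :=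
  @Measure_isProbability.Build _ _ R lebesgue01 lebesgue01_setT.

Lemma lebesgue01_itv : lebesgue01 `]0, 1[ = 1%E.
Proof.
rewrite /lebesgue01 /mrestr setIid lebesgue_measure_itv/= lte_fin ltr01.
by rewrite -EFinB subr0.
Qed.

Lemma lebesgue01_le (t : R) : 0 <= t <= 1 ->
  lebesgue01 (`]0, 1[ `&` [set x | x <= t]) = t%:E.
Proof.
move=> /andP[t0 t1]; rewrite /lebesgue01 /mrestr.
have [te1|te1] := eqVneq t 1.
  rewrite [X in lebesgue_measure X](_ : _ = `]0, 1[%classic).
    by rewrite lebesgue_measure_itv/= lte_fin ltr01 -EFinB subr0 te1.
  apply/seteqP; split => [x [[]]//|x xI]; split => //; split => //=.
  by move: xI; rewrite /= in_itv/= te1 => /andP[_ /ltW].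
rewrite [X in lebesgue_measure X](_ : _ = `]0, t]%classic).
  rewrite lebesgue_measure_itv/= lte_fin; case: ltP => [_|t0'].
    by rewrite -EFinB subr0.
  by congr _%:E; apply/eqP; rewrite eq_le t0.
apply/seteqP; split => [x [[xI xt] _]|x] /=.
  by move: xI xt; rewrite /= !in_itv/= => /andP[-> _] ->.
rewrite !in_itv/= => /andP[x0 xt]; rewrite x0 xt/=.
have -> // : x < 1 by rewrite (le_lt_trans xt)// lt_neqAle te1.
Qed.

End unit_interval_lebesgue.

(** * The measure of a tight finitely additive functional, by its quantile function *)

Section quantile_measure.
Context {R : realType}.
Implicit Types (f g : R -> R) (x y t a e : R).

Definition has_bound f := exists M, forall x, `|f x| <= M.

Lemma bounded_cst (k : R) : has_bound (fun=> k).
Proof. by exists `|k|. Qed.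

Lemma boundedD f g : has_bound f -> has_bound g -> has_bound (f \+ g).
Proof.
move=> [M fM] [K gK]; exists (M + K) => x /=.
by apply: le_trans (ler_normD _ _) _; exact: lerD.
Qed.

Lemma boundedZ (k : R) f : has_bound f -> has_bound (fun x => k * f x).
Proof.
by move=> [M fM]; exists (`|k| * M) => x; rewrite normrM ler_wpM2l.
Qed.

Lemma bounded_bool (P : R -> bool) : has_bound (fun x => (P x)%:R).
Proof. by exists 1 => x; case: (P x); rewrite /= ?normr1 ?normr0. Qed.

Variable c : (R -> R) -> R.
Hypothesis c1 : c (fun=> 1) = 1.
Hypothesis cD : forall f g, has_bound f -> has_bound g -> c (f \+ g) = c f + c g.
Hypothesis cZ : forall (k : R) f, has_bound f -> c (fun x => k * f x) = k * c f.
Hypothesis c_le : forall f g, has_bound f -> has_bound g ->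
  (forall x, 0 < x < 1 -> f x <= g x) -> c f <= c g.
Hypothesis c_tight : forall e, 0 < e -> exists2 d, 0 < d < 1 &
  c (fun x => (x <= d)%R%:R) <= e /\ c (fun x => (1 - d <= x)%R%:R) <= e.

Let F a := c (fun x => (x <= a)%R%:R).

Let F_le a b : a <= b -> F a <= F b.
Proof.
move=> ab; apply: c_le => [||x _]; [exact: bounded_bool|exact: bounded_bool|].
by have [xa|_] := leP x a; rewrite ?ler0n// (le_trans xa ab).
Qed.

Let F0 : F 0 = 0.
Proof.
have c0 : c (fun=> 0 * 1) = 0 by rewrite cZ ?mul0r//; exact: bounded_cst.
apply/eqP; rewrite -[X in _ == X]c0 eq_le; apply/andP; split; apply: c_le;
  rewrite ?mul0r; do ?[exact: bounded_cst|exact: bounded_bool].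
- by move=> x /andP[x0 _]; rewrite (lt_geF x0).
- by move=> x _; rewrite ler0n.
Qed.

Let F1 : F 1 = 1.
Proof.
apply/eqP; rewrite -[X in _ == X]c1 eq_le; apply/andP; split; apply: c_le;
  do ?[exact: bounded_cst|exact: bounded_bool].
- by move=> x _; case: (x <= 1); rewrite ?ler01.
- by move=> x /andP[_ /ltW ->].
Qed.

(** The alternative [a = 0] keeps the set nonempty for every [t]. As [F] need not be
    right-continuous, only the one-sided bounds [quantile_le] and [quantile_ge] are available. *)
Let A t := [set a | 0 <= a <= 1 /\ (F a < t \/ a = 0)].

Let A_sup t : has_sup (A t).
Proof.
split; first by exists 0; split; [rewrite lexx ler01|right].
by exists 1 => a [/andP[]].
Qed.

Definition quantile t : R := sup (A t).

Let quantile_le t a : 0 <= a -> t <= F a -> quantile t <= a.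
Proof.
move=> a0 tF; apply: ge_sup; first by have [] := A_sup t.
move=> z [_ [Fz|->//]]; rewrite leNgt; apply/negP => /ltW /F_le.
by rewrite leNgt (lt_le_trans Fz tF).
Qed.

Let quantile_ge t a : 0 <= a <= 1 -> F a < t -> a <= quantile t.
Proof. by move=> a01 Ft; apply: ub_le_sup; [have [] := A_sup t|split=> //; left]. Qed.

Lemma quantile_mono : nondecreasing_fun quantile.
Proof.
move=> t u tu; apply: le_sup; last 2 first.
- by have [] := A_sup t.
- exact: A_sup.
move=> z [z01 h]; exists z; split=> //; split=> //.
by case: h => [h|]; [left; exact: lt_le_trans tu|right].
Qed.

(** Tightness forbids mass at the ends: [F] is below [t] near 0 and above [t] near 1. *)
Lemma quantile_range t : 0 < t < 1 -> 0 < quantile t < 1.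
Proof.
move=> /andP[t0 t1]; apply/andP; split.
  have [d /andP[d0 d1] [dt _]] := @c_tight (t / 2) ltac:(lra).
  apply: (lt_le_trans d0); apply: quantile_ge; first by rewrite (ltW d0) ltW.
  by apply: le_lt_trans dt _; lra.
have [d /andP[d0 d1] [_ dt]] := @c_tight (1 - t) ltac:(lra).
apply: (@le_lt_trans _ _ (1 - d)); last lra.
apply: quantile_le; first lra.
have : 1 <= F (1 - d) + c (fun x => (1 - d <= x)%R%:R).
  rewrite -[leLHS]c1 /F -cD; [|exact: bounded_bool..].
  apply: c_le; [exact: bounded_cst|apply: boundedD; exact: bounded_bool|].
  move=> x _ /=; have [h|h] := leP x (1 - d); first by rewrite lerDl ler0n.
  by rewrite (ltW h) add0r.
lra.
Qed.

Let quantileT : measurableTypeR R -> measurableTypeR R := quantile.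

Lemma measurable_quantile : measurable_fun [set: measurableTypeR R] quantileT.
Proof. by apply: nondecreasing_measurable => //; exact: quantile_mono. Qed.

Let Q : {mfun measurableTypeR R >-> measurableTypeR R} :=
  HB.pack quantileT (isMeasurableFun.Build _ _ (measurableTypeR R)
    (measurableTypeR R) quantileT measurable_quantile).

Definition quantile_measure : probability (measurableTypeR R) R :=
  distribution (@lebesgue01 R) Q.

Let J : set (measurableTypeR R) := `]0, 1[%classic.

Let Jsub : J `<=` quantile @^-1` J.
Proof. by move=> t; rewrite /J /= !in_itv/=; exact: quantile_range. Qed.

Let mJ : measurable J. Proof. exact: measurable_itv. Qed.

Lemma quantile_measure_itv : quantile_measure `]0, 1[%classic = 1%E.
Proof.
apply/eqP; rewrite eq_le probability_le1//=.
rewrite -[leLHS](@lebesgue01_itv R); apply: le_measure; rewrite ?inE//.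
by rewrite -[X in measurable X]setTI; exact: measurable_quantile.
Qed.

Let B (f : measurableTypeR R -> R) := (@lebesgue01 R).-integrable J (EFin \o f).
Let I (f : measurableTypeR R -> R) := \int[@lebesgue01 R]_(x in J) f x.

Let B_bounded (f : measurableTypeR R -> R) : measurable_fun J f -> has_bound f -> B f.
Proof.
move=> mf [M fM]; apply: measurable_bounded_integrable => //.
  by apply: le_lt_trans (ltry 1); exact: probability_le1.
exists M; split; first exact: num_real.
by move=> x Mx t _ /=; apply: le_trans (fM _) (ltW Mx).
Qed.

(** Both sides are within [e] of one Stieltjes sum of [f] against [F] on a regular grid. *)
Lemma quantile_measureE f : has_bound f -> measurable_fun setT f ->
  (forall e, 0 < e -> exists2 d, 0 < d & forall x y,
     0 < x < 1 -> 0 < y < 1 -> `|x - y| <= d -> `|f x - f y| <= e) ->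
  I (f \o quantile) = c f.
Proof.
move=> bf mf fu.
have mfq : measurable_fun J (f \o quantile).
  by apply: measurable_funTS; apply: measurableT_comp => //; exact: measurable_quantile.
have bfq : has_bound (f \o quantile) by have [M fM] := bf; exists M => x /=.
suff h e : 0 < e -> `|I (f \o quantile) - c f| <= 2 * e.
  apply/eqP; rewrite -subr_eq0 -normr_le0; apply/ler_addgt0Pr => e e0.
  by rewrite add0r; have := h (e / 2) ltac:(lra); lra.
move=> e0; have [d d0 fd] := fu e e0.
pose N := (Num.trunc d^-1).+1.
have N0 : 0 < N%:R :> R by rewrite ltr0n.
have Nd : N%:R^-1 <= d.
  by rewrite -[leRHS]invrK lef_pV2 ?posrE ?invr_gt0//; exact: ltW (truncnS_gt _).
pose a (k : nat) : R := k%:R / N%:R.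
(* Samples are taken at midpoints, which stay in the open interval where [f] is uniformly
   continuous. *)
pose v (k : nat) := f ((k%:R + 1 / 2) / N%:R).
have a01 k : (k <= N)%N -> 0 <= a k <= 1.
  by move=> kN; rewrite /a divr_ge0//= ler_pdivrMr// mul1r ler_nat.
have aS k : a k <= a k.+1 by rewrite /a ler_pM2r ?invr_gt0// ler_nat.
have fv k x : (k < N)%N -> 0 < x < 1 -> a k <= x <= a k.+1 -> `|f x - v k| <= e.
  move=> kN x01 /andP[ax xa]; apply: fd => //.
    have kN1 : k%:R + 1 <= N%:R :> R by rewrite natr1 ler_nat.
    have k0 : 0 <= k%:R :> R by exact: ler0n.
    by rewrite ltr_pdivrMr// ltr_pdivlMr//; lra.
  apply: le_trans Nd; move: ax xa; rewrite /a -natr1 ler_norml.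
  rewrite !mulrDl mul1r => ax xa.
  have : 0 < N%:R^-1 :> R by rewrite invr_gt0.
  lra.
have step (x y z : R) : y <= z -> (x <= y)%R%:R <= (x <= z)%R%:R :> R.
  by move=> yz; have [xy|_] := leP x y; rewrite ?ler0n// (le_trans xy yz).
have hc : `|c f - \sum_(k < N) v k * (F (a k.+1) - F (a k))| <= e.
  apply: (@step_approximation R R has_bound c [set x | 0 < x < 1] _ _ _ _ _ _ _
    f N (fun k x => (x <= a k)%R%:R)) => //.
  - exact: bounded_cst.
  - exact: boundedD.
  - exact: boundedZ.
  - by move=> k; exact: bounded_bool.
  - move=> x /= /andP[x0 x1]; rewrite /a mul0r divff ?gt_eqF// (lt_geF x0)/=.
    by rewrite ltW.
  - move=> k x kN /= x01.
    have [xa|ax] := leP x (a k); first by rewrite (le_trans xa (aS k)) subrr !mulr0.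
    have [xa|ax'] := leP x (a k.+1); last by rewrite subrr !mulr0.
    by rewrite subr0 !mulr1; apply: fv => //; rewrite ltW.
  - by move=> k x kN _; exact: step.
(* In the variable [t] the steps are the half-lines below [F (a k)], of Lebesgue measure [F (a k)]
   in ]0, 1[; values of [t] between [F (a k)] and [F (a k.+1)] have their quantile between [a k] and
   [a k.+1]. *)
have hI : `|I (f \o quantile) - \sum_(k < N) v k * (F (a k.+1) - F (a k))| <= e.
  have IF k : (k <= N)%N -> I (fun t => (t <= F (a k))%R%:R) = F (a k).
    move=> kN; have Fk : 0 <= F (a k) <= 1.
      have /andP[ak0 ak1] := a01 k kN.
      by rewrite -{1}F0 -F1 !F_le.
    rewrite /I /Rintegral (_ : (fun x => _) = EFin \o \1_[set x | x <= F (a k)]); last first.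
      by apply/funext => x /=; rewrite indicE mem_setE.
    rewrite integral_indic//; last first.
      by rewrite -[X in measurable X]setTI; exact: measurable_fun_le.
    by rewrite setIC; exact: (congr1 fine (lebesgue01_le Fk)).
  rewrite (eq_bigr (fun k : 'I_N => v k * (I (fun t => (t <= F (a k.+1))%R%:R) -
     I (fun t => (t <= F (a k))%R%:R)))); last first.
    by move=> k _; rewrite !IF// ltnW.
  apply: (@step_approximation R _ B I J _ _ _ _ _ _ _
    (f \o quantile) N (fun k x => (x <= F (a k))%R%:R)) => //.
  - by apply: B_bounded => //; exact: bounded_cst.
  - move=> g h Bg Bh; rewrite /B (_ : _ \o _ = (EFin \o g) \+ (EFin \o h))%E//.
    exact: integrableD.
  - by move=> k g Bg; rewrite /B (_ : _ \o _ = (fun x => k%:E * (EFin \o g) x))%E//; exact: integrableZl.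
  - rewrite /I /Rintegral integral_cst//= mul1e.
    exact: (congr1 fine (@lebesgue01_itv R)).
  - by move=> g h Bg Bh; rewrite /I RintegralD.
  - by move=> k g Bg; rewrite /I RintegralZl.
  - by move=> g h Bg Bh gh; rewrite /I; apply: le_Rintegral.
  - exact: B_bounded.
  - move=> k; apply: B_bounded; last exact: bounded_bool.
    rewrite (_ : (fun x => _) = \1_[set x | x <= F (a k)]); last first.
      by apply/funext => x /=; rewrite indicE mem_setE.
    apply: measurable_funTS; apply: measurable_indic.
    by rewrite -[X in measurable X]setTI; exact: measurable_fun_le.
  - move=> t; rewrite /J /= in_itv/= => /andP[t0 t1].
    rewrite /a mul0r divff ?gt_eqF// F0 F1 (lt_geF t0)/=.
    by rewrite ltW.
  - move=> k t kN Jt /=; have t01 := Jt; rewrite /J /= in_itv/= in t01.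
    have [ta|Ft] := leP t (F (a k)); first by rewrite (le_trans ta (F_le (aS k))) subrr !mulr0.
    have [ta|Ft'] := leP t (F (a k.+1)); last by rewrite subrr !mulr0.
    rewrite subr0 !mulr1; apply: fv => //; first exact: quantile_range.
    rewrite quantile_ge//=; last exact: a01 (ltnW kN).
    by apply: quantile_le => //; have /andP[] := a01 _ kN.
  - by move=> k t kN _; apply: step; exact: F_le.
rewrite distrC in hc.
have := ler_distD (\sum_(k < N) v k * (F (a k.+1) - F (a k))) (I (f \o quantile)) (c f).
lra.
Qed.

Lemma quantile_measure_integral f : (forall x, 0 <= f x) -> has_bound f ->
  measurable_fun setT f ->
  (forall e, 0 < e -> exists2 d, 0 < d & forall x y,
     0 < x < 1 -> 0 < y < 1 -> `|x - y| <= d -> `|f x - f y| <= e) ->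
  (\int[quantile_measure]_(x in J) (f x)%:E = (c f)%:E)%E.
Proof.
move=> f0 bf mf fu.
have mfq : measurable_fun setT (f \o quantile).
  by apply: measurableT_comp => //; exact: measurable_quantile.
have bfq : has_bound (f \o quantile) by have [M fM] := bf; exists M => x /=.
have mQJ : measurable (quantile @^-1` J).
  by rewrite -[X in measurable X]setTI; exact: measurable_quantile.
rewrite /quantile_measure /distribution ge0_integral_pushforward//=; last 2 first.
- by apply/measurable_EFinP; exact: measurable_funTS.
- by move=> x _; rewrite lee_fin.
rewrite -(quantile_measureE bf mf fu) /I /Rintegral fineK; last first.
  by apply: integrable_fin_num => //; apply: B_bounded => //; exact: measurable_funTS.
(* The preimage of [J] consists of [J] and a remainder that [lebesgue01] does not charge. *)
rewrite -(setDUK Jsub) ge0_integral_setU//=; first last.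
- by rewrite disj_set2E; apply/eqP; rewrite setDE setICA setICr setI0.
- by move=> x _; rewrite lee_fin.
- by apply/measurable_EFinP; exact: measurable_funTS.
- exact: measurableD.
rewrite [X in (_ + X)%E]null_set_integral ?adde0//=.
- exact: measurableD.
- by apply/measurable_EFinP; exact: measurable_funTS.
by rewrite /lebesgue01 /mrestr setDE -setIA setICl setI0 measure0.
exact: measurable_quantile.
Qed.

End quantile_measure.

(** * The transition kernel *)

Section lipschitz_test_functions.
Context {R : realType}.
Local Notation T := (measurableTypeR R).

(** Increases with [n] to the indicator of ]a, +oo[. The orbit limit is represented by a measure
    only on uniformly continuous functions, so invariance is tested on these instead of
    indicators. *)
Definition ramp (n : nat) (a x : R) : R := Num.min 1 (Num.max 0 (n%:R * (x - a))).

Lemma ramp_range n a x : 0 <= ramp n a x <= 1.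
Proof. by rewrite /ramp le_min ler01 le_max lexx/= ge_min lexx. Qed.

Lemma ramp_lip n a x y : `|ramp n a x - ramp n a y| <= n%:R * `|x - y|.
Proof.
wlog xy : x y / x <= y => [h|].
  by have [|/ltW] := leP x y => /h //; rewrite distrC [`|x - y|]distrC.
have n0 : 0 <= n%:R :> R by exact: ler0n.
rewrite distrC [`|x - y|]distrC [`|y - x|]ger0_norm ?subr_ge0//.
have h : n%:R * (x - a) <= n%:R * (y - a) by rewrite ler_wpM2l// lerB.
have -> : n%:R * (y - x) = n%:R * (y - a) - n%:R * (x - a) by ring.
rewrite /ramp; set A := n%:R * (x - a) in h *; set B := n%:R * (y - a) in h *.
have clip (z : R) : Num.min 1 (Num.max 0 z) =
    if z <= 0 then 0 else if 1 <= z then 1 else z.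
  case: (leP z 0) => [z0|z0]; first by rewrite min_r.
  by case: leP.
rewrite !clip; case: (leP A 0) => a0; case: (leP B 0) => b0;
  case: (leP 1 A) => a1; case: (leP 1 B) => b1; rewrite ler_norml; lra.
Qed.

Lemma measurable_ramp n a : measurable_fun [set: T] (ramp n a : T -> R).
Proof.
apply: measurable_minr => //; apply: measurable_maxr => //.
by apply: measurable_funM => //; apply: measurable_funB.
Qed.

Lemma ramp_mono n m a x : (n <= m)%N -> ramp n a x <= ramp m a x.
Proof.
move=> nm; rewrite /ramp; have [xa|xa] := leP (x - a) 0.
  rewrite !(max_idPl _) //; by rewrite mulr_ge0_le0.
have h : n%:R * (x - a) <= m%:R * (x - a) by rewrite ler_wpM2r ?ler_nat// ltW.
rewrite le_min ge_min lexx/= ge_min; apply/orP; right.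
by rewrite ge_max !le_max lexx h orbT.
Qed.

Lemma ramp_cvg a x : (ramp n a x)%:E @[n --> \oo] --> (\1_(`]a, +oo[%classic : set R) x)%:E.
Proof.
apply: cvg_EFin; first exact: nearW.
rewrite indicE mem_setE in_itv/= andbT; have [ax|xa] := ltP a x; last first.
  rewrite (_ : _ \o _ = fun=> 0); first exact: cvg_cst.
  apply/funext => n /=; rewrite /ramp (max_idPl _) ?(min_idPr _)//.
  by rewrite mulr_ge0_le0// subr_le0.
apply: cvg_near_cst; exists (Num.trunc (x - a)^-1).+1 => // n /= hn.
have xa0 : 0 < x - a by rewrite subr_gt0.
have : (x - a)^-1 <= n%:R.
  apply: ltW; apply: lt_le_trans (truncnS_gt _) _; by rewrite ler_nat.
rewrite -(ler_pM2r xa0) mulVf ?gt_eqF// => h.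
by rewrite /ramp (max_idPr _) ?(min_idPl _)//; lra.
Qed.

(** Monotone convergence gives equality on open half-lines, a generating family stable under
    intersection. *)
Lemma ramp_determines (m1 m2 : {measure set T -> \bar R}) :
  (m1 setT < +oo)%E ->
  (forall n a, \int[m1]_x (ramp n a x)%:E = \int[m2]_x (ramp n a x)%:E)%E ->
  forall A, measurable A -> m1 A = m2 A.
Proof.
move=> m1oo h.
have mray (m : {measure set T -> \bar R}) a :
    (\int[m]_x (ramp n a x)%:E)%E @[n --> \oo] --> m `]a, +oo[%classic.
  have := @cvg_monotone_convergence _ T R m setT measurableT
    (fun n x => (ramp n a x)%:E) _ _ _.
  move=> /(_ _ _ _); rewrite (eq_integral (fun x => (\1_(`]a, +oo[%classic : set T) x)%:E)); last first.
    by move=> x _; apply/cvg_lim => //; exact: ramp_cvg.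
  rewrite integral_indic// setIT; apply.
  - by move=> n; apply/measurable_EFinP; exact: measurable_ramp.
  - by move=> n x _; rewrite lee_fin; have /andP[] := ramp_range n a x.
  - by move=> x _ n m' nm; rewrite lee_fin; exact: ramp_mono.
apply: (@measure_unique _ R T (@RGenOInfty.G R) (fun k => `](- k%:R)%R, +oo[%classic)).
- exact: RGenOInfty.measurableE.
- move=> _ _ [x ->] [y ->]; exists (Num.max x y).
  apply/seteqP; split => z /=; rewrite !in_itv/= !andbT gt_max.
    by move=> [-> ->].
  by move=> /andP[].
- by move=> k; exists (- k%:R).
- apply/seteqP; split => // x _; exists (Num.trunc `|x|).+1 => //=.
  rewrite in_itv/= andbT; have := truncnS_gt `|x|; have := ler_norm (- x).
  by rewrite normrN; lra.
- move=> _ [a ->]; apply: (cvg_unique _ (mray m1 a)) => //.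
  have e12 : (fun n => \int[m1]_x (ramp n a x)%:E)%E =
    (fun n => \int[m2]_x (ramp n a x)%:E)%E by apply/funext => n; exact: h.
  by rewrite /= e12; exact: mray.
- by move=> k; apply: le_lt_trans m1oo; apply: le_measure; rewrite ?inE.
Qed.

End lipschitz_test_functions.

Lemma indic_ge0 (R : realType) (X : Type) (A : set X) (x : X) :
  (0 <= (\1_A x : R)%:E)%E.
Proof. by rewrite lee_fin indicE ler0n. Qed.

(** * The Markov kernel and its invariant laws *)

Section transition_kernel.
Context {R : realType}.
Local Notation T := (measurableTypeR R).
Variables (x0 y0 : R) (p0 p1 : R -> R).
Local Notation f0 := (f0 x0 y0).
Local Notation f1 := (f1 x0 y0).

Let J : set T := `]0, 1[%classic.

Let inJ (x : T) : (x \in J) = (0 < x < 1).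
Proof. by rewrite /J mem_setE in_itv. Qed.

(* The weights are extended outside ]0, 1[ so that the kernel is Markov on R. *)
Definition weight (x : T) : R := Num.max 0 (Num.min 1 ((p0 \_ J) x)).

Lemma weight_ge0 x : 0 <= weight x.
Proof. by rewrite /weight le_max lexx. Qed.

Lemma weightC_ge0 x : 0 <= 1 - weight x.
Proof. by rewrite subr_ge0 /weight ge_max ler01 ge_min lexx. Qed.

Definition step_kernel (x : T) : set T -> \bar R :=
  measure_add (mscale (NngNum (weight_ge0 x)) (\d_(f0 x : T)))
              (mscale (NngNum (weightC_ge0 x)) (\d_(f1 x : T))).

HB.instance Definition _ x := Measure.on (step_kernel x).

Lemma step_kernelE x A :
  step_kernel x A = ((weight x)%:E * \d_(f0 x : T) A +
                     (1 - weight x)%:E * \d_(f1 x : T) A)%E.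
Proof. by rewrite /step_kernel measure_addE. Qed.

Let step_kernel_setT x : step_kernel x setT = 1%E.
Proof.
by rewrite step_kernelE !diracT !mule1 -EFinD; congr _%:E; ring.
Qed.

HB.instance Definition _ x :=
  @Measure_isProbability.Build _ _ R (step_kernel x) (step_kernel_setT x).

Lemma integral_step_kernel x (h : T -> \bar R) : measurable_fun setT h ->
  (forall y, 0 <= h y)%E ->
  (\int[step_kernel x]_y h y =
   (weight x)%:E * h (f0 x) + (1 - weight x)%:E * h (f1 x))%E.
Proof.
move=> mh h0; rewrite ge0_integral_measure_add//.
rewrite !ge0_integral_mscale// !integral_dirac// !diracT !mul1e.
by [].
Qed.

Hypothesis mp0 : measurable_fun J (p0 : T -> R).

Let mJ : measurable J. Proof. exact: measurable_itv. Qed.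

Lemma measurable_weight : measurable_fun setT (weight : T -> R).
Proof.
apply: measurable_maxr => //; apply: measurable_minr => //.
by apply/measurable_restrict => //; rewrite setTI.
Qed.

Lemma measurable_f0 : measurable_fun setT (f0 : T -> T).
Proof.
apply: measurable_fun_ifT.
- exact: measurable_fun_ler.
- exact: measurable_funM.
- by apply: measurable_funD => //; apply: measurable_funM => //; exact: measurable_funB.
Qed.

Lemma measurable_f1 : measurable_fun setT (f1 : T -> T).
Proof.
apply: measurable_funB => //; apply: (@measurableT_comp _ _ _ _ _ _ (f0 : T -> T)).
  exact: measurable_f0.
exact: measurable_funB.
Qed.

Lemma measurable_step_kernel :
  measurable_fun setT (step_kernel : T -> giry T R).
Proof.
apply: measurable_giry_codensity => // A mA.
rewrite (_ : (fun x => _) = (fun x => (weight x * \1_A (f0 x : T) +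
   (1 - weight x) * \1_A (f1 x : T))%:E)); last first.
  apply/funext => x; rewrite EFinD !EFinM; etransitivity; first exact: step_kernelE.
  by rewrite !diracE !indicE.
have mw := measurable_weight.
apply/measurable_EFinP; apply: measurable_funD; apply: measurable_funM => //.
- by apply: (measurableT_comp _ measurable_f0); exact: measurable_indic.
- exact: measurable_funB.
- by apply: (measurableT_comp _ measurable_f1); exact: measurable_indic.
Qed.

Definition push (nu : probability T R) : giry T R :=
  giry_bind (nu : giry T R) measurable_step_kernel.

Lemma integral_push (nu : probability T R) (h : T -> \bar R) :
  measurable_fun setT h -> (forall y, 0 <= h y)%E ->
  (\int[push nu]_y h y =
   \int[nu]_x ((weight x)%:E * h (f0 x) + (1 - weight x)%:E * h (f1 x)))%E.
Proof.
move=> mh h0; have := giry_int_bind (nu : giry T R) measurable_step_kernel mh h0.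
rewrite /giry_int => ->; apply: eq_integral => x _.
exact: integral_step_kernel.
Qed.

Hypothesis p_sum1 : forall x, 0 <= x <= 1 -> p0 x + p1 x = 1.
Hypothesis p_gt0 : forall x, 0 <= x <= 1 -> 0 < p0 x < 1 /\ 0 < p1 x < 1.
Hypothesis x0y0 : 1 / 2 < x0 < 1 /\ 1 / 2 <= y0 < x0.

Lemma weightE x : 0 < x < 1 -> weight x = p0 x /\ 1 - weight x = p1 x.
Proof.
move=> x01; have x01' : 0 <= x <= 1 by lra.
have [/andP[a b] _] := p_gt0 x01'; have e := p_sum1 x01'.
suff -> : weight x = p0 x by split => //; lra.
rewrite /weight patchE ifT; last by rewrite mem_setE.
by rewrite min_r ?max_r// ltW.
Qed.

Section invariant_measure.
Variable nu : probability T R.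
Hypothesis nuJ : on_unit_interval nu.

Lemma integral_unit_interval (h : T -> \bar R) : measurable_fun setT h ->
  (forall y, 0 <= h y)%E -> (\int[nu]_x h x = \int[nu]_(x in J) h x)%E.
Proof.
move=> mh h0; rewrite -(setUv J) ge0_integral_setU//=; first last.
- by rewrite disj_set2E setICr.
- by rewrite setUv.
- exact: measurableC.
rewrite [X in (_ + X)%E]null_set_integral ?adde0//.
- exact: measurableC.
- exact: measurable_funTS.
- by have := @probability_setC _ _ _ nu _ mJ; rewrite nuJ subee.
Qed.

Lemma integral_push_unit_interval (h : T -> \bar R) : measurable_fun setT h ->
  (forall y, 0 <= h y)%E ->
  (\int[push nu]_y h y =
   \int[nu]_(x in J) ((p0 x)%:E * h (f0 x) + (p1 x)%:E * h (f1 x)))%E.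
Proof.
move=> mh h0; rewrite integral_push// integral_unit_interval; last 2 first.
- have mw := measurable_weight; apply: emeasurable_funD; apply: emeasurable_funM.
  + exact/measurable_EFinP.
  + by apply: (measurableT_comp mh); exact: measurable_f0.
  + by apply/measurable_EFinP; exact: measurable_funB.
  + by apply: (measurableT_comp mh); exact: measurable_f1.
- by move=> x; rewrite adde_ge0 ?mule_ge0// lee_fin ?weight_ge0 ?weightC_ge0.
apply: eq_integral => x; rewrite inJ => /weightE[-> ->].
by [].
Qed.

Definition one_step_stationary := forall A, measurable A -> A `<=` J ->
  (\int[nu]_(x in J) transition x0 y0 p0 p1 x A)%E = nu A.

Lemma transitionE x A : transition x0 y0 p0 p1 x A =
  ((p0 x)%:E * (\1_A (f0 x))%:E + (p1 x)%:E * (\1_A (f1 x))%:E)%E.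
Proof. by rewrite /transition !diracE !indicE. Qed.

Lemma push_invariant : one_step_stationary <-> forall A, measurable A -> push nu A = nu A.
Proof.
have pushE A : measurable A ->
    push nu A = (\int[nu]_(x in J) transition x0 y0 p0 p1 x A)%E.
  move=> mA; have mI : measurable_fun setT (EFin \o (\1_A : T -> R)).
    by apply/measurable_EFinP; exact: measurable_indic.
  have := integral_push_unit_interval mI (@indic_ge0 R T A).
  by rewrite /= integral_indic// setIT.
have nuE A : measurable A -> nu A = nu (A `&` J).
  move=> mA; have mI : measurable_fun setT (EFin \o (\1_A : T -> R)).
    by apply/measurable_EFinP; exact: measurable_indic.
  have := integral_unit_interval mI (@indic_ge0 R T A).
  by rewrite /= !integral_indic// setIT.
split=> [inv A mA|h A mA AJ]; last by rewrite -pushE// h.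
(* Stationarity speaks of subsets of [J] only, so [A] is cut down to [J]; both maps preserve [J],
   hence the transition probabilities do not change. *)
rewrite pushE// nuE// -inv; [|exact: measurableI|by move=> x []].
apply: eq_integral => x; rewrite inJ => x01.
rewrite !transitionE !indicE !in_setI.
have -> : f0 x \in J by rewrite inJ; exact: f0_range.
have -> : f1 x \in J by rewrite inJ; exact: f1_range.
by rewrite !andbT.
Qed.

Lemma invariant_integral : one_step_stationary -> forall h : T -> \bar R,
  measurable_fun setT h -> (forall y, 0 <= h y)%E ->
  (\int[nu]_(x in J) ((p0 x)%:E * h (f0 x) + (p1 x)%:E * h (f1 x)) =
   \int[nu]_(x in J) h x)%E.
Proof.
move=> /push_invariant inv h mh h0.
rewrite -integral_push_unit_interval// -integral_unit_interval//.
by apply: eq_measure_integral => A mA _; exact: inv.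
Qed.

Lemma invariant_of_ramps :
  (forall n a,
    \int[nu]_(x in J) ((p0 x)%:E * (ramp n a (f0 x))%:E +
                       (p1 x)%:E * (ramp n a (f1 x))%:E) =
    \int[nu]_(x in J) (ramp n a x)%:E)%E -> one_step_stationary.
Proof.
move=> h; apply/push_invariant; apply: ramp_determines => [|n a].
  by apply: le_lt_trans (ltry 1); exact: sprobability_setT.
have mr : measurable_fun setT (EFin \o (ramp n a : T -> R)).
  by apply/measurable_EFinP; exact: measurable_ramp.
have r0 y : (0 <= (ramp n a y)%:E)%E.
  by rewrite lee_fin; have /andP[] := ramp_range n a y.
by rewrite integral_push_unit_interval// integral_unit_interval// h.
Qed.

End invariant_measure.
End transition_kernel.

(** * Stationary laws *)

Section stationary_measures.
Context {R : realType}.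
Local Notation T := (measurableTypeR R).
Variables (x0 y0 : R) (p0 p1 : R -> R).
Hypothesis p_sum1 : forall x, 0 <= x <= 1 -> p0 x + p1 x = 1.
Hypothesis x0y0 : 1 / 2 < x0 < 1 /\ 1 / 2 <= y0 < x0.
Hypothesis p_dini : dini_continuous p0 p1.
Hypothesis p_gt0 : forall x, 0 <= x <= 1 -> 0 < p0 x < 1 /\ 0 < p1 x < 1.
Hypothesis Lambda_gt0 : 0 < Lambda0 x0 y0 p0 p1 /\ 0 < Lambda1 x0 y0 p0 p1.

Local Notation f0 := (f0 x0 y0).
Local Notation f1 := (f1 x0 y0).

Let J : set T := `]0, 1[%classic.

Let mJ : measurable J. Proof. exact: measurable_itv. Qed.

Let inJ (x : T) : (x \in J) = (0 < x < 1).
Proof. by rewrite /J mem_setE in_itv. Qed.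

Let JP (x : T) : J x <-> 0 < x < 1.
Proof. by rewrite -inJ inE. Qed.

Lemma measurable_p0 : measurable_fun J (p0 : T -> R).
Proof.
apply: (@measurable_funS _ _ _ _ (`[0, 1]%classic : set T)) => //.
  by move=> x; rewrite /J /= !in_itv/= => /andP[/ltW -> /ltW ->].
apply: subspace_continuous_measurable_fun => //.
exact: (p0_continuous p_dini p_gt0).
Qed.

Lemma measurable_p1 : measurable_fun J (p1 : T -> R).
Proof.
apply: (eq_measurable_fun (fun x : T => 1 - p0 x)).
  move=> x; rewrite inJ => x01; have := @p_sum1 x; lra.
by apply: measurable_funB => //; exact: measurable_p0.
Qed.

Let f0J x : J x -> J (f0 x).
Proof. by rewrite !JP; exact: f0_range. Qed.

Let f1J x : J x -> J (f1 x).
Proof. by rewrite !JP; exact: f1_range. Qed.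

Let p_ge0 x : J x -> 0 <= p0 x /\ 0 <= p1 x.
Proof. by move=> /JP x01; have := @p_gt0 x; lra. Qed.

Let averagee (h : T -> \bar R) x : \bar R :=
  ((p0 x)%:E * h (f0 x) + (p1 x)%:E * h (f1 x))%E.

Let measurable_averagee (h : T -> \bar R) : measurable_fun setT h ->
  measurable_fun J (averagee h).
Proof.
move=> mh; apply: emeasurable_funD; apply: emeasurable_funM.
- by apply/measurable_EFinP; exact: measurable_p0.
- by apply: measurable_funTS; apply: (measurableT_comp mh); exact: measurable_f0.
- by apply/measurable_EFinP; exact: measurable_p1.
- by apply: measurable_funTS; apply: (measurableT_comp mh); exact: measurable_f1.
Qed.

Let averagee_ge0 (h : T -> \bar R) x : J x -> (forall y, 0 <= h y)%E ->
  (0 <= averagee h x)%E.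
Proof.
by move=> /p_ge0[a b] h0; rewrite adde_ge0// mule_ge0// lee_fin.
Qed.

Fixpoint interior_boxes (s : seq (set T)) : Prop :=
  if s is A :: s' then (measurable A /\ A `<=` J) /\ interior_boxes s' else True.

(** [transition] is a bare set function. On [J] it coincides with the measure [step_kernel], for
    which the integral is a two-term sum. *)
Lemma path_prob_cons x A s : J x -> measurable A -> A `<=` J ->
  measurable_fun J (path_prob x0 y0 p0 p1 s) ->
  (forall y, J y -> 0 <= path_prob x0 y0 p0 p1 s y)%E ->
  path_prob x0 y0 p0 p1 (A :: s) x =
  averagee (path_prob x0 y0 p0 p1 s \_ A) x.
Proof.
move=> Jx mA AJ ms s0 /=.
have [w0 w1] := weightE p_sum1 p_gt0 (proj1 (JP x) Jx).
have -> : transition x0 y0 p0 p1 x = step_kernel x0 y0 p0 x.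
  by apply/funext => B; rewrite step_kernelE w1 w0.
rewrite integral_mkcond integral_step_kernel//; first by rewrite /averagee w1 w0.
- by apply/measurable_restrict => //; rewrite setTI; exact: measurable_funS ms.
- move=> y; rewrite patchE; case: ifP => //; rewrite inE => Ay.
  by apply: s0; exact: AJ.
Qed.

Lemma path_prob_measurable s : interior_boxes s ->
  measurable_fun J (path_prob x0 y0 p0 p1 s) /\
  (forall y, J y -> 0 <= path_prob x0 y0 p0 p1 s y)%E.
Proof.
elim: s => [_|A s IH [[mA AJ] /IH[ms s0]]].
  by split; [exact: measurable_cst|move=> y _; exact: lee01].
have mh : measurable_fun setT (path_prob x0 y0 p0 p1 s \_ A).
  by apply/measurable_restrict => //; rewrite setTI; exact: measurable_funS ms.
have h0 y : (0 <= (path_prob x0 y0 p0 p1 s \_ A) y)%E.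
  by rewrite patchE; case: ifP => //; rewrite inE => Ay; apply: s0; exact: AJ.
split.
  apply: (eq_measurable_fun (averagee (path_prob x0 y0 p0 p1 s \_ A))).
    by move=> x; rewrite inE => Jx; rewrite path_prob_cons.
  exact: measurable_averagee.
by move=> y Jy; rewrite path_prob_cons//; exact: averagee_ge0.
Qed.

Lemma stationaryP (nu : probability T R) : on_unit_interval nu ->
  stationary x0 y0 p0 p1 nu <-> one_step_stationary x0 y0 p0 p1 nu.
Proof.
move=> nuJ; split=> [st A mA AJ|inv k n A mA].
  (* The laws of [X_1] and [X_0] on [A] are the case [k = 1], [n = 0]. *)
  have := st 1%N 0%N (fun=> A) (fun=> conj mA AJ).
  rewrite /= integral_cst// mul1e => <-; apply: eq_integral => x; rewrite inE => Jx.
  rewrite -[RHS]/(path_prob x0 y0 p0 p1 [:: A] x) path_prob_cons//; last exact: measurable_cst.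
  by rewrite transitionE /averagee !patchE !indicE; do 2 case: ifP.
(* Prepending [J] means averaging over one earlier step; invariance, applied to the path probability
   cut off outside [B], removes it. *)
have step B s : interior_boxes (B :: s) ->
    chain_law x0 y0 p0 p1 nu (J :: B :: s) = chain_law x0 y0 p0 p1 nu (B :: s).
  move=> [[mB BJ] /path_prob_measurable[ms s0]].
  have -> : chain_law x0 y0 p0 p1 nu (J :: B :: s) =
      (\int[nu]_(x in J) averagee (path_prob x0 y0 p0 p1 s \_ B) x)%E.
    by apply: eq_integral => x; rewrite inE => Jx; rewrite path_prob_cons.
  rewrite (invariant_integral measurable_p0 p_sum1 p_gt0 x0y0 nuJ inv); last 2 first.
  - by apply/measurable_restrict => //; rewrite setTI; exact: measurable_funS ms.
  - by move=> y; rewrite patchE; case: ifP => //; rewrite inE => By; apply: s0; exact: BJ.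
  by rewrite -integral_mkcondr /= setIidr.
have wfA m (C : (set T)^nat) : (forall i, measurable (C i) /\ C i `<=` J) ->
    interior_boxes (mkseq C m).
  elim: m C => [//|m IH] C mC; rewrite /mkseq /=; split; first exact: mC.
  by rewrite -[iota 1 m]/(iota (1 + 0) m) iotaDl -map_comp; apply: (IH (C \o S)) => i; exact: mC.
have wfk m : interior_boxes (nseq m J ++ mkseq A n.+1).
  elim: m => [|m IH]; first exact: wfA.
  by split; [split; [exact: mJ|exact: subset_refl]|exact: IH].
elim: k => [//|k IH].
have : nseq k J ++ mkseq A n.+1 <> [::] by case: k {IH}.
rewrite -[nseq k.+1 _ ++ _]/(J :: (nseq k J ++ mkseq A n.+1)) -IH.
have := wfk k; case: (nseq k J ++ _) => [|B s] wf //.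
by rewrite step.
Qed.

Let Ux := averaging p0 p1 f0 f1.
Let Uu := averaging (P0 p0) (P1 p1) (g0 x0 y0) (g1 x0 y0).

Lemma iter_averaging_unlogc k (phi : R -> R) u :
  iter k Ux phi (unlogc u) = iter k Uu (phi \o unlogc) u.
Proof.
elim: k u => [//|k IH] u.
by rewrite !iterS {1}/Ux {1}/Uu /averaging -!IH g0E// g1E.
Qed.

Lemma orbit_mean_unlogc n (phi : R -> R) u :
  orbit_mean Ux n phi (unlogc u) = orbit_mean Uu n (phi \o unlogc) u.
Proof.
by congr (_ * _); apply: eq_bigr => k _; exact: iter_averaging_unlogc.
Qed.

Section orbit_mean_integral.
Variables (nu : probability T R) (phi : R -> R).
Hypothesis nuJ : on_unit_interval nu.
Hypothesis nu_inv : one_step_stationary x0 y0 p0 p1 nu.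
Hypothesis mphi : measurable_fun setT (phi : T -> R).
Hypothesis phi0 : forall x, 0 <= phi x.

Let iter_spec k : [/\ measurable_fun J (iter k Ux phi : T -> R),
  (forall x, J x -> 0 <= iter k Ux phi x) &
  (\int[nu]_(x in J) (iter k Ux phi x)%:E = \int[nu]_(x in J) (phi x)%:E)%E].
Proof.
elim: k => [|k [mk k0 ek]].
  by split=> //; exact: measurable_funTS.
pose h : T -> \bar R := (EFin \o (iter k Ux phi)) \_ J.
have mh : measurable_fun setT h.
  by apply/measurable_restrict => //; rewrite setTI; exact/measurable_EFinP.
have h0 y : (0 <= h y)%E.
  by rewrite /h patchE; case: ifP => //; rewrite inE => /k0; rewrite -lee_fin.
have hE x : J x -> (iter k.+1 Ux phi x)%:E = averagee h x.
  move=> Jx; rewrite iterS /averagee /h !patchE.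
  by rewrite !ifT ?inE; [|exact: f1J|exact: f0J].
split.
- apply/measurable_EFinP; apply: (eq_measurable_fun (averagee h)).
    by move=> x; rewrite inE => /hE.
  exact: measurable_averagee.
- by move=> x Jx; rewrite -lee_fin hE//; exact: averagee_ge0.
- transitivity (\int[nu]_(x in J) averagee h x)%E.
    by apply: eq_integral => x; rewrite inE => /hE.
  rewrite -ek (invariant_integral measurable_p0 p_sum1 p_gt0 x0y0 nuJ nu_inv)//.
  by apply: eq_integral => x Jx; rewrite /h patchE Jx.
Qed.

Lemma measurable_orbit_mean n : measurable_fun J (orbit_mean Ux n phi : T -> R).
Proof.
apply: measurable_funM => //; apply: measurable_sum => k.
by have [] := iter_spec k.
Qed.

Lemma orbit_mean_ge0 n x : J x -> 0 <= orbit_mean Ux n phi x.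
Proof.
move=> Jx; rewrite mulr_ge0 ?invr_ge0//; apply: sumr_ge0 => k _.
by have [_ h _] := iter_spec k; exact: h.
Qed.

Lemma integral_orbit_mean n :
  (\int[nu]_(x in J) (orbit_mean Ux n phi x)%:E =
   \int[nu]_(x in J) (phi x)%:E)%E.
Proof.
rewrite /orbit_mean; under eq_integral do rewrite EFinM -sumEFin.
have ms k : measurable_fun J (fun x : T => (iter k Ux phi x)%:E).
  by have [h _ _] := iter_spec k; exact/measurable_EFinP.
have s0 k x : J x -> (0 <= (iter k Ux phi x)%:E)%E.
  by have [_ h _] := iter_spec k; rewrite lee_fin; exact: h.
rewrite ge0_integralZl//; last 2 first.
- by apply: emeasurable_sum => k; exact: ms.
- by move=> x Jx; apply: sume_ge0 => k _; exact: s0.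
rewrite ge0_integral_sum//; last by move=> k x; exact: s0.
rewrite (eq_bigr (fun=> \int[nu]_(x in J) (phi x)%:E)%E); last first.
  by move=> k _; have [_ _ ->] := iter_spec k.
have sum_cst (z : \bar R) m : (0 <= z -> \sum_(i < m) z = m%:R%:E * z)%E.
  move=> z0; elim: m => [|m IH]; first by rewrite big_ord0 mul0e.
  by rewrite big_ord_recr /= IH -natr1 EFinD ge0_muleDl ?lee_fin// mul1e.
rewrite sum_cst; last by apply: integral_ge0 => x _; rewrite lee_fin.
by rewrite muleA -EFinM mulVf// mul1e.
Qed.

End orbit_mean_integral.

Lemma unit_interval_tail (nu : probability T R) (e : R) : on_unit_interval nu ->
  0 < e -> exists2 N : R, 0 <= N &
  (nu (J `\` `[unlogc (- N), unlogc N]%classic) <= e%:E)%E.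
Proof.
move=> nuJ e0; pose K (n : nat) : set T := `[unlogc (- n%:R), unlogc (n%:R : R)]%classic.
have KJ n : K n `<=` J.
  move=> x; rewrite /K JP /= in_itv/= => /andP[a b].
  by have := unlogc_range (- n%:R : R); have := unlogc_range (n%:R : R); lra.
have mK n : measurable (K n) by exact: measurable_itv.
have KU : \bigcup_n K n = J.
  apply/seteqP; split => [x [n _ /KJ]//|x /JP x01].
  have lt := truncnS_gt `|logc x|.
  exists (Num.trunc `|logc x|).+1 => //.
  set m := (Num.trunc _).+1 in lt *; rewrite /K /= in_itv/=.
  have : - m%:R <= logc x <= m%:R by rewrite -ler_norml ltW.
  by rewrite -(unlogc_le (- _)) -[X in _ && X]unlogc_le (logcK x01).
have nuK : nu (K n) @[n --> \oo] --> (1 : \bar R)%E.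
  rewrite -nuJ -/J -KU; apply: nondecreasing_cvg_mu => //.
    by rewrite KU.
  move=> n m nm; apply/subsetPset => x; rewrite /K /= !in_itv/= => /andP[a b].
  have nm' : n%:R <= m%:R :> R by rewrite ler_nat.
  apply/andP; split; [apply: le_trans a|apply: le_trans b _]; rewrite unlogc_le//.
  by rewrite lerN2.
have nuK' n : nu (J `\` K n) = (1 - nu (K n))%E.
  rewrite measureD//; last by rewrite (le_lt_trans (probability_le1 _ _)) ?ltry.
  by congr (_ - _)%E; rewrite ?setIidr.
have [n _ /(_ n (leqnn n)) hn] : \forall n \near \oo, (nu (J `\` K n) <= e%:E)%E.
  have : (1 - nu (K n))%E @[n --> \oo] --> (0 : \bar R)%E.
    rewrite -[X in _ --> X](@subee R 1%E)//; apply: cvgeB => //; exact: cvg_cst.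
  move=> /fine_cvgP[fin /cvgrPdist_le /(_ e e0)]; apply: filterS2 fin => n nf.
  rewrite /= sub0r normrN nuK' => h; rewrite -(fineK nf) lee_fin.
  exact: le_trans (ler_norm _) h.
by exists n%:R.
Qed.

(** A stationary law gives [phi] and all its orbit means the same integral. For a suitable [n] the
    mean is within [e] of [c] off a set of mass at most [e], and it takes values in [0, 1]. *)
Lemma integral_eq_limit (nu : probability T R) (phi : R -> R) (F : set_system nat)
    (FU : UltraFilter F) (c : R) :
  on_unit_interval nu -> one_step_stationary x0 y0 p0 p1 nu ->
  measurable_fun setT (phi : T -> R) -> (forall x, 0 <= phi x <= 1) ->
  (forall N e : R, 0 < e -> \forall n \near F, forall u, `|u| <= N ->
     `|orbit_mean Uu n (phi \o unlogc) u - c| <= e) ->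
  (\int[nu]_(x in J) (phi x)%:E = c%:E)%E.
Proof.
move=> nuJ inv mphi phi01 cvg.
have FF := @ultra_proper _ F FU.
have phi0 x : 0 <= phi x by have /andP[] := phi01 x.
have om1 n x : J x -> orbit_mean Ux n phi x <= 1.
  move=> /JP x01; rewrite -(logcK x01) orbit_mean_unlogc.
  rewrite -[leRHS](orbit_mean_cst (g0 x0 y0) (g1 x0 y0) (P01 p_sum1) n 1 (logc x)).
  apply: orbit_mean_le => [u|u|u].
  - by have := p_ge0 (proj2 (JP _) (unlogc_range u)); case.
  - by have := p_ge0 (proj2 (JP _) (unlogc_range u)); case.
  - by have /andP[] := phi01 (unlogc u).
have c01 : 0 <= c <= 1.
  suff h e : 0 < e -> - e <= c <= 1 + e.
    apply/andP; split; apply/ler_addgt0Pr => e /h; lra.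
  move=> e0; have [n /(_ 0)] := filter_ex (cvg 0 e e0).
  rewrite normr0 lexx => /(_ isT); rewrite -orbit_mean_unlogc ler_norml.
  have J0 : J (unlogc 0) by apply/JP; exact: unlogc_range.
  have := om1 n _ J0; have := orbit_mean_ge0 nuJ inv mphi phi0 n J0; lra.
have /andP[c0 c1] := c01.
have Ifin : (0 <= \int[nu]_(x in J) (phi x)%:E <= 1)%E.
  apply/andP; split; first by apply: integral_ge0 => x _; rewrite lee_fin.
  apply: (@le_trans _ _ (\int[nu]_(x in J) (cst 1%E x))%E).
    apply: ge0_le_integral => //=.
    - by move=> x _; rewrite lee_fin.
    - by apply/measurable_EFinP; exact: measurable_funTS.
    - by move=> x _; rewrite lee_fin; have /andP[] := phi01 x.
  by rewrite integral_cst// mul1e; exact: probability_le1.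
have Inum : (\int[nu]_(x in J) (phi x)%:E)%E \is a fin_num.
  by rewrite ge0_fin_numE; case/andP: Ifin => // _ h; exact: le_lt_trans h (ltry _).
rewrite -(fineK Inum); congr _%:E; set z := fine _.
suff main e : 0 < e -> z <= c + 2 * e /\ c <= z + 2 * e.
  apply/eqP; rewrite eq_le; apply/andP; split; apply/ler_addgt0Pr => e e0.
    by have [] := main (e / 2) ltac:(lra); lra.
  by have [] := main (e / 2) ltac:(lra); lra.
move=> e0; have [N N0 Ne] := unit_interval_tail nuJ e0.
have [n hn] := filter_ex (cvg N e e0).
pose D : set T := J `\` `[unlogc (- N), unlogc N]%classic.
have mD : measurable D by apply: measurableD => //; exact: measurable_itv.
have near_c x : J x -> ~ D x -> `|orbit_mean Ux n phi x - c| <= e.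
  move=> Jx nD; have x01 := proj1 (JP x) Jx.
  rewrite -(logcK x01) orbit_mean_unlogc; apply: hn.
  rewrite ler_norml -(unlogc_le (- N)) -(unlogc_le _ N) (logcK x01).
  apply/negP => h; apply: nD; split => //=; rewrite in_itv/= => h'; exact: h.
have Iom := integral_orbit_mean nuJ inv mphi phi0 n.
have mom := measurable_orbit_mean nuJ inv mphi phi0 n.
have om0 x := orbit_mean_ge0 nuJ inv mphi phi0 n (x := x).
have ID : (\int[nu]_(x in J) (\1_D x)%:E <= e%:E)%E.
  by rewrite integral_indic// setIidl// => x [].
have mID : measurable_fun J (fun x : T => (\1_D x : R)%:E).
  by apply/measurable_EFinP; exact: measurable_indic.
have I0 (x : T) : (0 <= (\1_D x : R)%:E)%E by exact: indic_ge0.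
have Icst (k : R) : (\int[nu]_(x in J) (cst k%:E x) = k%:E)%E.
  by rewrite integral_cst// -[RHS]mule1; congr (_ * _)%E.
split.
- rewrite -lee_fin fineK// -Iom.
  apply: (@le_trans _ _ (\int[nu]_(x in J) (cst (c + e)%:E x + (\1_D x)%:E))%E).
    apply: ge0_le_integral => //.
    + exact/measurable_EFinP.
    + by apply: emeasurable_funD.
    + move=> x Jx /=; rewrite -EFinD lee_fin indicE.
      have [xD|/negP xD] := boolP (x \in D); first by have := om1 n x Jx; rewrite /=; lra.
      have := near_c x Jx; rewrite -[D x]inE => /(_ xD); rewrite ler_norml /=; lra.
  rewrite ge0_integralD//; last by move=> x _; rewrite lee_fin; lra.
  rewrite Icst; apply: le_trans (leeD2l _ ID) _.
  by rewrite -EFinD lee_fin; lra.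
- rewrite -lee_fin EFinD fineK// -Iom -Icst.
  apply: (@le_trans _ _ (\int[nu]_(x in J) ((orbit_mean Ux n phi x)%:E + (e%:E + (\1_D x)%:E)))%E).
    apply: ge0_le_integral => //.
    + apply: emeasurable_funD; first exact/measurable_EFinP.
      exact: emeasurable_funD.
    + move=> x Jx /=; rewrite -!EFinD lee_fin indicE.
      have := om0 x Jx.
      have [xD|/negP xD] := boolP (x \in D); first by rewrite /=; lra.
      have := near_c x Jx; rewrite -[D x]inE => /(_ xD); rewrite ler_norml /=; lra.
  rewrite ge0_integralD//; last 3 first.
  + exact/measurable_EFinP.
  + by move=> x Jx; rewrite adde_ge0// lee_fin ltW.
  + by apply: emeasurable_funD.
  rewrite leeD2l// ge0_integralD//; last by move=> x _; rewrite lee_fin ltW.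
  by rewrite -/(cst e%:E) Icst; apply: le_trans (leeD2l _ ID) _; rewrite -EFinD lee_fin; lra.
Qed.

Lemma f0_lip x y : 0 < x < 1 -> 0 < y < 1 ->
  `|f0 x - f0 y| <= slope1 x0 y0 * `|x - y|.
Proof.
wlog xy : x y / x <= y => [h|] x01 y01.
  have [xy|/ltW yx] := leP x y; first exact: h.
  by rewrite distrC [`|x - y|]distrC; exact: h.
have [a0 a1 a2] := slope0_bounds x0y0; have [b0 b1] := slope1_bounds x0y0.
rewrite distrC [`|x - y|]distrC !ger0_norm ?subr_ge0//; last exact: f0_le.
have h (u v : R) : u <= v -> slope0 x0 y0 * (v - u) <= slope1 x0 y0 * (v - u).
  by move=> uv; rewrite ler_wpM2r//; lra.
rewrite /Defs.f0; case: (leP x x0) => hx; case: (leP y x0) => hy.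
- by have := h x y xy; lra.
- by have := h x x0 hx; lra.
- by lra.
- by lra.
Qed.

Lemma f1_lip x y : 0 < x < 1 -> 0 < y < 1 ->
  `|f1 x - f1 y| <= slope1 x0 y0 * `|x - y|.
Proof.
move=> x01 y01; rewrite /Defs.f1.
have -> : 1 - f0 (1 - x) - (1 - f0 (1 - y)) = - (f0 (1 - x) - f0 (1 - y)) by ring.
have -> : x - y = - ((1 - x) - (1 - y)) by ring.
by rewrite !normrN; apply: f0_lip; lra.
Qed.

Section existence.
Variables (F : set_system nat) (FU : UltraFilter F).
Hypothesis F_oo : F --> \oo.

Let FF : ProperFilter F := ultra_proper.

(** The limiting mean occupation functional of the chain started at 1/2, whose coordinate is 0. *)
Definition orbit_limit (f : R -> R) : R :=
  ulim F (fun n => orbit_mean Uu n (f \o unlogc) 0).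

Let P0_ge0 u : 0 <= P0 p0 u.
Proof. by have [] := p_ge0 (proj2 (JP _) (unlogc_range u)). Qed.

Let P1_ge0 u : 0 <= P1 p1 u.
Proof. by have [] := p_ge0 (proj2 (JP _) (unlogc_range u)). Qed.

Let comp_bound f : has_bound f ->
  orbit_mean Uu n (f \o unlogc) 0 @[n --> F] --> orbit_limit f.
Proof.
move=> [M fM].
by apply: (orbit_mean_cvg P0_ge0 P1_ge0 (P01 p_sum1) FU (M := M)) => u /=.
Qed.

Let orbit_limit1 : orbit_limit (fun=> 1) = 1.
Proof.
rewrite /orbit_limit /ulim; apply/cvg_lim => //.
rewrite (_ : (fun n => _) = fun=> 1); first exact: cvg_cst.
by apply/funext => n; exact: orbit_mean_cst (P01 p_sum1) _ _ _.
Qed.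

Let orbit_limitD f g : has_bound f -> has_bound g ->
  orbit_limit (f \+ g) = orbit_limit f + orbit_limit g.
Proof.
move=> bf bg; rewrite {1}/orbit_limit /ulim; apply/cvg_lim => //.
rewrite (_ : (fun n => _) = (fun n => orbit_mean Uu n (f \o unlogc) 0) \+
  (fun n => orbit_mean Uu n (g \o unlogc) 0)).
  by apply: cvgD; exact: comp_bound.
by apply/funext => n /=; rewrite -orbit_meanD.
Qed.

Let orbit_limitZ (k : R) f : has_bound f ->
  orbit_limit (fun x => k * f x) = k * orbit_limit f.
Proof.
move=> bf; rewrite {1}/orbit_limit /ulim; apply/cvg_lim => //.
rewrite (_ : (fun n => _) = (fun n => k * orbit_mean Uu n (f \o unlogc) 0)).
  by apply: cvgMr; exact: comp_bound.
by apply/funext => n /=; rewrite -orbit_meanZ.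
Qed.

Let orbit_limit_le f g : has_bound f -> has_bound g ->
  (forall x, 0 < x < 1 -> f x <= g x) -> orbit_limit f <= orbit_limit g.
Proof.
move=> bf bg fg; apply: ler_lim.
- by apply: cvgP; exact: comp_bound.
- by apply: cvgP; exact: comp_bound.
- apply: nearW => n; apply: orbit_mean_le => // u /=.
  by apply: fg; exact: unlogc_range.
Qed.

Let orbit_limit_tight e : 0 < e -> exists2 d, 0 < d < 1 &
  orbit_limit (fun x => (x <= d)%R%:R) <= e /\
  orbit_limit (fun x => (1 - d <= x)%R%:R) <= e.
Proof.
move=> e0; have [N hN] := log_chain_tight p_sum1 x0y0 p_dini p_gt0 Lambda_gt0 e0.
exists (unlogc (- (`|N| + 1))); first exact: unlogc_range.
have nN := ler_norm N; have nN0 := normr_ge0 N.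
have tail (P : R -> bool) : (forall u, P (unlogc u) -> N < `|u|) ->
    orbit_limit (fun x => (P x)%:R) <= e.
  move=> hP; apply: limr_le; first by apply: cvgP; apply: comp_bound; exact: bounded_bool.
  apply: nearW => n; apply: le_trans (hN n); apply: orbit_mean_le => // u /=.
  by rewrite ler_nat; have := hP u; case: (P _) => // ->.
split; apply: tail => u.
  by rewrite unlogc_le => h; have := ler_norm (- u); rewrite normrN; lra.
by rewrite unlogcN opprB addrC subrK unlogc_le => h; have := ler_norm u; lra.
Qed.

(** One step of averaging, cut off outside ]0, 1[ because the weights are arbitrary off [0, 1] and a
    bounded function is wanted. *)
Let psi (phi : R -> R) : R -> R := fun x => if 0 < x < 1 then Ux phi x else 0.

Let orbit_limit_psi phi : has_bound phi -> orbit_limit (psi phi) = orbit_limit phi.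
Proof.
move=> bphi; have [M phiM] := bphi.
have psiE : psi phi \o unlogc = Uu (phi \o unlogc).
  apply/funext => u /=; rewrite /psi unlogc_range /Ux /Uu /averaging /=.
  by rewrite g0E// g1E.
rewrite {1}/orbit_limit /ulim psiE; apply/cvg_lim => //.
apply: (orbit_mean_shift_cvg P0_ge0 P1_ge0 (P01 p_sum1) FU F_oo (M := M)).
  by move=> u /=.
exact: comp_bound.
Qed.

(** The functional does not change under one step of averaging. To carry this over to the measure,
    the averaged ramp must itself be uniformly continuous on ]0, 1[, which comes from the continuity
    of [p0] and the Lipschitz bounds on the maps. *)
Lemma stationary_exists : exists2 mu : probability T R,
  on_unit_interval mu & one_step_stationary x0 y0 p0 p1 mu.
Proof.
pose mu := quantile_measure orbit_limit.
have muJ : on_unit_interval mu := quantile_measure_itv orbit_limit1 orbit_limitD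
  orbit_limit_le orbit_limit_tight.
exists mu => //.
apply: (invariant_of_ramps measurable_p0 p_sum1 p_gt0 x0y0 muJ) => n a.
have r01 x := ramp_range n a x.
have rb : has_bound (ramp n a).
  by exists 1 => x; have := r01 x; rewrite ler_norml; lra.
have n0 : 0 <= n%:R :> R by exact: ler0n.
have [s0 s1] := slope1_bounds x0y0.
have psi01 x : 0 <= psi (ramp n a) x <= 1.
  rewrite /psi; case: ifP => [x01|_]; last by rewrite lexx ler01.
  have [q0 q1] := p_ge0 (proj2 (JP _) x01); have := @p_sum1 x.
  have h0 := r01 (f0 x); have h1 := r01 (f1 x).
  move=> /(_ ltac:(lra)) h; rewrite /Ux /averaging.
  rewrite addr_ge0/= ?mulr_ge0//; [|lra|lra].
  by apply: convex_le => //; lra.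
have psiM : measurable_fun setT (psi (ramp n a) : T -> R).
  rewrite (_ : psi (ramp n a) = (Ux (ramp n a) : T -> R) \_ J); last first.
    by apply/funext => x; rewrite patchE inJ.
  apply/measurable_restrict => //; rewrite setTI /Ux /averaging.
  have mr := measurable_ramp n a.
  apply: measurable_funD; apply: measurable_funM.
  - exact: measurable_p0.
  - by apply: measurable_funTS; apply: (measurableT_comp mr); exact: measurable_f0.
  - exact: measurable_p1.
  - by apply: measurable_funTS; apply: (measurableT_comp mr); exact: measurable_f1.
have ruc e : 0 < e -> exists2 d, 0 < d & forall x y, 0 < x < 1 -> 0 < y < 1 ->
    `|x - y| <= d -> `|ramp n a x - ramp n a y| <= e.
  move=> e0; exists (e / (n%:R + 1)); first by rewrite divr_gt0//; lra.
  move=> x y _ _ xy; apply: le_trans (ramp_lip n a x y) _.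
  apply: (@le_trans _ _ ((n%:R + 1) * `|x - y|)); first by rewrite ler_wpM2r//; lra.
  by rewrite mulrC -ler_pdivlMr//; lra.
have psi_uc e : 0 < e -> exists2 d, 0 < d & forall x y, 0 < x < 1 -> 0 < y < 1 ->
    `|x - y| <= d -> `|psi (ramp n a) x - psi (ramp n a) y| <= e.
  move=> e0; have [d d0 hd] := p0_uniformly_continuous p_dini p_gt0 (e := e / 4) ltac:(lra).
  have [d' d'0 hd'] := ruc (e / 2) ltac:(lra).
  exists (Num.min d (d' / slope1 x0 y0)).
    by rewrite lt_min d0 divr_gt0//; lra.
  move=> x y x01 y01; rewrite le_min => /andP[xyd xyd'].
  rewrite /psi x01 y01 /Ux.
  have pp := hd x y x01 y01 xyd.
  have sxy : slope1 x0 y0 * `|x - y| <= d' by rewrite mulrC -ler_pdivlMr//; lra.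
  have r0 := hd' _ _ (f0_range x0y0 x01) (f0_range x0y0 y01) (le_trans (f0_lip x01 y01) sxy).
  have r1 := hd' _ _ (f1_range x0y0 x01) (f1_range x0y0 y01) (le_trans (f1_lip x01 y01) sxy).
  have [q0 q1] := p_ge0 (proj2 (JP _) x01).
  have cc (w : R) : 0 < w < 1 -> 0 <= w <= 1 by move=> /andP[/ltW-> /ltW->].
  have px := p_sum1 (cc _ x01); have py := p_sum1 (cc _ y01).
  rewrite /averaging.
  (* Variation of the weights first, at fixed [y], then that of the ramps; [p1 = 1 - p0] merges the
     two weight differences. *)
  have -> : p0 x * ramp n a (f0 x) + p1 x * ramp n a (f1 x) -
      (p0 y * ramp n a (f0 y) + p1 y * ramp n a (f1 y)) =
    (p0 x - p0 y) * (ramp n a (f0 y) - ramp n a (f1 y)) +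
    (p0 x * (ramp n a (f0 x) - ramp n a (f0 y)) +
     p1 x * (ramp n a (f1 x) - ramp n a (f1 y))).
    have -> : p1 x = 1 - p0 x by rewrite -px addrAC subrr add0r.
    have -> : p1 y = 1 - p0 y by rewrite -py addrAC subrr add0r.
    ring.
  have h2 := convex_norm_le q0 q1 px r0 r1.
  apply: le_trans (ler_normD _ _) _; rewrite normrM.
  have h3 : `|ramp n a (f0 y) - ramp n a (f1 y)| <= 1.
    by have := r01 (f0 y); have := r01 (f1 y); rewrite ler_norml; lra.
  have := ler_pM (normr_ge0 _) (normr_ge0 _) pp h3; lra.
have mr := measurable_ramp n a.
have e1 : (\int[mu]_(x in J) (psi (ramp n a) x)%:E = (orbit_limit (psi (ramp n a)))%:E)%E.
  apply: (quantile_measure_integral orbit_limit1 orbit_limitD orbit_limitZ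
    orbit_limit_le orbit_limit_tight) => //.
  - by move=> x; have /andP[] := psi01 x.
  - by exists 1 => x; have := psi01 x; rewrite ler_norml; lra.
have e2 : (\int[mu]_(x in J) (ramp n a x)%:E = (orbit_limit (ramp n a))%:E)%E.
  apply: (quantile_measure_integral orbit_limit1 orbit_limitD orbit_limitZ
    orbit_limit_le orbit_limit_tight) => //.
  by move=> x; have /andP[] := r01 x.
rewrite e2 -(orbit_limit_psi rb) -e1; apply: eq_integral => x; rewrite inJ => x01.
by rewrite /psi x01 /Ux /averaging EFinD !EFinM.
Qed.

End existence.

(** The constant [c] depends on the ramp and on [F], not on the law, so all stationary laws
    integrate every ramp alike. *)
Lemma stationary_unique (mu nu : probability T R) :
  on_unit_interval mu -> one_step_stationary x0 y0 p0 p1 mu ->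
  on_unit_interval nu -> one_step_stationary x0 y0 p0 p1 nu ->
  forall A, measurable A -> nu A = mu A.
Proof.
move=> muJ imu nuJ inu; have [F [FU Foo]] := @ultraFilterLemma nat \oo _.
apply: ramp_determines => [|n a]; first by apply: le_lt_trans (ltry 1); exact: probability_le1.
have r01 x := ramp_range n a x.
have mr := measurable_ramp n a.
have rM u : `|(ramp n a \o @unlogc R) u| <= 1.
  by have := r01 (unlogc u); rewrite ler_norml /=; lra.
have rL u w : `|(ramp n a \o @unlogc R) u - (ramp n a \o @unlogc R) w| <= n%:R * `|u - w|.
  apply: le_trans (ramp_lip _ _ _ _) _; rewrite ler_wpM2l ?ler0n//.
  exact: unlogc_dist.
have [c hc] := log_chain_cvg_cst p_sum1 x0y0 p_dini p_gt0 Lambda_gt0 FU Foo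
  (ler0n _ n) rM rL.
have Eramp (la : probability T R) : on_unit_interval la ->
    one_step_stationary x0 y0 p0 p1 la -> (\int[la]_x (ramp n a x)%:E = c%:E)%E.
  move=> laJ ila; rewrite (integral_unit_interval laJ (h := EFin \o ramp n a)).
  - exact: (integral_eq_limit FU laJ ila mr r01 hc).
  - exact/measurable_EFinP.
  - by move=> x; rewrite lee_fin; have /andP[] := r01 x.
by rewrite !Eramp.
Qed.

End stationary_measures.

Unset Implicit Arguments.

Theorem theorem1 (R : realType) (x0 y0 : R) (p0 p1 : R -> R)
  (p_sum1 : forall x, 0 <= x <= 1 -> p0 x + p1 x = 1)
  (A1 : 1 / 2 < x0 < 1 /\ 1 / 2 <= y0 < x0)
  (A2 : dini_continuous p0 p1)
  (A3 : forall x, 0 <= x <= 1 -> 0 < p0 x < 1 /\ 0 < p1 x < 1)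
  (A4 : 0 < Lambda0 x0 y0 p0 p1 /\ 0 < Lambda1 x0 y0 p0 p1) :
  exists mu : probability (measurableTypeR R) R,
    [/\ on_unit_interval mu,
        stationary x0 y0 p0 p1 mu &
        forall nu : probability (measurableTypeR R) R,
          on_unit_interval nu -> stationary x0 y0 p0 p1 nu ->
          forall A : set (measurableTypeR R),
            measurable A -> nu A = mu A].
Proof.
have [F [FU F_oo]] := @ultraFilterLemma nat \oo _.
have [mu muJ mu_st] := stationary_exists p_sum1 A1 A2 A3 A4 FU F_oo.
exists mu; split=> //; first exact/(stationaryP p_sum1 A1 A2 A3 muJ).
move=> nu nuJ /(stationaryP p_sum1 A1 A2 A3 nuJ) nu_st.
exact: (stationary_unique p_sum1 A1 A2 A3 A4 muJ mu_st nuJ nu_st).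
Qed.
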